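(* Let $T_n$ be the fractional split tree with $n$ balls and parameters $b,s,s_0,s_1$ and split vector $\mathcal V=(V_1,\dots,V_b)$, and let $\beta$ and $d$ be as in the context. Let $\phi$ be a toll function such that $\phi_n=O(n^{\beta-\delta})$ for some $\delta>0$. (This holds for example for counting leaves, $\phi(T)=\mathbf 1(T\text{ is a single node})$; for counting nodes, $\phi\equiv 1$; and for counting fringe subtrees with a given number $k$ of balls, $\phi=\delta_k$.) Then there exists a bounded, continuous, $d$-periodic function $\varpi=\varpi[\phi]:\mathbb R\to\mathbb R$ such that, as $n\to\infty$, $$\mathbb E[X_n(\phi)]=\varpi(\ln n)\,n^\beta+o(n^\beta).$$ In the nonlattice case, $\varpi$ is constant. If moreover $\phi_n\ge 0$ for all $n$ and $\phi_n>0$ for some $n\ge s_1$, then $\varpi$ is bounded away from $0$. (For split trees, $\beta=1$.)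
   Context: Fractional split trees. Fix integers $b\ge2$, $s\ge1$, $s_0\ge0$, $s_1\ge0$ with $0\le bs_1\le s+1-s_0$, and a random vector $\mathcal V=(V_1,\dots,V_b)$ (the split vector) with $V_i\ge0$ and $\sum_{i=1}^bV_i\le1$; if $\sum_iV_i=1$ a.s. the model is called a split tree. Let $V_{(1)}\ge\dots\ge V_{(b)}$ be the entries of $\mathcal V$ in decreasing order. Standing assumptions: $\mathbb P(V_{(1)}=1)<1$, $\mathbb P(V_{(b)}>0)>0$ and $\sum_{i=1}^b\mathbb P(V_i>0)>1$. Nodes are the finite words over $[b]=\{1,\dots,b\}$, i.e. elements of $[b]^*=\bigcup_{m\ge0}[b]^m$; the root is the empty word and the children of $v$ are $v1,\dots,vb$. Every node $u$ receives an independent copy $\mathcal V^{(u)}$ of $\mathcal V$. The tree with $n\ge1$ balls is described by counts $n_v$, $v\in[b]^*$: the root has count $n$; if $n_v\le s$, all proper descendants of $v$ have count $0$; if $n_v>s$, then conditionally on $n_v$ and $\mathcal V^{(v)}=(V_1,\dots,V_b)$, $(n_{v1},\dots,n_{vb})$ is distributed as the first $b$ coordinates of $\mathrm{Mult}\bigl(n_v-s_0-bs_1;\,V_1,\dots,V_b,1-\sum_iV_i\bigr)+(s_1,\dots,s_1,0)$, with the usual independence between different subtrees. $T_n$ is the set of nodes $v$ with $n_v>0$ (together with the ball counts); $T_0$ is empty. For $v\in T_n$, the fringe subtree $T_n^v$ is $v$ together with all its descendants in $T_n$; conditionally on $n_v=m$ it is distributed as $T_m$. Additive functionals. A toll function $\phi$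 is a real-valued function on trees with balls. Put $\phi_m=\mathbb E[\phi(T_m)]$ for $m\ge1$ and $X_n(\phi)=\sum_{v\in T_n}\phi(T_n^v)$. For $k\ge1$, $\delta_k$ is the toll function $\delta_k(T)=\mathbf 1(T\text{ has }k\text{ balls})$, so $X_n(\delta_k)=\#\{v\in T_n:n_v=k\}$. Parameters. $\beta\in(0,1]$ is the unique number with $\mathbb E\sum_{i=1}^bV_i^\beta=1$. $V:=V_I$ with $I$ uniform on $[b]$ independent of $\mathcal V$. The lattice case is that there is $d>0$ with $\ln V\in d\mathbb Z$ a.s. on $\{V>0\}$; then $d$ denotes the largest such number. Otherwise we are in the nonlattice case and $d:=0$. *)

(* Defs.v *)
From HB Require Import structures.
From mathcomp Require Import all_boot all_order all_algebra.
From mathcomp Require Import all_classical all_reals all_analysis.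

Set Implicit Arguments.
Unset Strict Implicit.
Unset Printing Implicit Defensive.

Import Order.TTheory GRing.Theory Num.Theory.
Import numFieldNormedType.Exports.

Local Open Scope classical_set_scope.
Local Open Scope ring_scope.

Definition node (b : nat) := seq 'I_b.

(* A tree with balls is encoded by its counts: [t v] is the number of balls in
   the subtree rooted at [v], so that [t [::]] is the total number of balls and
   the vertices of the tree are the words with a positive count.  The trees of
   [split_tree_model] below have finitely many vertices. *)
Definition btree (b : nat) := node b -> nat.

Definition nodes b (t : btree b) : set (node b) := [set v | (0 < t v)%N].

(* The vertices of the fringe subtree are renamed so that its root is [::]. *)
Definition fringe b (t : btree b) (v : node b) : btree b := fun w => t (v ++ w).

Definition toll (R : realType) (b : nat) := btree b -> R.

Definition additive_functional (R : realType) b (phi : toll R b) (t : btree b) : R :=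
  \sum_(v \in nodes t) phi (fringe t v).

Definition toll_leaf (R : realType) b : toll R b :=
  fun t => (`[< nodes t = [set [::]] >])%:R.

Definition toll_one (R : realType) b : toll R b := fun=> 1.

Definition toll_delta (R : realType) b (k : nat) : toll R b :=
  fun t => (t [::] == k)%:R.

Section split_vector.
Context {d0 : measure_display} {S : measurableType d0} {R : realType}.
Context {P0 : probability S R} {b : nat}.
Variable V : {RV P0 >-> b.-tuple R}.

Definition order_stat (i : nat) (x : S) : R :=
  nth 0 (sort (fun y z : R => z <= y) (V x)) i.

Record split_vector : Prop := SplitVector {
  split_vector_ge0 : {ae P0, forall x, forall i : 'I_b, 0 <= tnth (V x) i} ;
  split_vector_sum : {ae P0, forall x, \sum_(i < b) tnth (V x) i <= 1} ;
  split_vector_max : (P0 [set x | order_stat 0 x = 1%R] < 1)%E ;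
  split_vector_min : (0 < P0 [set x | (0 < order_stat b.-1 x)%R])%E ;
  split_vector_pos : (1 < \sum_(i < b) P0 [set x | (0 < tnth (V x) i)%R])%E }.

(* Law of V_I with I uniform on 'I_b and independent of V. *)
Definition law_VI (A : set R) : \bar R :=
  (\sum_(i < b) (b%:R^-1)%:E * P0 [set x | A (tnth (V x) i)])%E.

(* ln V_I belongs to dZ almost surely on {V_I > 0} *)
Definition lattice_with (d : R) : Prop :=
  law_VI [set y | 0 < y /\ ~ exists k : int, ln y = d * k%:~R] = 0%E.

Definition lattice : Prop := exists d, 0 < d /\ lattice_with d.

Definition is_span (d : R) : Prop :=
  [/\ 0 < d, lattice_with d & forall d', 0 < d' -> lattice_with d' -> d' <= d]
  \/ (~ lattice /\ d = 0).

End split_vector.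

(* [multinomial_prob m p k] is the probability that the first b coordinates of
   Mult(m; p_1, .., p_b, 1 - sum_i p_i) are k_1, .., k_b. *)
Definition multinomial_prob (R : realType) (b m : nat) (p : 'I_b -> R)
    (k : 'I_b -> nat) : R :=
  let r := (\sum_(i < b) k i)%N in
  if (r <= m)%N then
    (m`!)%:R / ((\prod_(i < b) (k i)`!) * (m - r)`!)%N%:R
    * (\prod_(i < b) p i ^+ k i) * (1 - \sum_(i < b) p i) ^+ (m - r)
  else 0.

(* Probability that the children of a node with m balls and split vector p
   have counts c. *)
Definition split_prob (R : realType) (b s s0 s1 m : nat) (p : b.-tuple R)
    (c : 'I_b -> nat) : R :=
  if (m <= s)%N then [forall i, c i == 0%N]%:R
  else if [forall i, (s1 <= c i)%N] then
    multinomial_prob (m - s0 - b * s1) (tnth p) (fun i => (c i - s1)%N)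
  else 0.

Section split_tree.
Context {d0 d1 : measure_display}.
Context {S : measurableType d0} {Omega : measurableType d1} {R : realType}.
Context {P0 : probability S R} {P : probability Omega R} {b : nat}.
Variable V : {RV P0 >-> b.-tuple R}.
Variables (s s0 s1 n : nat).
Variables (W : node b -> {RV P >-> b.-tuple R}) (T : Omega -> btree b).

(* sigma-algebra generated by all split vectors and by the counts at depth at
   most k *)
Definition history (k : nat) : set (set Omega) :=
  <<s [set E | (exists u B, measurable B /\ E = W u @^-1` B) \/
               (exists v m, (size v <= k)%N /\ E = [set w | T w v = m])] >>.

(* [W u] is the split vector attached to the node u and [T] the random tree
   with n balls. The last field says that, conditionally on [history k], the
   vectors of counts of the children of the different nodes v of depth k are
   independent, with law [split_prob] at the values of n_v and [W v].
   [T] is almost surely finite; it is taken to be finite everywhere, i.e. a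
   random element of the countable set of finite trees, so that every toll
   function of it is measurable. *)
Record split_tree_model : Prop := SplitTreeModel {
  split_tree_measurable : forall v m, measurable [set w | T w v = m] ;
  split_tree_finite : forall w, finite_set (nodes (T w)) ;
  split_tree_copies : forall u B, measurable B ->
    P (W u @^-1` B) = P0 (V @^-1` B) ;
  split_tree_indep : forall (us : seq (node b)) (B : node b -> set (b.-tuple R)),
    uniq us -> (forall u, measurable (B u)) ->
    P (\bigcap_(u in [set` us]) (W u @^-1` B u)) =
    (\prod_(u <- us) P (W u @^-1` B u))%E ;
  split_tree_root : forall w, T w [::] = n ;
  split_tree_children :
    forall (k : nat) (E : set Omega) (c : k.-tuple 'I_b -> 'I_b -> nat),
    history k E ->
    P (E `&` [set w | forall (v : k.-tuple 'I_b) i, T w (rcons v i) = c v i]) =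
    (\int[P]_(w in E)
       (\prod_(v : k.-tuple 'I_b) split_prob s s0 s1 (T w v) (W v w) (c v))%:E)%E }.

End split_tree.

(* Main.v *)
Require Import Defs.
From HB Require Import structures.
From mathcomp Require Import all_boot all_order all_algebra.
From mathcomp Require Import all_classical all_reals all_analysis.
From mathcomp Require Import measurable_realfun.
From mathcomp Require Import ring lra zify.

Set Implicit Arguments.
Unset Strict Implicit.
Unset Printing Implicit Defensive.

Import Order.TTheory GRing.Theory Num.Theory.
Import numFieldNormedType.Exports.

Local Open Scope classical_set_scope.
Local Open Scope ring_scope.

(** The expectations x_n of the additive functional satisfy x_n = phi_n + a_n(x), where a_n
averages x over the numbers of balls of the children of the root: conditionally on the
split vector these are binomial with parameters n - c and V_i, shifted by s1, where
c = s0 + b s1. Replacing a binomial number by its mean turns this recursion into the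
multiplicative renewal equation y(t) = E sum_i y(t V_i) + error, which is solved by t^beta
up to oscillation. The proof is elementary renewal theory for g(t) = y(t) / t^beta, based on
comparison with explicit barriers instead of a renewal theorem.

The expectation E sum_i F(V_i) enters as a linear monotone functional I with I(v^beta) = 1
([intensity], [renewal_kernel]). The measure v^beta I is the law of the steps of a random
walk on a logarithmic scale. A maximum principle ([renewal_comparison]) and the fact that
I(v^gamma) > 1 for gamma < beta yield [renewal_persistence]: an approximate subsolution
that is small, relative to t^beta, on one long window stays small to the right of it. Three
applications follow. A solution and its dilations are close, so that g is uniformly
continuous on a multiplicative scale ([normalized_uniform_cont]). By the argument of Choquet
and Deny, g(t) - g(t a) tends to 0 for every a in the support of the law of the V_i
([support_asymptotic_period]): a gap that is nearly maximal is propagated along a geometric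
progression, against the boundedness of g. And g satisfies a Cauchy criterion along the
orbits of the group of these asymptotic periods ([renewal_cauchy]). This group is closed;
so in the nonlattice case it contains all positive numbers, and in the lattice case it
contains e^d ([walk_orbits_nonlattice], [walk_orbits_lattice]). The limits
of g along the progressions e^(z + k d) define the periodic function ([periodic_limit]).

To apply this to x, the tolls are first truncated to finite support; the error is a small
multiple of n^beta because n^beta minus a lower power is a strict supersolution of the
recursion ([supersol_exists], [truncation_approx]). For tolls of finite support the
increments of x satisfy the recursion with the weight V_i, which makes x Lipschitz as a
function of n^theta for some theta < beta + 1/2 ([solution_dist]); the fluctuations of
the binomial variables then cost less than n^beta ([solution_approx_renewal]). If some
phi_m > 0 with m >= s1, then every large node has a child with m balls with positive
probability, and a subsolution of order n^beta fits below x ([solution_lower_bound]).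

The recursion itself needs that the fringe subtree of a child of the root, given that it has
m balls, is distributed as the tree with m balls. Conditionally on all split vectors the tree
is a Markov chain along the generations; integrating out the split vectors generation by
generation ([law_upto]) shows that the probabilities of finite trees are products of
averaged transition probabilities, which are the same for the fringe subtree and for the
tree with m balls ([child_law]). The expectations are finite because the contributions of
the first K generations are bounded in K: the probability that a node passes all its balls on
to one child leads to a coefficient less than 1 ([additive_finite], [additive_solution]). *)

(** * Powers and binomial expectations *)

Section powers.
Variable R : realType.
Implicit Types (a t x y th : R).

Lemma powR_1x x : 1 `^ x = 1 :> R. Proof. by rewrite powR1. Qed.

Lemma powRV a x : 0 <= a -> a^-1 `^ x = a `^ (- x).
Proof. by move=> a0; rewrite -powR_inv1// -powRrM mulN1r. Qed.

Lemma powR_le_tangent1 th t : 0 <= th -> th <= 1 -> 0 <= t ->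
  t `^ th <= 1 + th * (t - 1).
Proof.
move=> th0 th1 t0.
have [->|th_neq0] := eqVneq th 0; first by rewrite powRr0 mul0r addr0.
have [->|th_neq1] := eqVneq th 1; first by rewrite powRr1//; lra.
have thp : 0 < th by rewrite lt_neqAle eq_sym th_neq0.
have thq : 0 < 1 - th by rewrite subr_gt0 lt_neqAle th_neq1.
have := @conjugate_powR _ (t `^ th) 1 th^-1 (1 - th)^-1 (powR_ge0 _ _) ler01.
rewrite !invr_gt0 !invrK mulr1 => /(_ thp thq).
have -> : (t `^ th) `^ th^-1 = t by rewrite -powRrM mulfV// powRr1.
have -> : 1 `^ (1 - th)^-1 = 1 :> R by rewrite powR1.
move=> h; have : t `^ th <= t * th + 1 * (1 - th) by apply: h; ring.
lra.
Qed.

Lemma powR_le_tangent th a t : 0 <= th -> th <= 1 -> 0 < a -> 0 <= t ->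
  t `^ th <= a `^ th + th * a `^ (th - 1) * (t - a).
Proof.
move=> th0 th1 a0 t0.
have ap : 0 < a `^ th by exact: powR_gt0.
have aV : a^-1 `^ th = (a `^ th)^-1.
  by rewrite -[in LHS]powR_inv1 ?(ltW a0)// -powRrM mulN1r powRN.
have /(powR_le_tangent1 th0 th1) : 0 <= t / a by rewrite divr_ge0// ltW.
rewrite powRM ?invr_ge0 ?(ltW a0)// aV ler_pdivrMr// => /le_trans; apply.
have -> : a `^ (th - 1) = a `^ th / a.
  rewrite powRB; last by rewrite (gt_eqF a0) implybT.
  by rewrite powRr1 ?ltW.
rewrite le_eqVlt; apply/orP; left; apply/eqP; field.
by rewrite gt_eqF.
Qed.

Lemma powR_dist1 th t : 0 <= th -> th <= 1 -> 0 <= t ->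
  `|t `^ th - 1| <= `|t - 1|.
Proof.
move=> th0 th1 t0; have [t1|t1] := leP 1 t.
  rewrite !ger0_norm ?subr_ge0//; last first.
    by rewrite -[leLHS](powRr0 t) ler_powR.
  rewrite lerD2r -[leRHS]powRr1//; exact: ler_powR.
have [->|tn0] := eqVneq t 0.
  have [->|thn] := eqVneq th 0; first by rewrite powRr0 subrr normr0.
  by rewrite powR0.
have tp : 0 < t by rewrite lt_neqAle eq_sym tn0.
rewrite !ler0_norm ?subr_le0 ?(ltW t1)//; last first.
  by rewrite -[leRHS](powRr0 t) ger_powR// tp ltW.
rewrite lerN2 lerD2r -[leLHS]powRr1//; apply: ger_powR => //.
by rewrite tp ltW.
Qed.

(** The homogeneous form of [powR_dist1]; its weight a^(th - 1) is what gains half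
a power when t deviates from a by the square root of a. *)
Lemma powR_dist th a t : 0 <= th -> th <= 1 -> 0 < a -> 0 <= t ->
  `|t `^ th - a `^ th| <= a `^ (th - 1) * `|t - a|.
Proof.
move=> th0 th1 a0 t0.
have ap : 0 < a `^ th by exact: powR_gt0.
have ta0 : 0 <= t / a by rewrite divr_ge0// ltW.
have -> : t `^ th - a `^ th = a `^ th * ((t / a) `^ th - 1).
  have aV : a^-1 `^ th = (a `^ th)^-1.
    by rewrite -[in LHS]powR_inv1 ?(ltW a0)// -powRrM mulN1r powRN.
  by rewrite powRM ?invr_ge0 ?(ltW a0)// aV; field; rewrite gt_eqF.
have -> : t - a = a * (t / a - 1) by field; rewrite gt_eqF.
have -> : a `^ (th - 1) = a `^ th / a.
  rewrite powRB; last by rewrite (gt_eqF a0) implybT.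
  by rewrite powRr1 ?ltW.
rewrite !normrM (gtr0_norm ap) (gtr0_norm a0) mulrA divfK ?gt_eqF//.
by rewrite ler_wpM2l ?powR_ge0// powR_dist1.
Qed.

Lemma powR_subadd th x y : 0 < th -> th <= 1 -> 0 <= x -> 0 <= y ->
  (x + y) `^ th <= x `^ th + y `^ th.
Proof.
move=> th0 th1 x0 y0.
have [/eqP|xyn] := eqVneq (x + y) 0.
  rewrite paddr_eq0// => /andP[/eqP -> /eqP ->].
  by rewrite addr0 powR0 ?gt_eqF// addr0.
have xy : 0 < x + y by rewrite lt_neqAle eq_sym xyn addr_ge0.
have key z : 0 <= z -> z <= x + y ->
    z / (x + y) <= z `^ th / (x + y) `^ th.
  move=> z0 zxy.
  have [->|zn] := eqVneq z 0; first by rewrite mul0r powR0 ?gt_eqF// mul0r.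
  have zp : 0 < z by rewrite lt_neqAle eq_sym zn.
  rewrite -powRN.
  have -> : (x + y) `^ (- th) = ((x + y)^-1) `^ th.
    by rewrite -[in RHS]powR_inv1 ?ltW// -powRrM mulN1r.
  rewrite -powRM ?invr_ge0 ?(ltW xy)//.
  apply: ger1_powR => //; rewrite divr_gt0//=.
  by rewrite ler_pdivrMr// mul1r.
have := lerD (key x x0 _) (key y y0 _).
rewrite -!mulrDl divff ?gt_eqF// lerDl lerDr ler_pdivlMr ?powR_gt0// mul1r.
by apply.
Qed.

Lemma powR_le_distD th x y : 0 < th -> th <= 1 -> 0 <= x -> 0 <= y ->
  `|x `^ th - y `^ th| <= `|x - y| `^ th.
Proof.
move=> th0 th1; wlog xy : x y / y <= x.
  move=> W x0 y0; have [/W|/ltW /W] := leP y x; first exact.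
  by move=> h; rewrite distrC (distrC x); exact: h.
move=> x0 y0; rewrite !ger0_norm ?subr_ge0//; last first.
  by apply: ge0_ler_powR => //; rewrite ?nnegrE// ltW.
rewrite lerBlDr; have {1}-> : x = (x - y) + y by ring.
by apply: powR_subadd => //; rewrite subr_ge0.
Qed.

Lemma le_powR2r th x y : 0 <= th -> 0 <= x -> x <= y -> x `^ th <= y `^ th.
Proof.
by move=> th0 x0 xy; apply: ge0_ler_powR; rewrite ?nnegrE// (le_trans x0).
Qed.

Lemma powR_anti th x y : th <= 0 -> 0 < x -> x <= y -> y `^ th <= x `^ th.
Proof.
move=> th0 x0 xy; rewrite -[th]opprK !(powRN _ (- th)).
rewrite lef_pV2 ?posrE ?powR_gt0//; last exact: lt_le_trans xy.
by apply: le_powR2r => //; rewrite ?oppr_ge0// ltW.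
Qed.

Lemma powR_unbounded th C : 0 < th -> exists T : R, 0 < T /\
  forall t, T <= t -> C <= t `^ th.
Proof.
move=> th0; exists ((Num.max 1 C) `^ th^-1); split.
  by rewrite powR_gt0// lt_max ltr01.
move=> t ht; have m0 : 0 <= Num.max 1 C by rewrite le_max ler01.
have : ((Num.max 1 C) `^ th^-1) `^ th <= t `^ th.
  by apply: le_powR2r => //; rewrite ?powR_ge0// ltW.
rewrite -powRrM mulVf ?gt_eqF// powRr1//; apply: le_trans.
by rewrite le_max lexx orbT.
Qed.

End powers.

Section binomial_expectation.
Variable R : realType.
Implicit Types (F G : nat -> R) (v : R) (N k : nat).

(** The expectation of F at a binomial variable with parameters N and v, computed by
conditioning on the first trial. This form makes sense for every real v, and its
properties follow by induction on N without binomial coefficients; they come back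
only in [binE_formula]. *)
Fixpoint binE N F v : R :=
  if N is N'.+1 then v * binE N' (fun k => F k.+1) v + (1 - v) * binE N' F v
  else F 0%N.

Lemma eq_binE N F G v : (forall k, (k <= N)%N -> F k = G k) ->
  binE N F v = binE N G v.
Proof.
elim: N F G => [|N IH] F G FG /=; first exact: FG.
by rewrite (IH _ (G \o S)) ?(IH F G)// => k kN; apply: FG => //; exact: leqW.
Qed.

Lemma binED N F G v : binE N (fun k => F k + G k) v = binE N F v + binE N G v.
Proof. by elim: N F G => [//|N IH] F G /=; rewrite !IH; ring. Qed.

Lemma binEZ N (r : R) F v : binE N (fun k => r * F k) v = r * binE N F v.
Proof. by elim: N F => [//|N IH] F /=; rewrite !IH; ring. Qed.

Lemma binEB N F G v : binE N (fun k => F k - G k) v = binE N F v - binE N G v.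
Proof. by elim: N F G => [//|N IH] F G /=; rewrite !IH; ring. Qed.

Lemma binE_cst N (r : R) v : binE N (fun=> r) v = r.
Proof. by elim: N => [//|N IH] /=; rewrite IH; ring. Qed.

Lemma binE_le N F G v : 0 <= v <= 1 -> (forall k, (k <= N)%N -> F k <= G k) ->
  binE N F v <= binE N G v.
Proof.
move=> /andP[v0 v1]; elim: N F G => [|N IH] F G FG /=; first exact: FG.
apply: lerD; apply: ler_wpM2l => //; rewrite ?subr_ge0//; apply: IH => k kN;
  apply: FG => //; exact: leqW.
Qed.

Lemma binE_ge0 N F v : 0 <= v <= 1 -> (forall k, (k <= N)%N -> 0 <= F k) ->
  0 <= binE N F v.
Proof. by move=> v01 F0; rewrite -(binE_cst N 0 v); exact: binE_le. Qed.

Lemma binE_norm N F v : 0 <= v <= 1 -> `|binE N F v| <= binE N (fun k => `|F k|) v.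
Proof.
move=> v01; rewrite ler_norml; apply/andP; split.
  rewrite -mulN1r -binEZ; apply: binE_le => // k _; rewrite mulN1r.
  by rewrite lerNl ler_normr lexx orbT.
by apply: binE_le => // k _; exact: ler_norm.
Qed.

Lemma binE_mean N v : binE N (fun k => k%:R) v = N%:R * v.
Proof.
elim: N => [|N IH] /=; first by rewrite mul0r.
under eq_binE => k _ do rewrite -natr1.
by rewrite binED binE_cst IH -[N.+1%:R]natr1; ring.
Qed.

Lemma binE_var N v :
  binE N (fun k => (k%:R - N%:R * v) ^+ 2) v = N%:R * v * (1 - v).
Proof.
have key (M : R) : binE N (fun k => (k%:R - M) ^+ 2) v =
    N%:R * v * (1 - v) + (N%:R * v - M) ^+ 2.
  elim: N M => [|N IH] M /=; first by rewrite !mul0r !sub0r add0r.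
  rewrite (@eq_binE _ _ (fun k => (k%:R - (M - 1)) ^+ 2)); last first.
    by move=> k _; rewrite -natr1; ring.
  by rewrite !IH -[N.+1%:R]natr1; ring.
by rewrite key subrr expr0n addr0.
Qed.

(** The Cauchy-Schwarz inequality, in the linear form |z| <= z^2 / 2r + r / 2 with r the
square root of the mean. *)
Lemma binE_dev N v : 0 <= v <= 1 ->
  binE N (fun k => `|k%:R - N%:R * v|) v <= (N%:R * v) `^ 2^-1.
Proof.
move=> /andP[v0 v1]; set m := N%:R * v; set r := m `^ 2^-1.
have m0 : 0 <= m by rewrite mulr_ge0.
have [m_eq0|mn0] := eqVneq m 0.
  have := binE_mean N v; rewrite -/m m_eq0 => E.
  rewrite (@eq_binE _ _ (fun k => k%:R)) ?E ?powR_ge0// => k _.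
  by rewrite subr0 ger0_norm.
have mp : 0 < m by rewrite lt_neqAle eq_sym mn0.
have rp : 0 < r by exact: powR_gt0.
have rr : r * r = m.
  rewrite -powRD; last by rewrite mn0 implybT.
  by rewrite (_ : 2^-1 + 2^-1 = 1 :> R) ?powRr1//; field.
have : binE N (fun k => `|k%:R - m|) v <=
   binE N (fun k => (2 * r)^-1 * ((k%:R - m) ^+ 2) + r / 2) v.
  apply: binE_le; rewrite ?v0// => k _; rewrite -(real_normK (num_real _)).
  set z := `|_|; rewrite -(ler_pM2l (_ : 0 < 2 * r)); last by rewrite mulr_gt0.
  rewrite mulrDr mulrA mulfV ?gt_eqF ?mulr_gt0//.
  have := sqr_ge0 (z - r); lra.
have := binE_var N v; rewrite -/m => Ev.
rewrite binED (binEZ _ _ (fun k => (k%:R - m) ^+ 2)) Ev binE_cst => /le_trans.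
apply.
have : (2 * r)^-1 * (m * (1 - v)) <= (2 * r)^-1 * m.
  rewrite ler_pM2l ?invr_gt0 ?mulr_gt0//; nra.
have -> : (2 * r)^-1 * m = r / 2.
  by rewrite -rr; field; rewrite gt_eqF.
lra.
Qed.

(** Size biasing: choosing one of the k successes amounts to choosing one of the N + 1
trials, which succeeds with probability v and leaves N further trials. *)
Lemma binE_size_bias N F v :
  N.+1%:R * v * binE N (fun k => F k.+1) v = binE N.+1 (fun k => k%:R * F k) v.
Proof.
elim: N F => [|N IH] F; first by rewrite /= mulrC; ring.
transitivity (v * binE N.+1 (fun k => k.+1%:R * F k.+1) v +
   (1 - v) * binE N.+1 (fun k => k%:R * F k) v); last by [].
rewrite -(IH F) (@eq_binE _ (fun k => k.+1%:R * F k.+1)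
   (fun k => k%:R * F k.+1 + F k.+1)); last first.
  by move=> k _; rewrite -natr1; ring.
rewrite binED -(IH (fun k => F k.+1)) -[N.+2%:R]natr1 /=; ring.
Qed.

Lemma binE_inv N v : 0 <= v <= 1 ->
  N.+1%:R * v * binE N (fun k => k.+1%:R^-1) v <= 1.
Proof.
move=> v01; rewrite (binE_size_bias N (fun k => k%:R^-1)).
rewrite -[leRHS](binE_cst N.+1 1 v); apply: binE_le => // k _.
by case: k => [|k]; rewrite ?mul0r// mulfV.
Qed.

(** The value N carries the mass v^N and the other values contribute at most 0. *)
Lemma binE_le_top N F v : 0 <= v <= 1 -> (forall k, (k < N)%N -> F k <= 0) ->
  binE N F v <= v ^+ N * F N.
Proof.
move=> /andP[v0 v1]; elim: N F => [|N IH] F FN /=; first by rewrite mul1r.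
have h1 : binE N F v <= 0.
  rewrite -(binE_cst N 0 v); apply: binE_le; first by rewrite v0.
  by move=> k kN; apply: FN.
have h2 : binE N (fun k => F k.+1) v <= v ^+ N * F N.+1.
  by apply: IH => k kN; exact: FN.
rewrite exprS -mulrA; nra.
Qed.

Lemma binE_ge_atom N F v k : 0 <= v <= 1 -> (forall k, 0 <= F k) ->
  (k <= N)%N -> v ^+ k * (1 - v) ^+ (N - k) * F k <= binE N F v.
Proof.
move=> v01; have /andP[v0 v1] := v01; elim: N F k => [|N IH] F k F0 kN /=.
  by move: kN; rewrite leqn0 => /eqP ->; rewrite !expr0 !mul1r.
have w0 : 0 <= 1 - v by rewrite subr_ge0.
have p1 : 0 <= v * binE N (fun k => F k.+1) v by rewrite mulr_ge0// binE_ge0.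
have p2 : 0 <= (1 - v) * binE N F v by rewrite mulr_ge0// binE_ge0.
case: (ltnP k N.+1) => [kN'|Nk].
  have := IH F k F0 kN'; rewrite subSn// exprS => h.
  apply: (@le_trans _ _ ((1 - v) * binE N F v)); last by rewrite lerDr.
  rewrite (_ : _ * F k = (1 - v) * (v ^+ k * (1 - v) ^+ (N - k) * F k)).
    exact: ler_wpM2l.
  by ring.
have -> : k = N.+1 by apply/eqP; rewrite eqn_leq kN.
have := IH (fun k => F k.+1) N (fun k => F0 _) (leqnn _).
rewrite !subnn !expr0 !mulr1 exprS => h.
apply: (@le_trans _ _ (v * binE N (fun k0 => F k0.+1) v)); last by rewrite lerDl.
by rewrite -mulrA; apply: ler_wpM2l.
Qed.

Lemma measurable_binE N F : measurable_fun setT (binE N F).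
Proof.
elim: N F => [|N IH] F /=; first exact: measurable_cst.
apply: measurable_funD; apply: measurable_funM => //.
exact: measurable_funB.
Qed.

Lemma binE_formula N F v : binE N F v =
  \sum_(k < N.+1) F k * ('C(N, k)%:R * v ^+ k * (1 - v) ^+ (N - k)).
Proof.
elim: N F => [|N IH] F.
  by rewrite big_ord_recl big_ord0 /= bin0 !expr0 !mulr1 addr0.
have E : (1 - v) * (\sum_(k < N.+1)
      F k * ('C(N, k)%:R * v ^+ k * (1 - v) ^+ (N - k))) =
    F 0%N * (1 - v) ^+ N.+1 +
    \sum_(i < N.+1) F i.+1 * ('C(N, i.+1)%:R * v ^+ i.+1 * (1 - v) ^+ (N - i)).
  rewrite big_ord_recl [in RHS]big_ord_recr /= bin0 bin_small// subn0 expr0.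
  rewrite !mul0r mulr0 addr0 mulrDr mulr_sumr exprS; congr (_ + _).
    by rewrite !mul1r mulrCA.
  apply: eq_bigr => i _; rewrite /bump leq0n add1n.
  have -> : (N - i = (N - i.+1).+1)%N by have := ltn_ord i; lia.
  by rewrite !exprS; ring.
rewrite /= !IH E [RHS]big_ord_recl /= bin0 expr0 subn0 !mul1r addrCA.
congr (_ + _); rewrite mulr_sumr -big_split /=; apply: eq_bigr => i _.
by rewrite /bump leq0n add1n binS natrD subSS exprS; ring.
Qed.

End binomial_expectation.

(** * Mean functionals and the comparison principle *)

Section functional.
Variable R : realType.
Implicit Types (F G w u y : R -> R) (I : (R -> R) -> R).

Definition itv_ind (i : interval R) (v : R) : R := (v \in i)%:R.

Lemma measurable_itv_ind i : measurable_fun setT (itv_ind i).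
Proof.
rewrite (_ : itv_ind i = \1_[set` i]); first exact: measurable_indic.
by apply/funext => v; rewrite indicE mem_setE.
Qed.

Lemma itv_ind_ge0 i v : 0 <= itv_ind i v. Proof. exact: ler0n. Qed.
Lemma itv_ind_le1 i v : itv_ind i v <= 1.
Proof. by rewrite /itv_ind; case: (_ \in _). Qed.

(** Only the values on [0, 1] have to be bounded, since a mean functional depends on
no others. *)
Definition adm F := measurable_fun setT F /\
  exists C, forall v, 0 <= v <= 1 -> `|F v| <= C.

Lemma adm_cst c : adm (fun=> c).
Proof. by split; [exact: measurable_cst | exists `|c|]. Qed.

Lemma admD F G : adm F -> adm G -> adm (fun v => F v + G v).
Proof.
move=> [mF [C hC]] [mG [D hD]]; split; first exact: measurable_funD.
exists (C + D) => v v01; apply: le_trans (ler_normD _ _) _.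
by rewrite lerD ?hC ?hD.
Qed.

Lemma admM F G : adm F -> adm G -> adm (fun v => F v * G v).
Proof.
move=> [mF [C hC]] [mG [D hD]]; split; first exact: measurable_funM.
exists (C * D) => v v01; rewrite normrM.
by apply: ler_pM => //; rewrite ?hC ?hD.
Qed.

Lemma admZ c F : adm F -> adm (fun v => c * F v).
Proof. by move=> aF; apply: admM => //; exact: adm_cst. Qed.

Lemma admB F G : adm F -> adm G -> adm (fun v => F v - G v).
Proof.
move=> aF aG; rewrite (_ : (fun v => _) = (fun v => F v + -1 * G v)).
  by apply: admD => //; exact: admZ.
by apply/funext => v; rewrite mulN1r.
Qed.

Lemma adm_norm F : adm F -> adm (fun v => `|F v|).
Proof.
move=> [mF [C hC]]; split; first exact: (measurableT_comp _ mF).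
by exists C => v v01; rewrite normr_id hC.
Qed.

Lemma adm_ind i : adm (itv_ind i).
Proof.
split; first exact: measurable_itv_ind.
by exists 1 => v _; rewrite ger0_norm ?itv_ind_ge0// itv_ind_le1.
Qed.

Lemma adm_pow g : 0 <= g -> adm (fun v => v `^ g).
Proof.
move=> g0; split; first exact: measurable_powR.
exists 1 => v /andP[v0 v1]; rewrite ger0_norm ?powR_ge0//.
by apply: le_trans (le_powR2r g0 v0 v1) _; rewrite powR1.
Qed.

Lemma adm_id : adm (fun v => v).
Proof.
by split => //; exists 1 => v /andP[v0 v1]; rewrite ger0_norm.
Qed.

Lemma adm_binE N (F : nat -> R) : adm (binE N F).
Proof.
split; first exact: measurable_binE.
exists (\sum_(k < N.+1) `|F k|) => v v01.
apply: le_trans (binE_norm _ _ v01) _.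
rewrite -[leRHS](binE_cst N _ v); apply: binE_le => // k kN.
rewrite -[leLHS]/(`|F (Ordinal (kN : (k < N.+1)%N))|).
by rewrite (bigD1 (Ordinal (kN : (k < N.+1)%N)))//= lerDl sumr_ge0.
Qed.

(** All dilations t of these functions, restricted to [0, 1], are in the domain [adm]
of a mean functional. *)
Definition ladm w := measurable_fun setT w /\
  forall T, exists C, forall t, 0 <= t <= T -> `|w t| <= C.

Lemma ladm_scale w t : 0 <= t -> ladm w -> adm (fun v => w (t * v)).
Proof.
move=> t0 [mw bw]; split; first by apply: measurableT_comp => //; exact: mulrl_measurable.
have [C hC] := bw t; exists C => v /andP[v0 v1]; apply: hC.
by rewrite mulr_ge0//= ler_piMr.
Qed.

(** An integral over [0, 1] against a finite measure, of which linearity and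
monotonicity are all that the renewal argument uses. *)
Record mean_functional I : Prop := MeanFunctional {
  mfD : forall F G, adm F -> adm G -> I (fun v => F v + G v) = I F + I G ;
  mfZ : forall c F, adm F -> I (fun v => c * F v) = c * I F ;
  mf_le : forall F G, adm F -> adm G ->
    (forall v, 0 <= v <= 1 -> F v <= G v) -> I F <= I G }.

Section basic.
Variable I : (R -> R) -> R.
Hypothesis mfI : mean_functional I.

Lemma mfB F G : adm F -> adm G -> I (fun v => F v - G v) = I F - I G.
Proof.
move=> aF aG; rewrite (_ : (fun v => _) = (fun v => F v + -1 * G v)).
  by rewrite (mfD mfI)//; [rewrite (mfZ mfI)// mulN1r | exact: admZ].
by apply/funext => v; rewrite mulN1r.
Qed.

Lemma mf_eq F G : adm F -> adm G ->
  (forall v, 0 <= v <= 1 -> F v = G v) -> I F = I G.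
Proof.
move=> aF aG FG; apply/eqP; rewrite eq_le; apply/andP.
by split; apply: (mf_le mfI) => // v v01; rewrite FG.
Qed.

Lemma mf_ge0 F : adm F -> (forall v, 0 <= v <= 1 -> 0 <= F v) -> 0 <= I F.
Proof.
move=> aF F0; have <- : I (fun v => 0 * F v) = 0 by rewrite (mfZ mfI)// mul0r.
by apply: (mf_le mfI) => //; [exact: admZ | move=> v v01; rewrite mul0r F0].
Qed.

Lemma mf_cst c : I (fun=> c) = c * I (fun=> 1).
Proof.
rewrite -(mfZ mfI); last exact: adm_cst.
by apply: mf_eq => [||v _]; [exact: adm_cst|exact/admZ/adm_cst|rewrite mulr1].
Qed.

Lemma mf1_ge0 : 0 <= I (fun=> 1).
Proof. by apply: mf_ge0 => //; exact: adm_cst. Qed.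

Lemma mf_norm F : adm F -> `|I F| <= I (fun v => `|F v|).
Proof.
move=> aF; rewrite ler_norml; apply/andP; split.
  rewrite -mulN1r -(mfZ mfI); last exact: adm_norm.
  apply: (mf_le mfI) => //; first exact/admZ/adm_norm.
  by move=> v _; rewrite mulN1r lerNl ler_normr lexx orbT.
by apply: (mf_le mfI) => //; [exact: adm_norm|move=> v _; exact: ler_norm].
Qed.

Lemma mf_le_cst F c : adm F -> (forall v, 0 <= v <= 1 -> F v <= c) ->
  I F <= c * I (fun=> 1).
Proof. by move=> aF Fc; rewrite -mf_cst; apply: (mf_le mfI) => //; exact: adm_cst. Qed.

End basic.
End functional.

Section exprs.
Variable R : realType.
Lemma expr_small (z e : R) : 0 <= z -> z < 1 -> 0 < e -> exists k, z ^+ k <= e.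
Proof.
move=> z0 z1 e0.
have : (fun n => z ^+ n) @ \oo --> (0 : R).
  by apply: cvg_expr; rewrite ger0_norm.
move=> /cvgrPdist_le /(_ e e0) [k _ /(_ k (leqnn _))] /=.
by rewrite sub0r normrN ger0_norm ?exprn_ge0// => h; exists k.
Qed.
End exprs.

(** In logarithmic coordinates the measure v^beta I(dv) is the law of the steps of a
random walk, of total mass 1 by [rk_beta]; [rk_nondeg] gives it some mass inside
]0, 1[. *)
Record renewal_kernel (R : realType) (I : (R -> R) -> R) (beta : R) : Prop :=
  RenewalKernel {
    rk_mf : mean_functional I ;
    rk_beta0 : 0 < beta ;
    rk_beta : I (fun v => v `^ beta) = 1 ;
    rk_nondeg : exists p q, [/\ 0 < p, p <= q, q < 1 & 0 < I (itv_ind `[p, q])] }.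

Section renewal.
Variables (R : realType) (I : (R -> R) -> R) (beta : R).
Hypothesis rk : renewal_kernel I beta.
Let mfI := rk_mf rk.
Let beta0 := rk_beta0 rk.
Let Ibeta := rk_beta rk.

Lemma mf_pow_gt1 g : 0 <= g -> g < beta -> 1 < I (fun v => v `^ g).
Proof.
move=> g0 gb; have [p [q [p0 pq q1 Ipq]]] := rk_nondeg rk.
have q0 : 0 < q by exact: lt_le_trans pq.
rewrite -Ibeta.
set k := p `^ g * (1 - q `^ (beta - g)).
have k0 : 0 < k.
  rewrite mulr_gt0 ?powR_gt0// subr_gt0.
  have := gt0_ltr_powR (_ : 0 < beta - g); rewrite subr_gt0 => /(_ gb q 1).
  by rewrite !nnegrE (ltW q0) ler01 powR1 => /(_ isT isT q1).
apply: (@lt_le_trans _ _ (I (fun v => v `^ beta + k * itv_ind `[p, q] v))).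
  have aK := adm_ind `[p, q]; have aP := adm_pow (ltW beta0).
  rewrite (mfD mfI)//; last exact: admZ.
  by rewrite (mfZ mfI)// ltrDl mulr_gt0.
apply: (mf_le mfI).
- by apply: admD; [apply: adm_pow; exact: ltW|apply: admZ; exact: adm_ind].
- exact: adm_pow.
move=> v /andP[v0 v1].
have E : v `^ beta = v `^ g * v `^ (beta - g).
  rewrite -powRD; first by rewrite subrKC.
  by rewrite subrKC gt_eqF.
have vb1 : v `^ (beta - g) <= 1.
  by rewrite -[leRHS](powR_1x (beta - g)); apply: le_powR2r => //; rewrite subr_ge0 ltW.
rewrite /itv_ind in_itv /=; case: andP => [[pv vq]|_]; last first.
  by rewrite mulr0 addr0 E ler_piMr ?powR_ge0.
have vb2 : v `^ (beta - g) <= q `^ (beta - g).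
  by apply: le_powR2r => //; rewrite subr_ge0 ltW.
have vb3 : p `^ g <= v `^ g by apply: le_powR2r => //; exact: ltW.
have := powR_ge0 v g; have := powR_ge0 p g; rewrite E mulr1 /k.
move: vb1 vb2 vb3 k0; rewrite /k; set a := v `^ g; set b := v `^ _; set c := q `^ _.
by move=> *; nra.
Qed.

Lemma mf_pow_lt1 g : beta < g -> I (fun v => v `^ g) < 1.
Proof.
move=> gb; have g0 : 0 <= g by rewrite ltW// (lt_trans beta0).
have [p [q [p0 pq q1 Ipq]]] := rk_nondeg rk.
have q0 : 0 < q by exact: lt_le_trans pq.
rewrite -Ibeta.
set k := p `^ beta * (1 - q `^ (g - beta)).
have k0 : 0 < k.
  rewrite mulr_gt0 ?powR_gt0// subr_gt0.
  have := gt0_ltr_powR (_ : 0 < g - beta); rewrite subr_gt0 => /(_ gb q 1).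
  by rewrite !nnegrE (ltW q0) ler01 powR1 => /(_ isT isT q1).
apply: (@lt_le_trans _ _ (I (fun v => v `^ g + k * itv_ind `[p, q] v))).
  have aK := adm_ind `[p, q]; have aP := adm_pow g0.
  rewrite (mfD mfI)//; last exact: admZ.
  by rewrite (mfZ mfI)// ltrDl mulr_gt0.
apply: (mf_le mfI).
- by apply: admD; [exact: adm_pow|apply: admZ; exact: adm_ind].
- by apply: adm_pow; exact: ltW.
move=> v /andP[v0 v1].
have E : v `^ g = v `^ beta * v `^ (g - beta).
  rewrite -powRD; first by rewrite subrKC.
  by rewrite subrKC gt_eqF// (lt_trans beta0).
have vb1 : v `^ (g - beta) <= 1.
  by rewrite -[leRHS](powR_1x (g - beta)); apply: le_powR2r => //; rewrite subr_ge0 ltW.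
rewrite /itv_ind in_itv /=; case: andP => [[pv vq]|_]; last first.
  by rewrite mulr0 addr0 E ler_piMr ?powR_ge0.
have vb2 : v `^ (g - beta) <= q `^ (g - beta).
  by apply: le_powR2r => //; rewrite subr_ge0 ltW.
have vb3 : p `^ beta <= v `^ beta by apply: le_powR2r => //; exact: ltW.
have := powR_ge0 v beta; have := powR_ge0 p beta; rewrite E mulr1 /k.
move: vb1 vb2 vb3 k0; rewrite /k; set a := v `^ beta; set b := v `^ _; set c := q `^ _.
by move=> *; nra.
Qed.

(** A maximum principle without compactness. The factors v in ]q, 1] carry at most the
fraction th < 1 of the mass of v^beta I, whereas factors v <= q bring t closer to the
region where w <= 0. So an induction on k shows w <= 0 up to r / q^k, and each of its
steps improves the bound w t <= C t^beta by the factor th again and again. *)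
Lemma renewal_comparison (w : R -> R) r : 0 < r -> ladm w ->
  (exists C, forall t, 0 <= t -> w t <= C * t `^ beta) ->
  (forall t, 0 <= t <= r -> w t <= 0) ->
  (forall t, r < t -> w t <= I (fun v => w (t * v))) ->
  forall t, 0 <= t -> w t <= 0.
Proof.
have [p [q [p0 pq q1 Ipq]]] := rk_nondeg rk.
have q0 : 0 < q by exact: lt_le_trans pq.
move=> r0 lw [C0 hC0] wr wI.
pose C := Num.max 0 C0.
have C_ge0 : 0 <= C by rewrite le_max lexx.
have hC t : 0 <= t -> w t <= C * t `^ beta.
  move=> t0; apply: le_trans (hC0 t t0) _; rewrite ler_wpM2r ?powR_ge0//.
  by rewrite le_max lexx orbT.
pose th := 1 - p `^ beta * I (itv_ind `[p, q]).
have ap : adm (fun v : R => v `^ beta) by apply: adm_pow; exact: ltW.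
pose J := I (fun v => v `^ beta * itv_ind `]q, +oo[ v).
have aJ : adm (fun v => v `^ beta * itv_ind `]q, +oo[ v).
  by apply: admM => //; exact: adm_ind.
have Jth : J <= th.
  have aK : adm (fun v => p `^ beta * itv_ind `[p, q] v) by apply: admZ; exact: adm_ind.
  have <- : I (fun v => v `^ beta - p `^ beta * itv_ind `[p, q] v) = th.
    by rewrite (mfB mfI)// Ibeta (mfZ mfI)//; exact: adm_ind.
  apply: (mf_le mfI) => //; first exact: admB.
  move=> v /andP[v0 v1]; rewrite /itv_ind !in_itv /= andbT.
  case: (ltP q v) => qv; rewrite ?andbF ?mulr0 ?mulr1 ?subr0 ?subr_ge0//.
  case: andP => [[pv _]|_]; rewrite ?mulr0 ?mulr1 ?powR_ge0//.
  by apply: le_powR2r => //; exact: ltW.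
have th1 : th < 1 by rewrite ltrBlDr ltrDl mulr_gt0// powR_gt0.
have J0 : 0 <= J.
  by apply: (mf_ge0 mfI) => // v _; rewrite mulr_ge0 ?powR_ge0 ?itv_ind_ge0.
have th0 : 0 <= th by exact: le_trans Jth.
(* outer induction: one more factor q^-1 in the admissible range of t *)
have key k : forall t, 0 <= t -> q ^+ k * t <= r -> w t <= 0.
  elim: k => [|k IH] t t0 qt.
    by apply: wr; rewrite t0/=; move: qt; rewrite expr0 mul1r.
  (* inner induction: the bound gains a factor th *)
  have step j : forall t, 0 <= t -> q ^+ k.+1 * t <= r -> w t <= C * th ^+ j * t `^ beta.
    elim: j => [|j IHj] {qt t0}t t0 qt; first by rewrite expr0 mulr1 hC.
    have [tr|rt] := leP t r.
      apply: le_trans (wr t _) _; first by rewrite t0.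
      by rewrite !mulr_ge0 ?exprn_ge0 ?powR_ge0.
    apply: le_trans (wI t rt) _.
    apply: (@le_trans _ _ (I (fun v => (C * th ^+ j * t `^ beta) *
       (v `^ beta * itv_ind `]q, +oo[ v)))).
      apply: (mf_le mfI); [exact: ladm_scale|exact: admZ|].
      move=> v /andP[v0 v1]; rewrite /itv_ind in_itv /= andbT.
      case: ltP => qv; last first.
        rewrite !mulr0; apply: IH; first exact: mulr_ge0.
        apply: le_trans qt; rewrite exprSr -mulrA ler_wpM2l ?exprn_ge0 ?(ltW q0)//.
        by rewrite mulrC ler_wpM2r.
      rewrite mulr1 -mulrA -powRM//; apply: IHj; first exact: mulr_ge0.
      apply: le_trans qt; rewrite ler_wpM2l ?exprn_ge0 ?(ltW q0)//.
      by rewrite ler_piMr.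
    rewrite (mfZ mfI)// -/J mulrAC exprSr [C * (_ * _)]mulrA.
    rewrite ler_wpM2r ?powR_ge0//.
    by rewrite ler_wpM2l// mulr_ge0 ?exprn_ge0.
  apply/ler_addgt0Pr => e e0; rewrite add0r.
  have D0 : 0 < C * t `^ beta + 1 by rewrite ltr_wpDl// mulr_ge0 ?powR_ge0.
  have [|j hj] := @expr_small R th (e / (C * t `^ beta + 1)) th0 th1.
    by rewrite divr_gt0.
  apply: le_trans (step j t t0 qt) _; rewrite mulrAC.
  apply: (@le_trans _ _ ((C * t `^ beta + 1) * th ^+ j)).
    by rewrite ler_wpM2r ?exprn_ge0// lerDl.
  by rewrite mulrC -ler_pdivlMr.
move=> t t0; have [k hk] := @expr_small R q (r / (t + 1)) (ltW q0) q1 (divr_gt0 r0 (ltr_wpDl t0 ltr01)).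
apply: (key k) => //; apply: (@le_trans _ _ (q ^+ k * (t + 1))).
  by rewrite ler_wpM2l ?exprn_ge0 ?(ltW q0)// lerDl.
by rewrite -ler_pdivlMr// ltr_wpDl.
Qed.

End renewal.

(** * Persistence of subsolutions *)

Section ladm_lemmas.
Variable R : realType.
Implicit Types (w u : R -> R).

Lemma ladm_cst (c : R) : ladm (fun=> c).
Proof. by split; [exact: measurable_cst|move=> T; exists `|c|]. Qed.

Lemma ladmD w u : ladm w -> ladm u -> ladm (fun v => w v + u v).
Proof.
move=> [mF hF] [mG hG]; split; first exact: measurable_funD.
move=> T; have [C hC] := hF T; have [D hD] := hG T.
exists (C + D) => v v01; apply: le_trans (ler_normD _ _) _.
by rewrite lerD ?hC ?hD.
Qed.

Lemma ladmM w u : ladm w -> ladm u -> ladm (fun v => w v * u v).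
Proof.
move=> [mF hF] [mG hG]; split; first exact: measurable_funM.
move=> T; have [C hC] := hF T; have [D hD] := hG T.
exists (C * D) => v v01; rewrite normrM.
by apply: ler_pM => //; rewrite ?hC ?hD.
Qed.

Lemma ladmZ (c : R) w : ladm w -> ladm (fun v => c * w v).
Proof. by move=> lw; apply: ladmM => //; exact: ladm_cst. Qed.

Lemma ladmB w u : ladm w -> ladm u -> ladm (fun v => w v - u v).
Proof.
move=> lw lu; rewrite (_ : (fun v => _) = (fun v => w v + -1 * u v)).
  by apply: ladmD => //; exact: ladmZ.
by apply/funext => v; rewrite mulN1r.
Qed.

Lemma ladm_norm w : ladm w -> ladm (fun v => `|w v|).
Proof.
move=> [mF hF]; split; first exact: (measurableT_comp _ mF).
by move=> T; have [C hC] := hF T; exists C => v v01; rewrite normr_id hC.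
Qed.

Lemma ladm_bounded w : measurable_fun setT w -> (exists C, forall t, `|w t| <= C) ->
  ladm w.
Proof. by move=> mw [C hC]; split => // T; exists C. Qed.

Lemma ladm_ind i : ladm (@itv_ind R i).
Proof.
apply: ladm_bounded; first exact: measurable_itv_ind.
by exists 1 => v; rewrite ger0_norm ?itv_ind_ge0// itv_ind_le1.
Qed.

Lemma ladm_pow (g : R) : 0 <= g -> ladm (fun v => v `^ g).
Proof.
move=> g0; split; first exact: measurable_powR.
move=> T; exists (T `^ g) => v /andP[v0 vT]; rewrite ger0_norm ?powR_ge0//.
exact: le_powR2r.
Qed.

Lemma ladm_scaler w (c : R) : 0 <= c -> ladm w -> ladm (fun t => w (c * t)).
Proof.
move=> c0 [mw bw]; split.
  by apply: measurableT_comp => //; exact: mulrl_measurable.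
move=> T; have [C hC] := bw (c * T); exists C => t /andP[t0 tT]; apply: hC.
by rewrite mulr_ge0//= ler_wpM2l.
Qed.

End ladm_lemmas.

Section persistence.
Variables (R : realType) (I : (R -> R) -> R) (beta rho : R).
Hypothesis rk : renewal_kernel I beta.
Hypothesis rho0 : 0 < rho.
Hypothesis rho_beta : rho < beta.
Let mfI := rk_mf rk.
Let beta0 := rk_beta0 rk.
Let Ibeta := rk_beta rk.

(** If an approximate subsolution is at most eps t^beta on one long window [r / L, r], it
remains so beyond the window, up to an error that is small when L and r are large.
The barrier is eps t^beta + D Psi(t / r): on the critical power the functional acts as
the identity, while it enlarges the power t^(beta - rho) strictly, so that subtracting
the latter makes Psi a strict supersolution. Below s0 the function Psi is the positive
power s^(beta - rho) instead, which dominates the subsolution to the left of the window. *)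
Lemma renewal_persistence : exists A : R, 0 < A /\
  forall (u : R -> R) (r L eps G K : R),
    ladm u -> 0 < r -> 1 <= L -> 0 <= eps -> 0 <= G -> 0 <= K ->
    (forall t, 0 <= t -> 0 <= u t <= G * t `^ beta) ->
    (forall t, r < t -> u t <= I (fun v => u (t * v)) + K * t `^ (beta - rho)) ->
    (forall t, r / L <= t <= r -> u t <= eps * t `^ beta) ->
    forall t, r <= t ->
      u t <= (eps + A * (G * L `^ (- rho) + K * r `^ (- rho))) * t `^ beta.
Proof.
set g := beta - rho; have g0 : 0 < g by rewrite subr_gt0.
pose m := I (fun v => v `^ g).
have m1 : 1 < m by apply: (mf_pow_gt1 rk); [exact: ltW|rewrite /g gtrBl].
have I1 := mf1_ge0 mfI; set c1 := I (fun=> 1) in I1.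
have c1p : 0 < c1 + 1 by rewrite ltr_wpDl.
(* so small that the factors v <= s0, for which the two forms of Psi differ, cost
   at most a quarter of the gain m - 1 *)
pose s0 := Num.min 1 (((m - 1) / (4 * (c1 + 1))) `^ g^-1).
have d0 : 0 < (m - 1) / (4 * (c1 + 1)) by rewrite divr_gt0 ?subr_gt0// mulr_gt0.
have s0p : 0 < s0 by rewrite /s0 lt_min ltr01 powR_gt0.
have s01 : s0 <= 1 by rewrite /s0 ge_min lexx.
have s0g : s0 `^ g <= (m - 1) / (4 * (c1 + 1)).
  have -> : (m - 1) / (4 * (c1 + 1)) = (((m - 1) / (4 * (c1 + 1))) `^ g^-1) `^ g.
    by rewrite -powRrM mulVf ?gt_eqF// powRr1// ltW.
  apply: le_powR2r; rewrite ?(ltW g0)// ?(ltW s0p)// /s0 ge_min lexx orbT //.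
have ag : adm (fun v : R => v `^ g) by apply: adm_pow; exact: ltW.
have ab : adm (fun v : R => v `^ beta) by apply: adm_pow; exact: ltW.
have aJ : adm (fun v => v `^ g * itv_ind `]-oo, s0] v).
  by apply: admM => //; exact: adm_ind.
have J0 : I (fun v => v `^ g * itv_ind `]-oo, s0] v) <= (m - 1) / 4.
  apply: le_trans (mf_le_cst (c := s0 `^ g) mfI aJ _) _.
    move=> v /andP[v0 v1]; rewrite /itv_ind in_itv /=.
    case: (leP v s0) => vs; rewrite ?mulr1 ?mulr0 ?powR_ge0//.
    by apply: le_powR2r => //; exact: ltW.
  rewrite -/c1; apply: le_trans (ler_wpM2r I1 s0g) _.
  have -> : (m - 1) / (4 * (c1 + 1)) * c1 = (m - 1) / 4 * (c1 / (c1 + 1)).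
    by field; rewrite gt_eqF.
  rewrite ler_piMr ?divr_ge0// ?subr_ge0 ?(ltW m1)//.
  by rewrite ler_pdivrMr// mul1r lerDl.
pose A := 2 * s0 `^ (- rho); have A0 : 0 < A by rewrite mulr_gt0 ?powR_gt0.
pose Psi s : R := itv_ind `]-oo, s0] s * s `^ g +
                  (1 - itv_ind `]-oo, s0] s) * (A * s `^ beta - s `^ g).
have lPsi : ladm Psi.
  have l1 := @ladm_ind R `]-oo, s0]; have l2 := @ladm_pow R _ (ltW g0).
  have l3 := @ladm_pow R _ (ltW beta0).
  apply: ladmD; apply: ladmM => //; apply: ladmB => //; first exact: ladm_cst.
  exact: ladmZ.
have PsiE s : Psi s = if s <= s0 then s `^ g else A * s `^ beta - s `^ g.
  rewrite /Psi /itv_ind in_itv /=; case: ifP => _; first by rewrite subrr mul0r addr0 mul1r.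
  by rewrite mul0r add0r subr0 mul1r.
have powD s : 0 <= s -> s `^ beta = s `^ g * s `^ rho.
  by move=> s_ge0; rewrite -powRD subrK// gt_eqF.
have Psi_ge s : 0 <= s -> s `^ g <= Psi s.
  move=> s_ge0; rewrite PsiE; case: (leP s s0) => // s0s.
  rewrite lerBrDr powD// [A * _]mulrCA -mulr2n -mulr_natr ler_wpM2l ?powR_ge0//.
  rewrite /A -mulrA ler_peMr// powRN ler_pdivlMl ?powR_gt0// mulr1.
  by apply: le_powR2r; rewrite ?(ltW rho0)// ltW.
have Psi_le s : 1 <= s -> Psi s <= A * s `^ beta.
  move=> s_ge1; rewrite PsiE; case: ifP => ss.
    have := Psi_ge s (le_trans ler01 s_ge1).
    have -> : s = 1 by apply/eqP; rewrite eq_le s_ge1 andbT (le_trans ss).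
    rewrite !powR_1x mulr1 /A => _.
    apply: (@le_trans _ _ (2 * 1)); first by rewrite mulr1 ler1n.
    rewrite ler_wpM2l// powRN invf_ge1 ?powR_gt0// -(powR_1x rho).
    by apply: le_powR2r => //; exact: ltW.
  by rewrite gerBl powR_ge0.
have Psi_super s : 1 < s -> I (fun v => Psi (s * v)) <= Psi s - (m - 1) / 2 * s `^ g.
  move=> s1; have s_ge0 : 0 <= s by rewrite ltW// (lt_trans ltr01).
  have a1 := @admZ R (A * s `^ beta) _ ab; have a2 := @admZ R (s `^ g) _ ag.
  have a3 := @admZ R (2 * s `^ g) _ aJ.
  apply: (@le_trans _ _ (I (fun v => (A * s `^ beta) * v `^ beta - s `^ g * v `^ g +
      (2 * s `^ g) * (v `^ g * itv_ind `]-oo, s0] v)))).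
    apply: (mf_le mfI); [exact: ladm_scale|by apply: admD => //; exact: admB|].
    move=> v /andP[v0 v1]; rewrite PsiE /itv_ind in_itv /=.
    rewrite !powRM//; set x := s `^ g; set y := v `^ g; set z := s `^ beta; set w := v `^ beta.
    have [x0 y0 z0 w0] : [/\ 0 <= x, 0 <= y, 0 <= z & 0 <= w].
      by split; exact: powR_ge0.
    have xy0 : 0 <= x * y by exact: mulr_ge0.
    have zw0 : 0 <= A * (z * w) by apply: mulr_ge0; [exact: ltW|exact: mulr_ge0].
    case: (leP v s0) => vs; case: ifP => svs; rewrite ?mulr1 ?mulr0; try lra.
    have : v <= s0.
      apply: le_trans svs; rewrite -[leLHS]mul1r ler_wpM2r// ltW//.
    by rewrite leNgt vs.
  rewrite (mfD mfI)//; last exact: admB.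
  rewrite (mfB mfI)// !(mfZ mfI)// Ibeta mulr1 -/m PsiE.
  rewrite ifF; last by apply/negbTE; rewrite -ltNge (le_lt_trans s01 s1).
  move: J0 (powR_ge0 s g); set j := I _; set x := s `^ g; nra.
pose B0 := Num.max 1 (2 / (m - 1)).
have m10 : 0 < m - 1 by rewrite subr_gt0.
exists (A * B0); split.
  by rewrite mulr_gt0// lt_max ltr01.
move=> u r L eps G K lu r0 L1 eps0 G0 K0 uG uI ur.
have L0 : 0 < L by exact: lt_le_trans L1.
pose K1 := 2 * K / (m - 1).
have K10 : 0 <= K1 by rewrite /K1 divr_ge0 ?mulr_ge0// ltW.
pose D := (G * L `^ (- rho) + K1 * r `^ (- rho)) * r `^ beta.
have D0 : 0 <= D by rewrite mulr_ge0 ?powR_ge0// addr_ge0// mulr_ge0// powR_ge0.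
pose B t := eps * t `^ beta + D * Psi (r^-1 * t).
have rV : 0 <= r^-1 by rewrite invr_ge0 ltW.
have lB : ladm B.
  apply: ladmD; first by apply: ladmZ; apply: ladm_pow; exact: ltW.
  by apply: ladmZ; exact: ladm_scaler.
have rt0 t : 0 <= t -> 0 <= r^-1 * t by exact: mulr_ge0.
have B_ge0 t : 0 <= t -> 0 <= B t.
  move=> t0; rewrite addr_ge0// mulr_ge0 ?powR_ge0//.
  by apply: le_trans (Psi_ge _ _); rewrite ?powR_ge0 ?rt0.
have le0 : forall t, 0 <= t -> u t - B t <= 0.
  apply: (renewal_comparison rk r0).
  - exact: ladmB.
  - exists G => t t0; apply: (@le_trans _ _ (u t)); first by rewrite gerBl B_ge0.
    by case/andP: (uG t t0).
  - move=> t /andP[t0 tr]; rewrite subr_le0.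
    have [rLt|tL] := leP (r / L) t.
      apply: le_trans (ur t _) _; first by rewrite rLt.
      rewrite /B lerDl mulr_ge0//.
      by apply: le_trans (Psi_ge _ _); rewrite ?powR_ge0 ?rt0.
    have /andP[_ h] := uG t t0; apply: (le_trans h).
    rewrite /B -[leLHS]add0r lerD ?mulr_ge0 ?powR_ge0//.
    have tE : t = r * (r^-1 * t) by rewrite mulrA divff ?mul1r// gt_eqF.
    apply: (@le_trans _ _ (D * (r^-1 * t) `^ g)); last first.
      by rewrite ler_wpM2l// Psi_ge ?rt0.
    rewrite {1}tE powRM ?(ltW r0) ?rt0// (powD (r^-1 * t)) ?rt0//.
    rewrite /D mulrDl mulrDl; apply: (@le_trans _ _ (G * L `^ (- rho) * r `^ beta * (r^-1 * t) `^ g)).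
      have {}h : (r^-1 * t) `^ rho <= L `^ (- rho).
        rewrite -(powRV _ (ltW L0)); apply: le_powR2r; rewrite ?rt0 ?(ltW rho0)//.
        by rewrite mulrC ler_pdivrMr// mulrC ltW.
      rewrite [leLHS](_ : _ = (G * r `^ beta * (r^-1 * t) `^ g) * (r^-1 * t) `^ rho); last by ring.
      rewrite [leRHS](_ : _ = (G * r `^ beta * (r^-1 * t) `^ g) * L `^ (- rho)); last by ring.
      by rewrite ler_wpM2l// !mulr_ge0 ?powR_ge0.
    rewrite lerDl; apply: mulr_ge0; rewrite ?powR_ge0//; apply: mulr_ge0;
      rewrite ?powR_ge0//; apply: mulr_ge0; by rewrite ?powR_ge0.
  - move=> t rt; have t0 : 0 <= t by rewrite ltW// (lt_trans r0).
    rewrite (mfB mfI); [|exact: ladm_scale|exact: ladm_scale].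
    rewrite lerBlDr -addrA; apply: le_trans (uI t rt) _; rewrite lerD2l.
    rewrite [leRHS]addrC lerBrDr.
    have rt1 : 1 < r^-1 * t by rewrite mulrC ltr_pdivlMr// mul1r.
    have IB : I (fun v => B (t * v)) <= B t - D * ((m - 1) / 2 * (r^-1 * t) `^ g).
      have ls := ladm_scale (rt0 t t0) lPsi.
      have -> : I (fun v => B (t * v)) = I (fun v => eps * t `^ beta * v `^ beta +
           D * Psi ((r^-1 * t) * v)).
        apply: (mf_eq mfI); first exact: ladm_scale.
          by apply: admD; exact: admZ.
        move=> v /andP[v0 v1]; rewrite /B powRM//; congr (_ + _); first by rewrite mulrA.
        by rewrite mulrA.
      rewrite (mfD mfI); [|exact: admZ|exact: admZ].
      rewrite !(mfZ mfI)// Ibeta mulr1 /B -addrA lerD2l -mulrBr ler_wpM2l//.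
      exact: Psi_super.
    apply: le_trans (lerD (lexx _) IB) _; rewrite addrCA gerDl.
    rewrite subr_le0 /D.
    have -> : t `^ (beta - rho) = r `^ g * (r^-1 * t) `^ g.
      by rewrite -/g -powRM ?(ltW r0) ?rt0// mulrA divff ?mul1r// gt_eqF.
    have -> : r `^ g = r `^ (- rho) * r `^ beta.
      by rewrite -powRD ?[- rho + _]addrC// gt_eqF ?implybT.
    have -> : K = K1 * ((m - 1) / 2) by rewrite /K1; field; rewrite gt_eqF.
    set a := r `^ (- rho); set b := r `^ beta; set c := (_ * t) `^ _; set d := L `^ _.
    have := mulr_ge0 G0 (powR_ge0 L (- rho)); rewrite -/d => gd.
    have bc : 0 <= b * c by rewrite mulr_ge0 ?powR_ge0.
    have := mulr_ge0 (mulr_ge0 gd bc) (ltW m10).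
    by move=> h; lra.
move=> t rt; have t0 : 0 <= t by rewrite (le_trans (ltW r0)).
have := le0 t t0; rewrite subr_le0 => /le_trans; apply.
rewrite /B mulrDl lerD2l.
have rt1 : 1 <= r^-1 * t by rewrite mulrC ler_pdivlMr// mul1r.
apply: (@le_trans _ _ (D * (A * (r^-1 * t) `^ beta))).
  by rewrite ler_wpM2l// Psi_le.
have -> : D * (A * (r^-1 * t) `^ beta) =
   A * (G * L `^ (- rho) + K1 * r `^ (- rho)) * t `^ beta.
  have -> : t `^ beta = r `^ beta * (r^-1 * t) `^ beta.
    by rewrite -powRM ?(ltW r0) ?rt0// mulrA divff ?mul1r// gt_eqF.
  by rewrite /D; ring.
rewrite ler_wpM2r ?powR_ge0// -[A * B0 * _]mulrA ler_wpM2l ?(ltW A0)//.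
rewrite mulrDr lerD//.
  by rewrite ler_peMl ?mulr_ge0 ?powR_ge0// /B0 le_max lexx.
rewrite mulrA ler_wpM2r ?powR_ge0// /K1 mulrAC ler_wpM2r//.
by rewrite /B0 le_max lexx orbT.
Qed.

End persistence.

(** * Approximate solutions of the renewal equation *)

Section small_powers.
Variable R : realType.

Lemma powR_small (rho D e : R) : 0 < rho -> 0 <= D -> 0 < e ->
  exists T, 1 <= T /\ forall t, T <= t -> D * t `^ (- rho) <= e.
Proof.
move=> rho0 D0 e0; have [T [T0 hT]] := powR_unbounded (D / e) rho0.
exists (Num.max 1 T); split; first by rewrite le_max lexx.
move=> t; rewrite ge_max => /andP[t1 /hT h]; rewrite powRN ler_pdivrMr; last first.
  by rewrite powR_gt0// (lt_le_trans ltr01).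
by rewrite mulrC -ler_pdivrMr.
Qed.
End small_powers.

Section asymptotic_solution.
Variables (R : realType) (I : (R -> R) -> R) (beta rho : R).
Hypothesis rk : renewal_kernel I beta.
Hypothesis beta1 : beta <= 1.
Hypothesis rho0 : 0 < rho.
Hypothesis rho_beta : rho < beta.
Let mfI := rk_mf rk.
Let beta0 := rk_beta0 rk.
Let Ibeta := rk_beta rk.

(** The term 1 in [ar_lip] admits step functions of step length 1. *)
Record approx_renewal (y : R -> R) (G K C t0 : R) : Prop := ApproxRenewal {
  ar_meas : measurable_fun setT y ;
  ar_G0 : 0 <= G ; ar_K0 : 0 <= K ; ar_C0 : 0 <= C ; ar_t0 : 0 < t0 ;
  ar_bound : forall t, 0 <= t -> `|y t| <= G * t `^ beta ;
  ar_eq : forall t, t0 <= t ->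
    `|y t - I (fun v => y (t * v))| <= K * t `^ (beta - rho) ;
  ar_lip : forall s t, 0 <= s -> 0 <= t -> `|y s - y t| <= C * (`|s - t| + 1) }.

Section fixed_solution.
Variables (y : R -> R) (G K C t0 : R).
Hypothesis ar : approx_renewal y G K C t0.
Let G0 := ar_G0 ar.
Let K0 := ar_K0 ar.
Let C0 := ar_C0 ar.
Let t0p := ar_t0 ar.

Definition normalized (t : R) := y t / t `^ beta.
Local Notation g := normalized.

Lemma ar_ladm : ladm y.
Proof.
split; first exact: ar_meas ar.
move=> T; exists (G * T `^ beta) => t /andP[t_ge0 tT].
apply: le_trans (ar_bound ar t_ge0) _; rewrite ler_wpM2l//.
by apply: le_powR2r => //; exact: ltW.
Qed.

Lemma ar_0 : y 0 = 0.
Proof.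
by apply/eqP; rewrite -normr_le0; apply: le_trans (ar_bound ar (lexx 0)) _;
  rewrite powR0 ?mulr0// gt_eqF.
Qed.

Lemma normalizedK t : 0 < t -> y t = g t * t `^ beta.
Proof. by move=> t_gt0; rewrite /g divfK// gt_eqF// powR_gt0. Qed.

Lemma normalized_le t : 0 < t -> `|g t| <= G.
Proof.
move=> t_gt0; rewrite normrM normfV (ger0_norm (powR_ge0 _ _)).
by rewrite ler_pdivrMr ?powR_gt0// (ar_bound ar)// ltW.
Qed.

(** Two dilations of a solution differ by another approximate solution, so
persistence spreads their closeness from one window to all larger arguments. *)
Lemma normalized_uniform_cont e : 0 < e ->
  exists z T, [/\ 0 < z, z < 1, 0 < T & forall s t, T <= s -> s <= t ->
    (1 - z) * t <= s -> `|g s - g t| <= e].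
Proof.
move=> e0; have [A [A0 hA]] := renewal_persistence rk rho0 rho_beta.
pose d := e / 8; have d0 : 0 < d by rewrite divr_gt0.
have [L [L1 hL]] := @powR_small R rho (A * (2 * G)) d rho0
   (mulr_ge0 (ltW A0) (mulr_ge0 (ler0n _ 2) G0)) d0.
have [r1 [r11 hr1]] := @powR_small R rho (A * (2 * K)) d rho0
   (mulr_ge0 (ltW A0) (mulr_ge0 (ler0n _ 2) K0)) d0.
have [r2 [r20 hr2]] := powR_unbounded (2 * C / d) beta0.
have L0 : 0 < L by exact: lt_le_trans L1.
pose r := Num.max (Num.max r1 (r2 * L)) (2 * t0).
have rr1 : r1 <= r by rewrite !le_max lexx.
have r0 : 0 < r by apply: lt_le_trans rr1; apply: lt_le_trans r11.
have rL : 2 * C <= d * (r / L) `^ beta.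
  rewrite [leRHS]mulrC -ler_pdivrMr// hr2// ler_pdivlMr//.
  by rewrite !le_max lexx orbT.
have rt0 : 2 * t0 <= r by rewrite !le_max lexx orbT.
pose z := Num.min (2^-1) (Num.min (r^-1) (d / (G + 1))).
have G1 : 0 < G + 1 by rewrite ltr_wpDl.
have z0 : 0 < z by rewrite !lt_min invr_gt0 ltr0n invr_gt0 r0 divr_gt0.
have [z12 zr' zG'] : [/\ z <= 2^-1, z <= r^-1 & z <= d / (G + 1)].
  by rewrite /z !ge_min !lexx !orbT.
have zr : z * r <= 1 by rewrite -ler_pdivlMr// div1r.
have zG : z * G <= d.
  apply: (@le_trans _ _ (z * (G + 1))); first by rewrite ler_wpM2l ?lerDl// ltW.
  by rewrite -ler_pdivlMr.
exists z, r; split => //; first by rewrite (le_lt_trans z12)// invf_lt1// ltr1n.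
move=> s t rs st zts.
have s0 : 0 < s by exact: lt_le_trans rs.
have tp : 0 < t by exact: lt_le_trans st.
pose l := s / t.
have l1 : l <= 1 by rewrite ler_pdivrMr// mul1r.
have lz : 1 - z <= l by rewrite ler_pdivlMr.
have l12 : 2^-1 <= l by lra.
have l0 : 0 < l by apply: lt_le_trans l12; rewrite invr_gt0.
have lb1 : l `^ beta <= 1.
  by rewrite -[leRHS](powR_1x beta); apply: le_powR2r => //; exact: ltW.
have lbl : l <= l `^ beta by apply: ger1_powR; rewrite ?l0.
pose u x := `|y (l * x) - l `^ beta * y x|.
have ly := ar_ladm.
have lly := ladm_scaler (ltW l0) ly.
have lu0 : ladm (fun x => y (l * x) - l `^ beta * y x).
  by apply: ladmB => //; exact: ladmZ.
have lu : ladm u by exact: ladm_norm.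
have := hA u r L (2 * d) (2 * G) (2 * K) lu r0 L1 (mulr_ge0 (ler0n _ 2) (ltW d0))
   (mulr_ge0 (ler0n _ 2) G0) (mulr_ge0 (ler0n _ 2) K0).
move=> /(_ _ _ _ t); rewrite (le_trans rs st) => H.
have {H}ut : u t <= (2 * d + A * (2 * G * L `^ (- rho) + 2 * K * r `^ (- rho))) * t `^ beta.
  apply: H => // [x x0|x rx|x /andP[rLx xr]].
  - rewrite normr_ge0/=; apply: le_trans (ler_normB _ _) _.
    rewrite normrM (ger0_norm (powR_ge0 _ _)).
    have h1 := ar_bound ar x0.
    have h2 := ar_bound ar (mulr_ge0 (ltW l0) x0).
    rewrite powRM ?(ltW l0)// in h2.
    have xb := powR_ge0 x beta; have gx := mulr_ge0 G0 xb.
    have : l `^ beta * `|y x| <= 1 * (G * x `^ beta).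
      by apply: ler_pM => //; exact: powR_ge0.
    have : G * (l `^ beta * x `^ beta) <= 1 * (G * x `^ beta).
      by rewrite mulrCA ler_wpM2r.
    by move=> *; lra.
  - have x0 : 0 < x by exact: lt_trans rx.
    have xt : t0 <= x by lra.
    have lxt : t0 <= l * x.
      apply: (@le_trans _ _ (2^-1 * x)); first lra.
      by rewrite ler_wpM2r// ltW.
    have e1 := ar_eq ar xt; have e2 := ar_eq ar lxt.
    have ax : adm (fun v => y (x * v)) by apply: ladm_scale => //; exact: ltW.
    have alx : adm (fun v => y (l * x * v)).
      by apply: ladm_scale => //; rewrite mulr_ge0 ?ltW.
    have aux : adm (fun v => y (l * (x * v)) - l `^ beta * y (x * v)).
      by apply: (@ladm_scale R (fun x => y (l * x) - l `^ beta * y x)) => //; exact: ltW.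
    have E : I (fun v => y (l * (x * v)) - l `^ beta * y (x * v)) =
       I (fun v => y (l * x * v)) - l `^ beta * I (fun v => y (x * v)).
      rewrite -(mfZ mfI)// -(mfB mfI)//; last exact: admZ.
      apply: (mf_eq mfI) => //; first by apply: admB => //; exact: admZ.
      by move=> v _; rewrite mulrA.
    have h1 : `|I (fun v => y (l * (x * v)) - l `^ beta * y (x * v))| <= I (fun v => u (x * v)).
      by apply: (mf_norm mfI).
    rewrite E in h1; rewrite /u.
    set a := y (l * x) in e2 *; set b := y x in e1 *.
    set ia := I _ in e2 h1 *; set ib := I _ in e1 h1 *; set iu := I _ in h1 *.
    have -> : a - l `^ beta * b = (a - ia) - l `^ beta * (b - ib) + (ia - l `^ beta * ib) by ring.
    apply: le_trans (ler_normD _ _) _; rewrite addrC lerD//.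
    apply: le_trans (ler_normB _ _) _; rewrite normrM (ger0_norm (powR_ge0 _ _)).
    have xg := powR_ge0 x (beta - rho).
    have h3 : l `^ beta * `|b - ib| <= 1 * (K * x `^ (beta - rho)).
      by apply: ler_pM => //; exact: powR_ge0.
    have h4 : (l * x) `^ (beta - rho) <= x `^ (beta - rho).
      apply: le_powR2r; [by rewrite subr_ge0 ltW|by rewrite mulr_ge0// ltW|].
      by rewrite ler_piMl// ltW.
    have h5 := ler_wpM2l K0 h4.
    by lra.
  - have x0 : 0 < x by apply: lt_le_trans rLx; rewrite divr_gt0.
    have h1 := ar_lip ar (ltW (mulr_gt0 l0 x0)) (ltW x0).
    have h2 := ar_bound ar (ltW x0).
    rewrite /u; have -> : y (l * x) - l `^ beta * y x =
        (y (l * x) - y x) + (1 - l `^ beta) * y x by ring.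
    apply: le_trans (ler_normD _ _) _.
    have h3 : `|l * x - x| <= 1.
      rewrite -[X in _ - X]mul1r -mulrBl normrM (gtr0_norm x0) distrC ger0_norm ?subr_ge0//.
      apply: le_trans zr; apply: ler_pM; rewrite ?subr_ge0 ?(ltW x0)//; lra.
    have h4 : (r / L) `^ beta <= x `^ beta.
      by apply: le_powR2r => //; [exact: ltW|rewrite divr_ge0// ltW].
    have h5 : `|(1 - l `^ beta) * y x| <= z * (G * x `^ beta).
      rewrite normrM (@ger0_norm _ (1 - _)) ?subr_ge0//.
      by apply: ler_pM => //; rewrite ?subr_ge0//; lra.
    have h6 : C * (`|l * x - x| + 1) <= C * 2 by rewrite ler_wpM2l//; lra.
    have h7 := ler_wpM2r (powR_ge0 x beta) zG.
    have h8 := ler_wpM2l (ltW d0) h4.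
    rewrite mulrA in h5; lra.
have hs : (2 * d + A * (2 * G * L `^ (- rho) + 2 * K * r `^ (- rho))) <= 4 * d.
  have := hL L (lexx _); have := hr1 r rr1; lra.
have -> : g s - g t = (y (l * t) - l `^ beta * y t) / (l * t) `^ beta.
  rewrite /g /l divfK ?gt_eqF// mulrBl; congr (_ - _).
  have -> : s `^ beta = (s / t) `^ beta * t `^ beta.
    by rewrite -powRM ?(ltW tp)// ?divr_ge0 ?(ltW s0) ?(ltW tp)// divfK// gt_eqF.
  by rewrite invfM mulrACA divff ?mul1r// gt_eqF// powR_gt0// divr_gt0.
rewrite normrM normfV (ger0_norm (powR_ge0 _ _)) -/(u t).
rewrite ler_pdivrMr; last by rewrite powR_gt0// mulr_gt0.
apply: (le_trans ut); rewrite powRM ?(ltW l0) ?(ltW tp)// [leRHS]mulrA.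
rewrite ler_wpM2r ?powR_ge0//; apply: (le_trans hs).
have -> : e = 8 * d by rewrite /d; field.
have := ler_wpM2l (ltW d0) (le_trans l12 lbl); lra.
Qed.

End fixed_solution.
End asymptotic_solution.

(** * Asymptotic periods *)

Section asymptotic_periods.
Variables (R : realType) (I : (R -> R) -> R) (beta rho : R).
Hypothesis rk : renewal_kernel I beta.
Hypothesis beta1 : beta <= 1.
Hypothesis rho0 : 0 < rho.
Hypothesis rho_beta : rho < beta.
Let mfI := rk_mf rk.
Let beta0 := rk_beta0 rk.
Let Ibeta := rk_beta rk.

Definition in_support (a : R) :=
  forall z, 0 < z -> 0 < I (itv_ind `[a - z, a + z]).

Lemma approx_renewalN y G K C t0 : approx_renewal I beta rho y G K C t0 ->
  approx_renewal I beta rho (fun t => - y t) G K C t0.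
Proof.
move=> ar; have ly := ar_ladm rk ar.
have lNy : ladm (fun t => -1 * y t) by exact: ladmZ.
case: (ar) => [? ? ? ? t0p hb he hl]; split => //.
- by apply: (measurableT_comp _ (ar_meas ar)); exact: oppr_measurable.
- by move=> t t_ge0; rewrite normrN hb.
- move=> t tt; have at0 : adm (fun v => y (t * v)).
    by apply: ladm_scale => //; rewrite (le_trans (ltW t0p)).
  have -> : I (fun v => - y (t * v)) = - I (fun v => y (t * v)).
    rewrite -mulN1r -(mfZ mfI)//; congr I.
    by apply/funext => v; rewrite mulN1r.
  by rewrite -opprD normrN he.
- by move=> s t s0 ?; rewrite -opprD normrN hl.
Qed.

Section fixed_solution.
Variables (y : R -> R) (G K C t0 : R).
Hypothesis ar : approx_renewal I beta rho y G K C t0.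
Let G0 := ar_G0 ar.
Let K0 := ar_K0 ar.
Let t0p := ar_t0 ar.
Local Notation g := (normalized beta y).

Definition asymptotic_period (a : R) := 0 < a /\
  forall e, 0 < e -> exists T, forall t, T <= t -> `|g t - g (t * a)| <= e.

Lemma ap_near e : 0 < e -> exists z T, [/\ 0 < z, z < 1, 0 < T &
  forall s t, T <= s -> T <= t -> `|s - t| <= z * t -> `|g s - g t| <= e].
Proof.
move=> e0; have [z [T [z0 z1 T0 H]]] := normalized_uniform_cont rk beta1 rho0 rho_beta ar e0.
exists (z / 2), T; split => //; try lra.
move=> s t Ts Tt st; have t_gt0 : 0 < t by exact: lt_le_trans Tt.
have zt := mulr_gt0 z0 t_gt0; have z1t : z * t <= 1 * t by rewrite ler_wpM2r// ltW.
have [le_st|lt_ts] := leP s t.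
  by apply: H => //; move: st; rewrite ler0_norm ?subr_le0//; lra.
rewrite distrC; apply: H => //; first exact: ltW.
have s_gt0 : 0 < s by exact: lt_trans lt_ts.
have zs : z * t <= z * s by rewrite ler_wpM2l// ltW.
by move: st; rewrite ger0_norm ?subr_ge0 ?(ltW lt_ts)//; lra.
Qed.

Let q a t := g t - g (t * a).

(** The gap q(t) = g(t) - g(t a) is, up to small errors, the average of q(t v) over the law
v^beta I(dv), all of whose values are almost at most eta. When q(t) nearly equals eta,
so must q(t v) for v close to the point a of the support, and hence q(t a), by uniform
continuity. *)
Lemma max_gap_step a eta : 0 < a -> a <= 1 -> in_support a ->
  (forall e, 0 < e -> exists T, forall t, T <= t -> q a t <= eta + e) -> 0 <= eta ->
  forall e, 0 < e -> exists e' T, 0 < e' /\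
    forall t, T <= t -> eta - e' <= q a t -> eta - e <= q a (t * a).
Proof.
move=> a0 a1 sa hq eta0 e e0.
have [z [T1 [z0 z1 T10 H1]]] := @ap_near (e / 4) (divr_gt0 e0 (ltr0n _ 4)).
pose zz := z * a / 2; have zz0 : 0 < zz by rewrite /zz divr_gt0// mulr_gt0.
have zza : zz < a by rewrite /zz ltr_pdivrMr//; nra.
pose w := itv_ind `[a - zz, a + zz].
have aw : adm w by exact: adm_ind.
have ab : adm (fun v : R => v `^ beta) by apply: adm_pow; exact: ltW.
have abw : adm (fun v : R => v `^ beta * w v) by exact: admM.
pose pA := I (fun v => v `^ beta * w v).
have pA0 : 0 < pA.
  apply: (@lt_le_trans _ _ ((a - zz) `^ beta * I w)).
    by rewrite mulr_gt0 ?powR_gt0 ?subr_gt0// sa.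
  rewrite -(mfZ mfI)//; apply: (mf_le mfI) => //; first exact: admZ.
  move=> v /andP[v0 v1]; rewrite /w /itv_ind in_itv /=; case: andP => [[h _]|_].
    by rewrite !mulr1; apply: le_powR2r; rewrite ?subr_ge0 ?(ltW zza)// ltW.
  by rewrite !mulr0.
pose e' := e * pA / 8; have e'0 : 0 < e' by rewrite /e' divr_gt0// mulr_gt0.
have [T2' hT2] := hq e' e'0; pose T2 := Num.max 0 T2'.
have T20 : 0 <= T2 by rewrite le_max lexx.
have c1 := mf1_ge0 mfI; set i1 := I (fun=> 1) in c1.
pose z' t := y t - a `^ (- beta) * y (t * a).
have ly := ar_ladm rk ar.
have lya : ladm (fun t => y (t * a)).
  rewrite (_ : (fun t => _) = (fun t => y (a * t))); first by apply: ladm_scaler => //; exact: ltW.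
  by apply/funext => t; rewrite mulrC.
have lz' : ladm z' by apply: ladmB => //; exact: ladmZ.
have z'E t : 0 < t -> z' t = q a t * t `^ beta.
  move=> t_gt0; rewrite /z' /q.
  rewrite (normalizedK beta y t_gt0) (normalizedK beta y (mulr_gt0 t_gt0 a0)).
  rewrite powRM ?(ltW t_gt0) ?(ltW a0)// powRN; field.
  by rewrite gt_eqF// powR_gt0.
have q2G t : 0 < t -> q a t <= 2 * G.
  move=> t_gt0; have h1 := normalized_le ar t_gt0.
  have h2 := normalized_le ar (mulr_gt0 t_gt0 a0).
  move: h1 h2; rewrite !ler_norml /q => /andP[_ h1] /andP[h2 _]; lra.
pose K' := K * (1 + a `^ (- rho)).
have K'0 : 0 <= K' by rewrite mulr_ge0// addr_ge0// powR_ge0.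
have z'I t : t0 / a <= t -> z' t <= I (fun v => z' (t * v)) + K' * t `^ (beta - rho).
  move=> tt; have ta : t0 <= t * a by rewrite -ler_pdivrMr.
  have t_gt0 : 0 < t by apply: lt_le_trans tt; rewrite divr_gt0.
  have tt0 : t0 <= t by apply: (le_trans ta); rewrite ler_piMr// ltW.
  have at1 : adm (fun v => y (t * v)) by apply: ladm_scale => //; exact: ltW.
  have at2 : adm (fun v => y (t * a * v)).
    by apply: ladm_scale => //; rewrite mulr_ge0 ?(ltW t_gt0)// ltW.
  have -> : I (fun v => z' (t * v)) =
      I (fun v => y (t * v)) - a `^ (- beta) * I (fun v => y (t * a * v)).
    rewrite -(mfZ mfI)// -(mfB mfI)//; last exact: admZ.
    apply: (mf_eq mfI); first by apply: ladm_scale => //; exact: ltW.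
      by apply: admB => //; exact: admZ.
    by move=> v _; rewrite /z' mulrAC.
  have := ar_eq ar tt0; have := ar_eq ar ta.
  set i2 := I _; set i3 := I _; rewrite !ler_norml => /andP[h2 _] /andP[_ h1].
  have h3 := ler_wpM2l (powR_ge0 a (- beta)) h2.
  have h4 : a `^ (- beta) * (t * a) `^ (beta - rho) = a `^ (- rho) * t `^ (beta - rho).
    rewrite powRM ?(ltW t_gt0) ?(ltW a0)// mulrCA -powRD; last by rewrite (gt_eqF a0) implybT.
    by rewrite [- beta + _]addrA addNr add0r mulrC.
  have h5 : a `^ (- beta) * - (K * (t * a) `^ (beta - rho)) = - (K * (a `^ (- rho) * t `^ (beta - rho))).
    by rewrite -h4; ring.
  rewrite h5 in h3; rewrite /z' /K'; lra.
pose B1 := 2 * G * T2 `^ beta * i1.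
have B10 : 0 <= B1 by rewrite /B1 !mulr_ge0 ?powR_ge0.
have [T3 [T31 hT3]] := @powR_small R beta B1 (e' / 4) beta0 B10 (divr_gt0 e'0 (ltr0n _ 4)).
have [T4 [T41 hT4]] := @powR_small R rho K' (e' / 4) rho0 K'0 (divr_gt0 e'0 (ltr0n _ 4)).
pose T5 := Num.max (Num.max T3 T4) (Num.max (t0 / a) (T1 / (a - zz) / a)).
exists e', T5; split => // t; rewrite /T5 !ge_max => /andP[/andP[t3 t4] /andP[tt0 t1]] qt.
have t_gt0 : 0 < t by apply: lt_le_trans tt0; rewrite divr_gt0.
rewrite leNgt; apply/negP => qta.
have t1a : T1 <= t * a * (a - zz) by rewrite -!ler_pdivrMr ?subr_gt0// mulrAC.
have near_a v : a - zz <= v <= a + zz -> q a (t * v) <= eta - e / 2.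
  move=> /andP[v1 v2]; have v0 : 0 < v by apply: lt_le_trans v1; rewrite subr_gt0.
  have taz : t * a * (a - zz) <= t * (a - zz).
    by rewrite mulrAC ler_piMr// mulr_ge0 ?subr_ge0 ?(ltW t_gt0) ?(ltW zza).
  have tv : t * (a - zz) <= t * v by rewrite ler_wpM2l// ltW.
  have tz : t * (a - zz) <= t * a by rewrite ler_wpM2l ?(ltW t_gt0)// gerBl ltW.
  have hva : `|v - a| <= zz by rewrite ler_norml; apply/andP; split; lra.
  have hz : zz <= z * a by rewrite /zz ler_pdivrMr//; have := mulr_gt0 z0 a0; lra.
  have d1 : `|t * v - t * a| <= z * (t * a).
    rewrite -mulrBr normrM (gtr0_norm t_gt0) mulrCA ler_wpM2l ?(ltW t_gt0)//.
    exact: le_trans hz.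
  have h1 := H1 (t * v) (t * a) (le_trans t1a (le_trans taz tv))
    (le_trans t1a (le_trans taz tz)) d1.
  have d2 : `|t * v * a - t * a * a| <= z * (t * a * a).
    by rewrite -mulrBl normrM (gtr0_norm a0) [z * _]mulrA ler_wpM2r ?(ltW a0).
  have tva : t * a * (a - zz) <= t * v * a by rewrite mulrAC ler_wpM2r ?(ltW a0).
  have taa : t * a * (a - zz) <= t * a * a.
    by rewrite ler_wpM2l ?mulr_ge0 ?(ltW t_gt0) ?(ltW a0)// gerBl ltW.
  have h2 := H1 (t * v * a) (t * a * a) (le_trans t1a tva) (le_trans t1a taa) d2.
  move: h1 h2 qta; rewrite /q !ler_norml => /andP[h1 h2] /andP[h3 h4] h5; lra.
have key : I (fun v => z' (t * v)) <=
    (eta + e') * t `^ beta - e / 2 * t `^ beta * pA + B1.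
  have E : I (fun v => (eta + e') * t `^ beta * v `^ beta
      - e / 2 * t `^ beta * (v `^ beta * w v) + 2 * G * T2 `^ beta) =
      (eta + e') * t `^ beta - e / 2 * t `^ beta * pA + B1.
    rewrite (mfD mfI); [|by apply: admB; exact: admZ|exact: adm_cst].
    rewrite (mfB mfI); [|exact: admZ|exact: admZ].
    congr (_ - _ + _); [|exact: (mfZ mfI)|exact: (mf_cst mfI)].
    by have := mfZ mfI ((eta + e') * t `^ beta) ab; rewrite Ibeta mulr1.
  rewrite -E; apply: (mf_le mfI); first by apply: ladm_scale => //; exact: ltW.
    by apply: admD; [apply: admB; exact: admZ|exact: adm_cst].
  move=> v /andP[v0 v1].
  have tb := powR_ge0 t beta; have vb := powR_ge0 v beta.
  have gT : 0 <= 2 * G * T2 `^ beta by rewrite !mulr_ge0 ?powR_ge0.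
  have tvb : 0 <= t `^ beta * v `^ beta by rewrite mulr_ge0.
  have etv : 0 <= eta * (t `^ beta * v `^ beta) by rewrite mulr_ge0.
  have e'tv : 0 <= e' * (t `^ beta * v `^ beta) by rewrite mulr_ge0// ltW.
  have etv2 : 0 <= e * (t `^ beta * v `^ beta) by rewrite mulr_ge0// ltW.
  have [->|vn0] := eqVneq v 0.
    rewrite mulr0 /z' mul0r (ar_0 rk ar) mulr0 subr0 powR0 ?gt_eqF//.
    by rewrite mul0r !mulr0 subr0 add0r.
  have vp : 0 < v by rewrite lt_neqAle eq_sym vn0.
  have tvp := mulr_gt0 t_gt0 vp.
  rewrite z'E// powRM ?(ltW t_gt0)//.
  rewrite /w /itv_ind in_itv /=; have [hv|_] := boolP (a - zz <= v <= a + zz);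
    rewrite ?mulr1 ?mulr0.
    have := ler_wpM2r tvb (near_a v hv); lra.
  have [tvT|tvT] := leP T2 (t * v).
    have h : q a (t * v) <= eta + e' by apply: hT2; apply: le_trans tvT; rewrite le_max lexx orbT.
    have := ler_wpM2r tvb h; lra.
  have h1 := ler_wpM2r (powR_ge0 (t * v) beta) (q2G _ tvp).
  have h2 : (t * v) `^ beta <= T2 `^ beta by apply: le_powR2r; exact: ltW.
  have h3 := ler_wpM2l (mulr_ge0 (ler0n _ 2) G0) h2.
  rewrite powRM ?(ltW t_gt0)// in h1 h3; lra.
have h1 := z'I t tt0; rewrite z'E// in h1.
have tb : 0 < t `^ beta by exact: powR_gt0.
have h2 : B1 <= e' / 4 * t `^ beta.
  by have := hT3 t t3; rewrite powRN ler_pdivrMr.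
have h3 : K' * t `^ (beta - rho) <= e' / 4 * t `^ beta.
  rewrite powRD; last by rewrite (gt_eqF t_gt0) implybT.
  rewrite mulrCA [X in _ <= X]mulrC; apply: ler_wpM2l; [exact: ltW|exact: hT4].
have h4 := ler_wpM2r (ltW tb) qt.
have h5 : e / 2 * t `^ beta * pA = 4 * (e' * t `^ beta) by rewrite /e'; field.
have h6 : 0 < e' * t `^ beta by rewrite mulr_gt0.
rewrite h5 in key; lra.
Qed.

End fixed_solution.
End asymptotic_periods.

Section asymptotic_periods2.
Variables (R : realType) (I : (R -> R) -> R) (beta rho : R).
Hypothesis rk : renewal_kernel I beta.
Hypothesis beta1 : beta <= 1.
Hypothesis rho0 : 0 < rho.
Hypothesis rho_beta : rho < beta.
Let mfI := rk_mf rk.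
Let beta0 := rk_beta0 rk.
Let Ibeta := rk_beta rk.

Section one_sided.
Variables (y : R -> R) (G K C t0 : R).
Hypothesis ar : approx_renewal I beta rho y G K C t0.
Let G0 := ar_G0 ar.
Local Notation g := (normalized beta y).
Let q a t := g t - g (t * a).

(** Steps of [max_gap_step] along the progression t, t a, t a^2, and so on. *)
Lemma max_gap_iter a eta : 0 < a -> a <= 1 -> in_support I a ->
  (forall e, 0 < e -> exists T, forall t, T <= t -> q a t <= eta + e) -> 0 <= eta ->
  forall k e, 0 < e -> exists e' T, 0 < e' /\
    forall t, T <= t -> eta - e' <= q a t ->
    forall j, (j <= k)%N -> eta - e <= q a (t * a ^+ j).
Proof.
move=> a0 a1 sa hq eta0; elim=> [|k IH] e e0.
  exists e, 0; split => // t _ h j; rewrite leqn0 => /eqP ->.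
  by rewrite expr0 mulr1.
have [e1 [T1 [e10 H1]]] := max_gap_step rk beta1 rho0 rho_beta ar a0 a1 sa hq eta0 e0.
have m0 : 0 < Num.min e e1 by rewrite lt_min e0.
have [e' [T [e'0 H]]] := IH _ m0.
exists e', (Num.max T (T1 / a ^+ k)); split => // t; rewrite ge_max => /andP[tT tT1] qt j.
have ak : 0 < a ^+ k by rewrite exprn_gt0.
have [me me1] : Num.min e e1 <= e /\ Num.min e e1 <= e1 by rewrite !ge_min !lexx orbT.
rewrite leq_eqVlt => /orP[/eqP ->|jk]; last first.
  by have := H t tT qt j jk; apply: le_trans; rewrite lerB.
rewrite exprSr mulrA; apply: H1; first by rewrite -ler_pdivrMr.
by have := H t tT qt k (leqnn k); apply: le_trans; rewrite lerB.
Qed.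

(** The Choquet-Deny argument: if the gap had a positive limit superior, it
would nearly be attained along a long geometric progression, and the gaps along
it would add up to more than the oscillation of a bounded function. *)
Lemma gap_limsup_le0 a : 0 < a -> a <= 1 -> in_support I a ->
  forall e, 0 < e -> exists T, forall t, T <= t -> q a t <= e.
Proof.
move=> a0 a1 sa.
have q2G t : 0 < t -> `|q a t| <= 2 * G.
  move=> t_gt0; have h1 := normalized_le ar t_gt0.
  have h2 := normalized_le ar (mulr_gt0 t_gt0 a0).
  by apply: le_trans (ler_normB _ _) _; lra.
pose S : set R := [set x | 0 <= x /\ exists T, forall t, T <= t -> q a t <= x].
have S0 : S !=set0.
  exists (2 * G); split; first by rewrite mulr_ge0.
  exists 1 => t t1; apply: le_trans (ler_norm _) (q2G _ _).
  exact: lt_le_trans t1.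
have Sinf : has_inf S by split => //; exists 0 => x [].
pose eta := inf S.
have eta0 : 0 <= eta by apply: lb_le_inf => // x [].
have hq e : 0 < e -> exists T, forall t, T <= t -> q a t <= eta + e.
  move=> e0; have [x [x0 [T hT]] xe] := inf_adherent e0 Sinf.
  by exists T => t /hT /le_trans; apply; exact: ltW.
have freq e T : 0 < e -> 0 < eta -> exists t, [/\ T <= t & eta - e <= q a t].
  move=> e0 eta_gt0; apply/not_existsP => H.
  pose e1 := Num.min e eta.
  have e10 : 0 < e1 by rewrite lt_min e0.
  have e1eta : e1 <= eta by rewrite ge_min lexx orbT.
  have e1e : e1 <= e by rewrite ge_min lexx.
  have : eta <= eta - e1.
    apply: ge_inf; first by case: Sinf.
    split; first by rewrite subr_ge0.
    exists T => t tT; rewrite leNgt; apply/negP => h; apply: (H t); split => //.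
    apply: le_trans (ltW h); lra.
  lra.
have [etap|] := ltP 0 eta; last first.
  move=> eta_le0 e e0; have [T hT] := hq e e0; exists T => t /hT.
  by move=> /le_trans; apply; lra.
exfalso.
have [k hk] : exists k : nat, 4 * G + 1 <= k%:R * eta.
  exists (Num.truncn ((4 * G + 1) / eta)).+1.
  rewrite -ler_pdivrMr//; apply/ltW/truncnS_gt.
have [e' [T [e'0 H]]] := max_gap_iter a0 a1 sa hq eta0 k (divr_gt0 etap (ltr0n _ 2)).
have [t [tm qt]] := freq e' (Num.max T 1) e'0 etap.
move: tm; rewrite ge_max => /andP[tT t1].
have t_gt0 : 0 < t by exact: lt_le_trans t1.
have tele j : (j <= k)%N -> j%:R * (eta / 2) <= g t - g (t * a ^+ j).
  elim: j => [|j IHj] jk; first by rewrite mul0r expr0 mulr1 subrr.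
  have h1 := IHj (ltnW jk); have := H t tT qt j (ltnW jk).
  rewrite /q -mulrA -exprSr -[j.+1%:R]natr1; lra.
have h1 := tele k (leqnn _).
have h2 := normalized_le ar t_gt0.
have h3 := normalized_le ar (mulr_gt0 t_gt0 (exprn_gt0 k a0)).
have : g t - g (t * a ^+ k) <= 2 * G.
  by apply: le_trans (ler_norm _) _; apply: le_trans (ler_normB _ _) _; lra.
lra.
Qed.

End one_sided.

Section two_sided.
Variables (y : R -> R) (G K C t0 : R).
Hypothesis ar : approx_renewal I beta rho y G K C t0.
Local Notation g := (normalized beta y).
Local Notation AP := (asymptotic_period beta y).

(** The lower bound for the gap is the upper bound for the gap of - y. *)
Lemma support_asymptotic_period a : 0 < a -> a <= 1 -> in_support I a -> AP a.
Proof.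
move=> a0 a1 sa; split => // e e0.
have [T1 H1] := gap_limsup_le0 ar a0 a1 sa e0.
have [T2 H2] := gap_limsup_le0 (approx_renewalN rk ar) a0 a1 sa e0.
exists (Num.max T1 T2) => t; rewrite ge_max => /andP[/H1 h1 /H2 h2].
by move: h1 h2; rewrite /normalized ler_norml !mulNr; lra.
Qed.

Lemma ap1 : AP 1.
Proof. by split => // e e0; exists 0 => t _; rewrite mulr1 subrr normr0 ltW. Qed.

Lemma apM a b : AP a -> AP b -> AP (a * b).
Proof.
move=> [a0 Ha] [b0 Hb]; split; first exact: mulr_gt0.
move=> e e0; have e20 : 0 < e / 2 by rewrite divr_gt0.
have [T1 H1] := Ha _ e20; have [T2 H2] := Hb _ e20.
exists (Num.max T1 (T2 / a)) => t; rewrite ge_max => /andP[t1 t2].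
have := H1 t t1; have := H2 (t * a); rewrite -ler_pdivrMr// => /(_ t2).
rewrite !ler_norml mulrA => /andP[h1 h2] /andP[h3 h4]; lra.
Qed.

Lemma apV a : AP a -> AP a^-1.
Proof.
move=> [a0 Ha]; split; first by rewrite invr_gt0.
move=> e e0; have [T H] := Ha _ e0; exists (T * a) => t tT.
by have := H (t / a); rewrite ler_pdivlMr// divfK ?gt_eqF// distrC => /(_ tT).
Qed.

Lemma apX a k : AP a -> AP (a ^+ k).
Proof.
by move=> Ha; elim: k => [|k IH]; rewrite ?expr0 ?exprS; [exact: ap1|exact: apM].
Qed.

Lemma ap_closed a : 0 < a ->
  (forall z, 0 < z -> exists b, AP b /\ `|b - a| <= z) -> AP a.
Proof.
move=> a0 Ha; split => // e e0; have e20 : 0 < e / 2 by rewrite divr_gt0.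
have [z [T [z0 z1 T0 H]]] := ap_near rk beta1 rho0 rho_beta ar e20.
have [|b [[b0 Hb] hb]] := Ha (z * a) ; first exact: mulr_gt0.
have [T1 H1] := Hb _ e20.
exists (Num.max T1 (Num.max (T / a) (T / b))) => t; rewrite !ge_max => /and3P[t1 ta tb].
have h1 := H1 t t1.
have ta0 : 0 < t by apply: lt_le_trans ta; rewrite divr_gt0.
have : `|g (t * b) - g (t * a)| <= e / 2.
  apply: H; [by rewrite -ler_pdivrMr|by rewrite -ler_pdivrMr|].
  by rewrite -mulrBr normrM (gtr0_norm ta0) mulrCA ler_wpM2l// ltW.
move: h1; rewrite !ler_norml => /andP[? ?] /andP[? ?]; lra.
Qed.

Lemma ap_finite (a : nat -> R) k e : 0 < e -> (forall j, AP (a j)) ->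
  exists T, forall t j, T <= t -> (j <= k)%N -> `|g t - g (t * a j)| <= e.
Proof.
move=> e0 Ha; elim: k => [|k [T IH]].
  have [T H] := (Ha 0%N).2 e e0; exists T => t j /H h.
  by rewrite leqn0 => /eqP ->.
have [T1 H1] := (Ha k.+1).2 e e0; exists (Num.max T T1) => t j.
rewrite ge_max => /andP[tT tT1]; rewrite leq_eqVlt => /orP[/eqP ->|]; first exact: H1.
exact: IH.
Qed.

(** The periods in L of bounded size can be used from a common threshold T on. *)
Definition uniform_period_set (L : R -> Prop) := forall M e, 1 <= M -> 0 < e ->
  exists T, forall r a, T <= r -> L a -> M^-1 <= a <= 1 -> `|g r - g (r * a)| <= e.

(** By uniform continuity it suffices to consider the finitely many periods of a geometric
grid in [1 / M, 1] whose ratio is close to 1. *)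
Lemma uniform_all : (forall a, 0 < a -> AP a) ->
  uniform_period_set (fun a => 0 < a).
Proof.
move=> Hall M e M1 e0; have e20 : 0 < e / 2 by rewrite divr_gt0.
have M0 : 0 < M by exact: lt_le_trans M1.
have [z [T [z0 z1 T0 H]]] := ap_near rk beta1 rho0 rho_beta ar e20.
pose s := 1 - z / 2; have s0 : 0 < s by rewrite /s; lra.
have s1 : s < 1 by rewrite /s; lra.
have [k hk] := expr_small (ltW s0) s1 (divr_gt0 (ltr01) M0 : 0 < 1 / M).
rewrite div1r in hk.
have [T1 H1] := @ap_finite (fun j => s ^+ j) k (e / 2) e20 (fun j => apX j (Hall _ s0)).
exists (Num.max T1 (T * M / s)) => r a; rewrite ge_max => /andP[r1 rT] a0 /andP[Ma a1].
have r0 : 0 < r by apply: lt_le_trans rT; rewrite divr_gt0// mulr_gt0.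
(* choose a grid point s ^ j with s ^ (j + 1) < a <= s ^ j *)
have [j [jk sja saj]] : exists j, [/\ (j <= k)%N, a <= s ^+ j & s * s ^+ j <= a].
  have P0 : exists j, s ^+ j <= a by exists k; exact: le_trans Ma.
  case: (ex_minnP P0) => [[|j]] hj hmin.
    exists 0%N; rewrite expr0 mulr1; split => //.
    by apply: le_trans hj; rewrite expr0 ltW.
  have jk : (j.+1 <= k)%N by apply: hmin; exact: le_trans Ma.
  exists j; rewrite ltnW// -exprS; split => //.
  rewrite leNgt; apply/negP => /ltW /hmin; by rewrite ltnn.
have sj0 : 0 < s ^+ j by rewrite exprn_gt0.
have h1 := H1 r j r1 jk.
have h2 : `|g (r * s ^+ j) - g (r * a)| <= e / 2.
  have rs : T * M <= r * s by rewrite -ler_pdivrMr.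
  have rM : T <= r * s * M^-1 by rewrite ler_pdivlMr.
  have rsa : T <= r * a.
    apply: (le_trans rM); rewrite -mulrA ler_wpM2l ?(ltW r0)//.
    by apply: (@le_trans _ _ M^-1) => //; rewrite ler_piMl ?invr_ge0 ?(ltW M0)// ltW.
  apply: H => //; first by apply: (le_trans rsa); rewrite ler_wpM2l// ltW.
  rewrite -mulrBr normrM (gtr0_norm r0) mulrCA ler_wpM2l ?(ltW r0)//.
  rewrite ger0_norm ?subr_ge0//.
  have : z * (s * s ^+ j) <= z * a by rewrite ler_wpM2l// ltW.
  have zs : 0 < z * s ^+ j by rewrite mulr_gt0.
  have : s * (z * s ^+ j) >= 2^-1 * (z * s ^+ j) by rewrite ler_wpM2r ?(ltW zs)// /s; lra.
  move: saj; rewrite /s; lra.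
move: h1 h2; rewrite !ler_norml => /andP[? ?] /andP[? ?]; lra.
Qed.

(** The window [1 / M, 1] contains finitely many powers of e^d. *)
Lemma uniform_lattice d : 0 < d -> AP (expR (- d)) ->
  uniform_period_set (fun a => exists k : int, a = expR (d * k%:~R)).
Proof.
move=> d0 Hd M e M1 e0.
have M0 : 0 < M by exact: lt_le_trans M1.
pose N := (Num.truncn (ln M / d)).+1.
have [T H] := @ap_finite (fun j => expR (- d) ^+ j) N e e0 (fun j => apX j Hd).
exists T => r a rT [k ->] /andP[h1 h2].
have k0 : k <= 0.
  rewrite -(lerz0 R) -(pmulr_rle0 _ d0) -ler_expR expR0.
  exact: h2.
have kE : k = - (`|k|%N : int) by lia.
have -> : expR (d * k%:~R) = expR (- d) ^+ `|k|.
  by rewrite {1}kE rmorphN /= mulrN -mulNr -expRM_natr.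
apply: H => //.
have h3 : - ln M <= d * k%:~R by rewrite -lnV// -ler_expR lnK ?posrE ?invr_gt0.
have h4 : (`|k|%N)%:R <= ln M / d.
  rewrite ler_pdivlMr//; move: h3; rewrite {1}kE rmorphN /=.
  by rewrite -[_%:~R]/((`|k|%N)%:R); lra.
rewrite /N; apply: leqW; rewrite truncn_ge_nat// divr_ge0 ?(ltW d0)//.
by rewrite ln_ge0.
Qed.

End two_sided.
End asymptotic_periods2.

(** * Convergence along orbits *)

Section renewal_cauchy.
Variables (R : realType) (I : (R -> R) -> R) (beta rho : R).
Hypothesis rk : renewal_kernel I beta.
Hypothesis beta1 : beta <= 1.
Hypothesis rho0 : 0 < rho.
Hypothesis rho_beta : rho < beta.
Let mfI := rk_mf rk.
Let beta0 := rk_beta0 rk.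
Let Ibeta := rk_beta rk.
Variables (y : R -> R) (G K C t0 : R).
Hypothesis ar : approx_renewal I beta rho y G K C t0.
Local Notation g := (normalized beta y).

(** On a long window to the left of r the function g is close to g(r) along the orbit
r L, by uniformity of the periods. The deviation |y - g(r) t^beta|, cut off outside the
orbit, is again an approximate subsolution because the walk never leaves the orbit,
and persistence carries the smallness over to the rest of the orbit. *)
Lemma renewal_cauchy (L : R -> Prop) :
  measurable [set a | L a] -> (forall a, L a -> 0 < a) -> L 1 ->
  (forall a b, L a -> L b -> L (a * b)) ->
  (forall F H, adm F -> adm H -> F 0 <= H 0 ->
    (forall v, 0 < v <= 1 -> L v -> F v <= H v) -> I F <= I H) ->
  uniform_period_set beta y L ->
  forall e, 0 < e -> exists T, 0 < T /\
    forall s a, T <= s -> L a -> 1 <= a -> `|g s - g (s * a)| <= e.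
Proof.
move=> mL Lpos L1 LM Lmono Lunif e e0.
have G0 := ar_G0 ar; have K0 := ar_K0 ar; have t0p := ar_t0 ar.
have [A [A0 hA]] := renewal_persistence rk rho0 rho_beta.
pose d := e / 3; have d0 : 0 < d by rewrite divr_gt0.
have [M [M1 hM]] := @powR_small R rho (A * (2 * G)) d rho0
   (mulr_ge0 (ltW A0) (mulr_ge0 (ler0n _ 2) G0)) d0.
have [r1 [r11 hr1]] := @powR_small R rho (A * K) d rho0 (mulr_ge0 (ltW A0) K0) d0.
have [T HT] := Lunif M d M1 d0.
have M0 : 0 < M by exact: lt_le_trans M1.
pose T' := Num.max (Num.max T r1) t0; exists T'.
split; first by rewrite lt_max t0p orbT.
move=> r a; rewrite !ge_max => /andP[/andP[rT rr1] rt0] La a1.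
have r0 : 0 < r by exact: lt_le_trans rt0.
pose c := g r; have cG : `|c| <= G by exact: (normalized_le ar).
pose w t := y t - c * t `^ beta.
pose ind t : R := \1_[set a | L a] (r^-1 * t).
pose u t := `|w t| * ind t.
have ind1 t : L (r^-1 * t) -> ind t = 1.
  by move=> h; rewrite /ind indicE mem_set.
have ind0 t : ~ L (r^-1 * t) -> ind t = 0.
  by move=> h; rewrite /ind indicE memNset.
have ly := ar_ladm rk ar.
have lw : ladm w by apply: ladmB => //; apply: ladmZ; apply: ladm_pow; exact: ltW.
have lind : ladm ind.
  apply: (@ladm_scaler R (\1_[set a | L a])); first by rewrite invr_ge0 ltW.
  apply: ladm_bounded; first exact: measurable_indic.
  by exists 1 => t; rewrite indicE; case: (_ \in _); rewrite ?normr1 ?normr0.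
have lu : ladm u by apply: ladmM => //; exact: ladm_norm.
have u_ge0 t : 0 <= u t by rewrite /u /ind indicE mulr_ge0.
have uw t : u t <= `|w t|.
  by rewrite /u /ind indicE; case: (_ \in _); rewrite ?mulr1 ?mulr0.
have wG t : 0 <= t -> `|w t| <= 2 * G * t `^ beta.
  move=> t_ge0; apply: le_trans (ler_normB _ _) _.
  have h1 := ar_bound ar t_ge0.
  rewrite normrM (ger0_norm (powR_ge0 _ _)).
  have h2 := ler_wpM2r (powR_ge0 t beta) cG; lra.
have H := hA u r M d (2 * G) K lu r0 M1 (ltW d0) (mulr_ge0 (ler0n _ 2) G0) K0.
have ra : r <= r * a by rewrite ler_peMr// ltW.
have ra0 : 0 < r * a by rewrite mulr_gt0// Lpos.
have : u (r * a) <= (d + A * (2 * G * M `^ (- rho) + K * r `^ (- rho))) * (r * a) `^ beta.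
  apply: H => // [t t_ge0|t rt|t /andP[rMt tr]].
  - by rewrite u_ge0/=; apply: le_trans (uw t) (wG t _).
  - have t_gt0 : 0 < t by exact: lt_trans rt.
    have tt0 : t0 <= t by rewrite (le_trans rt0)// ltW.
    have aut : adm (fun v => u (t * v)) by apply: ladm_scale => //; exact: ltW.
    have [Lt|nLt] := pselect (L (r^-1 * t)); last first.
      rewrite {1}/u ind0// mulr0 addr_ge0 ?mulr_ge0 ?powR_ge0//.
      by apply: (mf_ge0 mfI).
    have awt : adm (fun v => w (t * v)) by apply: ladm_scale => //; exact: ltW.
    have ayt : adm (fun v => y (t * v)) by apply: ladm_scale => //; exact: ltW.
    have ab : adm (fun v : R => v `^ beta) by apply: adm_pow; exact: ltW.
    have Ew : I (fun v => w (t * v)) = I (fun v => y (t * v)) - c * t `^ beta.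
      transitivity (I (fun v => y (t * v) - c * t `^ beta * v `^ beta)).
        apply: (mf_eq mfI) => //; first by apply: admB => //; exact: admZ.
        by move=> v /andP[v0 v1]; rewrite /w powRM ?(ltW t_gt0)// mulrA.
      rewrite (mfB mfI)//; last exact: admZ.
      by have := mfZ mfI (c * t `^ beta) ab; rewrite Ibeta mulr1 => ->.
    have h1 := mf_norm mfI awt.
    have h2 : I (fun v => `|w (t * v)|) <= I (fun v => u (t * v)).
      apply: Lmono => //; first exact: adm_norm.
        by rewrite mulr0 /w (ar_0 rk ar) powR0 ?gt_eqF// mulr0 subrr normr0.
      move=> v v01 Lv; rewrite /u ind1 ?mulr1//.
      by rewrite mulrA; exact: LM.
    have h3 := ar_eq ar tt0; rewrite Ew in h1.
    apply: (le_trans (uw t)); rewrite /w.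
    set i1 := I _ in h1 h3 *.
    have -> : y t - c * t `^ beta = (y t - i1) + (i1 - c * t `^ beta) by ring.
    apply: le_trans (ler_normD _ _) _; rewrite addrC lerD//.
    exact: le_trans h2.
  - have t_gt0 : 0 < t by apply: lt_le_trans rMt; rewrite divr_gt0.
    have [Lt|nLt] := pselect (L (r^-1 * t)); last first.
      by rewrite /u ind0// mulr0 mulr_ge0 ?powR_ge0 ?(ltW d0).
    apply: (le_trans (uw t)).
    have := HT r (r^-1 * t) rT Lt; rewrite mulrA mulfV ?gt_eqF// mul1r => hh.
    have {}hh : `|g r - g t| <= d.
      apply: hh; rewrite ![r^-1 * _]mulrC ler_pdivrMr// mul1r tr andbT.
      by rewrite ler_pdivlMr// mulrC.
    rewrite /w (normalizedK beta y t_gt0) -mulrBl normrM (ger0_norm (powR_ge0 _ _)).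
    by rewrite ler_wpM2r ?powR_ge0// distrC.
have E : r^-1 * (r * a) = a by rewrite mulrA mulVf ?mul1r// gt_eqF.
rewrite /u ind1 ?E// mulr1 /w (normalizedK beta y ra0) -mulrBl normrM.
rewrite (ger0_norm (powR_ge0 _ _)) ler_pM2r ?powR_gt0// distrC => /le_trans; apply.
have := hM M (lexx _); have := hr1 r rr1; rewrite /d; lra.
Qed.

End renewal_cauchy.

Section closed_subgroups.
Variable R : realType.

(** A closed subgroup of the reals is everything or cyclic: its positive
elements have either infimum 0 or a least element. *)
Lemma closed_subgroup_dichotomy (H : R -> Prop) :
  H 0 -> (forall x y, H x -> H y -> H (x - y)) ->
  (forall x, (forall e, 0 < e -> exists y, H y /\ `|y - x| <= e) -> H x) ->
  (forall x, H x) \/ exists D, [/\ 0 <= D, H D &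
    forall x, H x -> exists k : int, x = D * k%:~R].
Proof.
move=> H0 HB Hcl.
have HN x : H x -> H (- x) by move=> Hx; rewrite -[- x]add0r; exact: HB.
have HD x y : H x -> H y -> H (x + y).
  by move=> Hx Hy; rewrite -[y]opprK; apply: HB => //; exact: HN.
have HMn x k : H x -> H (x * k%:R).
  move=> Hx; elim: k => [|k IH]; first by rewrite mulr0.
  by rewrite -natr1 mulrDr mulr1; exact: HD.
have HMz x (k : int) : H x -> H (x * k%:~R).
  by move=> Hx; case: k => k; [exact: HMn|rewrite NegzE rmorphN mulrN; exact/HN/HMn].
pose S : set R := [set x | 0 < x /\ H x].
have [Sn0|S0] := pselect (S !=set0); last first.
  right; exists 0; split => // x Hx; exists 0; rewrite mul0r.
  apply: contrapT => /eqP xn0; apply: S0.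
  have [x0|x0] := ltP 0 x; first by exists x.
  exists (- x); split; last exact: HN.
  by rewrite oppr_gt0 lt_neqAle xn0.
have Sinf : has_inf S by split => //; exists 0 => x [/ltW].
pose D := inf S.
have D0 : 0 <= D by apply: lb_le_inf => // x [/ltW].
have Dlb x : S x -> D <= x by move=> Sx; apply: ge_inf => //; case: Sinf.
have rem p x : 0 < p -> H p -> H x ->
    let k := Num.floor (x / p) in
    [/\ 0 <= x - p * k%:~R, x - p * k%:~R < p & H (x - p * k%:~R)].
  move=> p0 Hp Hx k; split; last by apply: HB => //; exact: HMz.
    by rewrite subr_ge0 mulrC -ler_pdivlMr// floor_le_tmp.
  rewrite ltrBlDr -[X in X + _]mulr1 -mulrDr mulrC -ltr_pdivrMr//.
  by rewrite addrC -[1]/(1%:~R) -intrD floorD1_gt.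
have [Dp|Dle] := ltP 0 D.
  have HDD : H D.
    apply: Hcl => e e0; have [x [x0 Hx] xe] := inf_adherent e0 Sinf.
    exists x; split => //; rewrite ger0_norm ?subr_ge0; last exact: Dlb.
    by rewrite lerBlDl ltW.
  right; exists D; split => // x Hx; exists (Num.floor (x / D)).
  have [h1 h2 h3] := rem D x Dp HDD Hx.
  move: h1; rewrite le_eqVlt => /orP[/eqP h|h]; first by apply/eqP; rewrite -subr_eq0 -h.
  have := Dlb _ (conj h h3); by rewrite leNgt h2.
left => x; apply: Hcl => e e0.
have DE : D = 0 by apply/eqP; rewrite eq_le Dle.
have [p [p0 Hp]] := inf_adherent e0 Sinf; rewrite -/D DE add0r => pe.
exists (p * (Num.floor (x / p))%:~R); split; first exact: HMz.
have h1 : p * (Num.floor (x / p))%:~R <= x by rewrite mulrC -ler_pdivlMr// floor_le_tmp.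
have h2 : x < p * (Num.floor (x / p))%:~R + p.
  rewrite -[X in _ + X]mulr1 -mulrDr mulrC -ltr_pdivrMr//.
  by rewrite -[1]/(1%:~R) -intrD floorD1_gt.
rewrite distrC ger0_norm ?subr_ge0//; lra.
Qed.

End closed_subgroups.

(** * The recursion for the number of balls *)

Section binomial_powers.
Variable R : realType.
Implicit Types (th v : R) (N k : nat).

Lemma binE_pow_le th N v : 0 < th -> th <= 1 -> 0 <= v <= 1 ->
  binE N (fun k => k%:R `^ th) v <= (N%:R * v) `^ th.
Proof.
move=> th0 th1 v01; have /andP[v0 v1] := v01.
have m0 : 0 <= N%:R * v by rewrite mulr_ge0.
have [mE|mn0] := eqVneq (N%:R * v) 0.
  rewrite mE powR0 ?gt_eqF//.
  have <- : binE N (fun k => k%:R) v = 0 by rewrite binE_mean.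
  apply: binE_le => // -[|k] _.
    by rewrite powR0 ?gt_eqF.
  by apply: ler1_powR => //; rewrite ler1n.
have mp : 0 < N%:R * v by rewrite lt_neqAle eq_sym mn0.
set m := N%:R * v in mp *.
apply: (@le_trans _ _ (binE N (fun k => (m `^ th - th * m `^ (th - 1) * m) +
    (th * m `^ (th - 1)) * k%:R) v)).
  apply: binE_le => // k _; have := powR_le_tangent (ltW th0) th1 mp (ler0n R k); lra.
rewrite binED binE_cst (binEZ _ _ (fun k => k%:R)) binE_mean -/m; lra.
Qed.

(** Around the mean m = N v >= 1 the power k^th varies like m^(th - 1) |k - m|, and the mean
deviation is at most m^(1/2); for m < 1 everything is bounded. *)
Lemma binE_pow_dist th h N v : 0 < th -> th <= 1 -> 0 <= v <= 1 ->
  0 <= h -> th - 2^-1 <= h ->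
  binE N (fun k => `|k%:R `^ th - (N%:R * v) `^ th|) v <= N%:R `^ h + 2.
Proof.
move=> th0 th1 v01 h0 thh; have /andP[v0 v1] := v01.
have m0 : 0 <= N%:R * v by rewrite mulr_ge0.
have mN : N%:R * v <= N%:R by rewrite ler_piMr.
have hb := binE_pow_le N th0 th1 v01; have hd := binE_dev N v01.
set m := N%:R * v in m0 mN hb hd *.
have [m1|m1] := leP 1 m.
  have mp : 0 < m by exact: lt_le_trans m1.
  apply: (@le_trans _ _ (binE N (fun k => m `^ (th - 1) * `|k%:R - m|) v)).
    by apply: binE_le => // k _; apply: powR_dist => //; exact: ltW.
  rewrite binEZ; apply: (@le_trans _ _ (m `^ h)); last first.
    by apply: (@le_trans _ _ (N%:R `^ h)); [exact: le_powR2r|rewrite lerDl].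
  apply: (@le_trans _ _ (m `^ (th - 1) * m `^ 2^-1)).
    by rewrite ler_wpM2l// powR_ge0.
  rewrite -powRD; last by rewrite (gt_eqF mp) implybT.
  by apply: ler_powR => //; lra.
apply: (@le_trans _ _ (binE N (fun k => k%:R `^ th + 1) v)).
  apply: binE_le => // k _; apply: le_trans (ler_normB _ _) _.
  rewrite !ger0_norm ?powR_ge0// lerD2l -(powR_1x th); apply: le_powR2r => //; exact: ltW.
rewrite binED binE_cst.
have : m `^ th <= 1 by rewrite -(powR_1x th); apply: le_powR2r => //; exact: ltW.
have := powR_ge0 (N%:R : R) h; lra.
Qed.

(** Concavity of z^ka at the point 1 / ((N + 1) v), which bounds the expectation of
z = 1 / (k + 1) by [binE_inv]. *)
Lemma binE_invpow_le ka N v : 0 <= ka -> ka <= 1 -> 0 < v -> v <= 1 ->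
  v * binE N (fun k => k.+1%:R `^ (- ka)) v <= v `^ (1 - ka) * N.+1%:R `^ (- ka).
Proof.
move=> k0 k1 v0 v1; have v01 : 0 <= v <= 1 by rewrite ltW.
pose a := (N.+1%:R * v)^-1; have a0 : 0 < a by rewrite invr_gt0 mulr_gt0.
have hinv : binE N (fun k => k.+1%:R^-1) v <= a.
  by rewrite /a -[leRHS]div1r ler_pdivlMr ?mulr_gt0// mulrC binE_inv.
have -> : v `^ (1 - ka) * N.+1%:R `^ (- ka) = v * a `^ ka.
  rewrite /a powRV ?mulr_ge0 ?(ltW v0)// powRM ?(ltW v0)//.
  rewrite powRD; last by rewrite (gt_eqF v0) implybT.
  by rewrite powRr1 ?(ltW v0)//; ring.
rewrite ler_wpM2l ?(ltW v0)//.
apply: (@le_trans _ _ (binE N (fun k => (a `^ ka - ka * a `^ (ka - 1) * a) +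
    (ka * a `^ (ka - 1)) * k.+1%:R^-1) v)).
  apply: binE_le => // k _; rewrite -powRV//.
  have kp : 0 <= (k.+1%:R)^-1 :> R by rewrite invr_ge0.
  have := powR_le_tangent k0 k1 a0 kp.
  by set z := _^-1; set w := z `^ ka; lra.
rewrite binED binE_cst (binEZ _ _ (fun k => k.+1%:R^-1)).
have := ler_wpM2l (mulr_ge0 k0 (powR_ge0 a (ka - 1))) hinv; lra.
Qed.

End binomial_powers.

Section split_recursion.
Variables (R : realType) (I : (R -> R) -> R) (beta : R).
Hypothesis rk : renewal_kernel I beta.
Hypothesis beta1 : beta <= 1.
Let mfI := rk_mf rk.
Let beta0 := rk_beta0 rk.
Let Ibeta := rk_beta rk.
Variables (s c s1 : nat).
Hypothesis s_ge1 : (1 <= s)%N.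
Hypothesis cs : (c <= s.+1)%N.
Hypothesis s1c : (s1 <= c)%N.
Hypothesis s1c0 : s1 = c -> c = 0%N.

(** The expectation of sum_i om(V_i) F(B_i + s1), with B_i binomial with parameters n - c
and V_i. For om = 1 and c = s0 + b s1 it is the expected sum of F over the numbers of
balls of the children of a node with n balls; the weight om = id governs the effect of
one additional ball. *)
Definition act (om : R -> R) (n : nat) (F : nat -> R) : R :=
  I (fun v => om v * binE (n - c) (fun k => F (k + s1)%N) v).

Definition weight (om : R -> R) := adm om /\ forall v, 0 <= v <= 1 -> 0 <= om v <= 1.

Lemma weight1 : weight (fun=> 1).
Proof. by split; [exact: adm_cst|move=> v _; rewrite ler01 lexx]. Qed.

Lemma weight_id : weight id.
Proof. by split; [exact: adm_id|]. Qed.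

Lemma adm_act om n F : weight om ->
  adm (fun v => om v * binE (n - c) (fun k => F (k + s1)%N) v).
Proof. by move=> [ao _]; apply: admM => //; exact: adm_binE. Qed.

Lemma act_le om n F G : weight om ->
  (forall m, (m <= n - c + s1)%N -> F m <= G m) -> act om n F <= act om n G.
Proof.
move=> wo FG; apply: (mf_le mfI); [exact: adm_act|exact: adm_act|].
move=> v v01; have /andP[om0 _] := wo.2 v v01; rewrite ler_wpM2l//.
by apply: binE_le => // k kN; apply: FG; rewrite leq_add2r.
Qed.

Lemma actD om n F G : weight om ->
  act om n (fun m => F m + G m) = act om n F + act om n G.
Proof.
move=> wo; rewrite /act -(mfD mfI); [|exact: adm_act|exact: adm_act].
by congr I; apply/funext => v; rewrite binED mulrDr.
Qed.

Lemma actZ om n (r : R) F : weight om -> act om n (fun m => r * F m) = r * act om n F.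
Proof.
move=> wo; rewrite /act -(mfZ mfI); last exact: adm_act.
by congr I; apply/funext => v; rewrite binEZ mulrCA.
Qed.

Lemma actB om n F G : weight om ->
  act om n (fun m => F m - G m) = act om n F - act om n G.
Proof.
move=> wo; rewrite (_ : (fun m => _) = (fun m => F m + -1 * G m)).
  by rewrite actD// actZ// mulN1r.
by apply/funext => v; rewrite mulN1r.
Qed.

Lemma act_norm om n F : weight om -> `|act om n F| <= act om n (fun m => `|F m|).
Proof.
move=> wo; apply: le_trans (mf_norm mfI (adm_act n F wo)) _.
apply: (mf_le mfI).
- exact: adm_norm (adm_act n F wo).
- exact: (adm_act n (fun m => `|F m|) wo).
move=> v v01; have /andP[om0 _] := wo.2 v v01.
by rewrite normrM (ger0_norm om0) ler_wpM2l// binE_norm.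
Qed.

(** Children have at most as many balls as their parent, and the event that
one of them inherits all balls has expected number less than 1, so that the
maximum principle can be applied by induction on the number of balls. *)
Lemma act_comparison om (w : nat -> R) n0 n : weight om -> (s < n0)%N ->
  (forall m, (m < n0)%N -> w m <= 0) ->
  (forall m, (n0 <= m <= n)%N -> w m <= act om m w) -> w n <= 0.
Proof.
move=> wo sn0 wlt; elim/ltn_ind: n => n IH wact.
have [nn0|n0n] := ltnP n n0; first exact: wlt.
have IH' m : (m < n)%N -> w m <= 0.
  move=> mn; apply: IH => // k /andP[k1 k2]; apply: wact.
  by rewrite k1 (leq_trans k2)// ltnW.
have sn : (s < n)%N by exact: leq_trans n0n.
have cn : (c <= n)%N by exact: leq_trans sn.
have ho := wact n; rewrite n0n leqnn in ho; have {}ho := ho isT.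
apply/idP; rewrite leNgt; apply/negP => wn.
have [E|nE] := eqVneq s1 c; last first.
  have : act om n w <= 0.
    apply: le_trans (act_le wo (G := fun=> 0) _) _.
      move=> m hm; apply: IH'; apply: leq_ltn_trans hm _.
      have : (s1 < c)%N by rewrite ltn_neqAle nE.
      lia.
    by rewrite -[leRHS](mul0r (act om n (fun=> 0))) -actZ//; apply: act_le => // m _; rewrite mul0r.
  by move=> /(le_trans ho); rewrite leNgt wn.
have c0 := s1c0 E; have s10 : s1 = 0%N by rewrite E.
have n2 : (2 <= n)%N by lia.
have n0' : beta < n%:R by apply: le_lt_trans beta1 _; rewrite ltr1n.
have an : adm (fun v : R => v `^ n%:R) by exact: adm_pow.
have : act om n w <= w n * I (fun v => v `^ n%:R).
  rewrite -(mfZ mfI)//; apply: (mf_le mfI); [exact: adm_act|exact: admZ|].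
  move=> v v01; have /andP[v0 v1] := v01; have /andP[om0 om1] := wo.2 v v01.
  rewrite c0 s10 subn0 powR_mulrn//.
  have h : binE n (fun k => w (k + 0)%N) v <= v ^+ n * w n.
    have := @binE_le_top R n (fun k => w (k + 0)%N) v v01; rewrite addn0; apply.
    by move=> k kn; rewrite addn0; exact: IH'.
  apply: le_trans (ler_wpM2l om0 h) _; rewrite [leRHS]mulrC ler_piMl//.
  by rewrite mulr_ge0 ?exprn_ge0// ltW.
move=> /(le_trans ho); apply/negP; rewrite -ltNge gtr_pMr//.
exact: (mf_pow_lt1 rk).
Qed.

Lemma act_pow_le th n : 0 < th -> th <= 1 -> (s < n)%N ->
  act (fun=> 1) n (fun m => m%:R `^ th) <=
  n%:R `^ th * I (fun v => v `^ th) + s1%:R `^ th * I (fun=> 1).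
Proof.
move=> th0 th1 sn; have ap : adm (fun v : R => v `^ th) by apply: adm_pow; exact: ltW.
rewrite -(mfZ mfI)// -(mf_cst mfI) -(mfD mfI); [|exact: admZ|exact: adm_cst].
apply: (mf_le mfI); first exact: (adm_act n (fun m => m%:R `^ th) weight1).
  by apply: admD; [exact: admZ|exact: adm_cst].
move=> v v01; have /andP[v0 v1] := v01; rewrite mul1r.
apply: (@le_trans _ _ (binE (n - c) (fun k => k%:R `^ th + s1%:R `^ th) v)).
  by apply: binE_le => // k _; rewrite natrD powR_subadd.
rewrite binED binE_cst lerD2r; apply: le_trans (binE_pow_le _ th0 th1 v01) _.
rewrite powRM// ler_wpM2r ?powR_ge0//; apply: le_powR2r => //; first exact: ltW.
by rewrite ler_nat leq_subr.
Qed.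

(** The expectation of k^th is close to (N v)^th by [binE_pow_dist]: concavity gives only
the opposite inequality [act_pow_le]. *)
Lemma act_pow_ge th n : 0 < th -> th <= 1 -> (s < n)%N ->
  (n%:R `^ th - c%:R `^ th) * I (fun v => v `^ th) -
    (n%:R `^ (th / 2) + 2) * I (fun=> 1)
  <= act (fun=> 1) n (fun m => m%:R `^ th).
Proof.
move=> th0 th1 sn; have ap : adm (fun v : R => v `^ th) by apply: adm_pow; exact: ltW.
have cn : (c <= n)%N by exact: leq_trans sn.
rewrite -(mfZ mfI)// -(mf_cst mfI) -(mfB mfI); [|exact: admZ|exact: adm_cst].
apply: (mf_le mfI); [|exact: (adm_act n (fun m => m%:R `^ th) weight1)|].
  by apply: admB; [exact: admZ|exact: adm_cst].
move=> v v01; have /andP[v0 v1] := v01; rewrite mul1r.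
have h2 : 0 <= th / 2 by lra.
have hd := @binE_pow_dist R th (th / 2) (n - c) v th0 th1 v01 h2 ltac:(lra).
apply: (@le_trans _ _ (binE (n - c) (fun k => ((n - c)%:R * v) `^ th -
   `|k%:R `^ th - ((n - c)%:R * v) `^ th|) v)); last first.
  apply: binE_le => // k _; apply: (@le_trans _ _ (k%:R `^ th)).
    by rewrite lerBlDr -lerBlDl distrC ler_norm.
  by apply: le_powR2r; rewrite ?(ltW th0)// ler_nat leq_addr.
rewrite binEB binE_cst; apply: lerB.
  rewrite powRM// ler_wpM2r ?powR_ge0// lerBlDr.
  rewrite -[in leLHS](subnK cn) natrD; exact: powR_subadd.
apply: (le_trans hd); rewrite lerD2r; apply: le_powR2r => //.
by rewrite ler_nat leq_subr.
Qed.

Definition supersol (B g : R) (n : nat) : R := (B + 1) * n%:R `^ beta - B * n%:R `^ g.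

Lemma pow_le_nat (g h : R) n : 0 < g -> g <= h -> n%:R `^ g <= n%:R `^ h :> R.
Proof.
move=> g0 gh; case: n => [|n]; first by rewrite !powR0// gt_eqF// (lt_le_trans g0).
by apply: ler_powR => //; rewrite ler1n.
Qed.

Lemma supersol_bounds B g n : 0 <= B -> 0 < g -> g <= beta ->
  n%:R `^ beta <= supersol B g n <= (B + 1) * n%:R `^ beta.
Proof.
move=> B0 g0 gb; have h := pow_le_nat n g0 gb.
have := ler_wpM2l B0 h; have := mulr_ge0 B0 (powR_ge0 (n%:R : R) g).
by rewrite /supersol => *; apply/andP; split; lra.
Qed.

Lemma nat_pow_large (g C : R) : 0 < g -> exists n0, forall n, (n0 <= n)%N -> C <= n%:R `^ g :> R.
Proof.
move=> g0; have [T [T0 hT]] := powR_unbounded C g0.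
exists (Num.truncn T).+1 => n hn; apply: hT; apply: (@le_trans _ _ ((Num.truncn T).+1)%:R).
  by apply/ltW/truncnS_gt.
by rewrite ler_nat.
Qed.

(** Since E sum V_i^g > 1 for g < beta, subtracting a lower power turns the
critical power n^beta into a strict supersolution that absorbs tolls of order n^g. *)
Lemma supersol_exists g : 0 < g -> g < beta -> exists B n0, [/\ 0 <= B, (s < n0)%N &
  forall n, (n0 <= n)%N ->
    act (fun=> 1) n (supersol B g) + n%:R `^ g <= supersol B g n].
Proof.
move=> g0 gb.
have g1 : g <= 1 by rewrite (le_trans (ltW gb)).
pose m := I (fun v => v `^ g); have m1 : 1 < m by apply: (mf_pow_gt1 rk) => //; exact: ltW.
have i10 := mf1_ge0 mfI; set i1 := I (fun=> 1) in i10.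
have m10 : 0 < m - 1 by rewrite subr_gt0.
have [B [B0 Bm]] : exists B, 0 <= B /\ B * m = B + 2.
  exists (2 / (m - 1)); split; first by rewrite divr_ge0// ltW.
  by field; rewrite gt_eqF.
pose C1 := (B + 1) * (s1%:R `^ beta * i1) + B * (c%:R `^ g * m) + 2 * B * i1.
pose C2 := B * i1.
have C10 : 0 <= C1.
  have m0 : 0 <= m by rewrite ltW// (lt_trans ltr01).
  by rewrite /C1 !addr_ge0// !mulr_ge0 ?powR_ge0// addr_ge0.
have C20 : 0 <= C2 by rewrite mulr_ge0.
have [n1 hn1] := nat_pow_large (C1 + C2 + 1) (divr_gt0 g0 (ltr0n R 2)).
exists B, (maxn n1 s.+1); split => //; first by rewrite leq_max leqnn orbT.
move=> n; rewrite geq_max => /andP[/hn1 hn sn].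
rewrite actB ?actZ; [|exact: weight1|exact: weight1|exact: weight1].
have := act_pow_le beta0 beta1 sn; rewrite Ibeta -/i1 mulr1.
have := act_pow_ge g0 g1 sn; rewrite -/i1 -/m.
have -> : n%:R `^ g = n%:R `^ (g / 2) * n%:R `^ (g / 2) :> R.
  rewrite -powRD; first by congr (_ `^ _); field.
  by rewrite -splitr gt_eqF.
set x := n%:R `^ (g / 2) in hn *; set a1 := act _ _ _; set a2 := act _ _ _.
set nb := n%:R `^ beta; set sb := s1%:R `^ beta; set cg := c%:R `^ g => h1 h2.
have B1 : 0 <= B + 1 by rewrite addr_ge0.
have := ler_wpM2l B1 h2; have := ler_wpM2l B0 h1; rewrite /supersol.
rewrite -/nb.
have -> : n%:R `^ g = x * x.
  rewrite -powRD; first by congr (_ `^ _); field.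
  by rewrite -splitr gt_eqF.
have e1 : B * ((x * x - cg) * m - (x + 2) * i1) = (B * m) * (x * x) - B * (cg * m) - C2 * x - 2 * B * i1.
  by rewrite /C2; ring.
rewrite e1 Bm.
have x1 : 1 <= x by lra.
have : (C1 + C2) * x <= x * x by rewrite ler_wpM2r//; lra.
have : C1 <= C1 * x by rewrite ler_peMr.
rewrite /C1 -/sb -/cg; lra.
Qed.

End split_recursion.

(** * Growth and regularity of the solutions *)

Section split_solutions.
Variables (R : realType) (I : (R -> R) -> R) (beta : R).
Hypothesis rk : renewal_kernel I beta.
Hypothesis beta1 : beta <= 1.
Let mfI := rk_mf rk.
Let beta0 := rk_beta0 rk.
Let Ibeta := rk_beta rk.
Variables (s c s1 : nat).
Hypothesis s_ge1 : (1 <= s)%N.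
Hypothesis cs : (c <= s.+1)%N.
Hypothesis s1c : (s1 <= c)%N.
Hypothesis s1c0 : s1 = c -> c = 0%N.
Local Notation actI := (act I c s1).
Local Notation act1 := (actI (fun=> 1)).
Let w1 := weight1 R.

(** The recursion for the expectations x of an additive functional with expected tolls phi. *)
Definition split_solution (phi x : nat -> R) := x 0%N = 0 /\
  forall n, (1 <= n)%N -> x n = phi n + (if (n <= s)%N then 0 else act1 n x).

Lemma split_solutionN phi x : split_solution phi x ->
  split_solution (fun n => - phi n) (fun n => - x n).
Proof.
move=> [x0 xE]; split; first by rewrite x0 oppr0.
move=> n n1; rewrite xE// opprD; congr (_ + _); case: ifP => _; first by rewrite oppr0.
rewrite -mulN1r -(actZ rk)//; congr (act1 n); by apply/funext => m; rewrite mulN1r.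
Qed.

(** Both x and - x lie below Q times the supersolution of [supersol_exists], which
dominates the toll. *)
Lemma solution_bound g : 0 < g -> g < beta -> exists D n0, [/\ 0 < D, (s < n0)%N &
  forall phi x Q n1, split_solution phi x -> (n0 <= n1)%N -> 0 <= Q ->
    (forall m, (m < n1)%N -> `|x m| <= Q * m%:R `^ beta) ->
    (forall n, (n1 <= n)%N -> `|phi n| <= Q * n%:R `^ g) ->
    forall n, `|x n| <= D * Q * n%:R `^ beta].
Proof.
move=> g0 gb; have [B [n0 [B0 sn0 HB]]] := @supersol_exists R I beta rk beta1 s c s1 cs g g0 gb.
exists (B + 1), n0; split => //; first by rewrite ltr_wpDl.
have half phi x Q n1 : split_solution phi x -> (n0 <= n1)%N -> 0 <= Q ->
    (forall m, (m < n1)%N -> `|x m| <= Q * m%:R `^ beta) ->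
    (forall n, (n1 <= n)%N -> `|phi n| <= Q * n%:R `^ g) ->
    forall n, x n <= (B + 1) * Q * n%:R `^ beta.
  move=> [x0 xE] n01 Q0 hx hphi n.
  have sb m := supersol_bounds m B0 g0 (ltW gb).
  apply: (@le_trans _ _ (Q * supersol beta B g n)); last first.
    by have /andP[_ h] := sb n; have := ler_wpM2l Q0 h; lra.
  rewrite -subr_le0.
  apply: (@act_comparison _ _ _ rk beta1 _ _ _ s_ge1 cs s1c s1c0 (fun=> 1)
    (fun m => x m - Q * supersol beta B g m) n1) => //.
  - exact: leq_trans n01.
  - move=> m mn1; rewrite subr_le0; apply: le_trans (ler_norm _) _.
    by apply: (le_trans (hx m mn1)); rewrite ler_wpM2l//; case/andP: (sb m).
  - move=> m /andP[n1m _]; have sm : (s < m)%N by rewrite (leq_trans sn0)// (leq_trans n01).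
    rewrite (actB rk)// (actZ rk)// xE; last exact: leq_ltn_trans sm.
    rewrite leqNgt sm /=.
    have := HB m (leq_trans n01 n1m); have := ler_norm (phi m); have := hphi m n1m.
    move=> h1 h2 /(ler_wpM2l Q0) h3; lra.
move=> phi x Q n1 sol n01 Q0 hx hphi n; rewrite ler_norml; apply/andP; split; last first.
  exact: half hx hphi n.
rewrite lerNl; apply: (half _ _ Q n1 (split_solutionN sol)) => // m hm.
  by rewrite normrN; exact: hx.
by rewrite normrN; exact: hphi.
Qed.

Lemma solution_zero phi x M : split_solution phi x ->
  (forall m, (m < M)%N -> phi m = 0) -> forall m, (m < M)%N -> x m = 0.
Proof.
move=> sol hphi; have [x0 xE] := sol.
have small m : (m < M)%N -> (m <= s)%N -> x m = 0.
  move=> mM ms; have [->|m0] := posnP m; first exact: x0.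
  by rewrite xE// hphi// add0r ms.
have half (e : R) m : (m < M)%N -> e * x m <= 0.
  move=> mM; have [ms|sm] := leqP m s; first by rewrite small// mulr0.
  apply: (@act_comparison _ _ _ rk beta1 _ _ _ s_ge1 cs s1c s1c0 (fun=> 1)
    (fun k => e * x k) s.+1) => // k => [ks|/andP[sk km]].
    by rewrite small ?mulr0// (leq_ltn_trans _ mM)// (leq_trans _ (ltnW sm)).
  rewrite (actZ rk)// xE; last exact: leq_ltn_trans sk.
  by rewrite hphi ?(leq_ltn_trans km)// add0r leqNgt sk.
move=> m mM; apply/eqP; rewrite eq_le; apply/andP; split.
  by rewrite -[leLHS]mul1r; exact: half.
by rewrite -oppr_le0 -mulN1r; exact: half.
Qed.

Let ka : R := 3 / 4 * (1 - beta).

(** One more ball goes to a child of relative size v with probability v, so the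
increments satisfy the recursion with the extra weight v. For this weighted recursion
(n + 1)^(- ka) is a supersolution: for beta < 1 because 1 - ka > beta and hence
I(v^(1 - ka)) < 1, and for beta = 1 because it is constant. *)
Lemma solution_increment phi x M : split_solution phi x ->
  (forall m, (M <= m)%N -> phi m = 0) -> exists C, 0 <= C /\
  forall n, `|x n.+1 - x n| <= C * n.+1%:R `^ (- ka).
Proof.
move=> sol hphi; have [x0 xE] := sol.
have ka0 : 0 <= ka by rewrite /ka mulr_ge0// ?divr_ge0// subr_ge0.
have b0 : 0 < beta := beta0.
have ka1 : ka < 1 by rewrite /ka; lra.
pose r := I (fun v => v `^ (1 - ka)).
have ap : adm (fun v : R => v `^ (1 - ka)) by apply: adm_pow; lra.
have r0 : 0 <= r by apply: (mf_ge0 mfI) => // v _; exact: powR_ge0.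
(* the supersolution inequality for large n *)
have [n2 Hn2] : exists n2, forall n, (n2 <= n)%N -> (s < n)%N ->
    r * (n - c).+1%:R `^ (- ka) <= n.+1%:R `^ (- ka).
  have [b1|bn1] := eqVneq beta 1.
    exists 0%N => n _ _; have kE : ka = 0 by rewrite /ka b1; lra.
    have rE : r = 1 by rewrite /r kE subr0; move: Ibeta; rewrite b1.
    by rewrite kE oppr0 !powRr0 rE mulr1.
  have blt : beta < 1 by rewrite lt_neqAle bn1.
  have r1 : r < 1 by apply: (mf_pow_lt1 rk); rewrite /ka; lra.
  exists (c + (Num.truncn (c%:R * r / (1 - r))).+1)%N => n hn sn.
  have cn : (c <= n)%N by exact: leq_trans sn.
  have a0 : 0 < (n - c).+1%:R :> R by [].
  have e : n.+1%:R = (n - c).+1%:R + c%:R :> R by rewrite -natrD addSn subnK.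
  have n0 : 0 < n.+1%:R :> R by [].
  set a := (n - c).+1%:R in a0 e *; set b := n.+1%:R in n0 e *.
  rewrite !powRN ler_pdivrMr ?powR_gt0// mulrC ler_pdivlMr ?powR_gt0//.
  have ba : 1 <= b / a by rewrite ler_pdivlMr// mul1r e lerDl.
  have h : b `^ ka <= (b / a) * a `^ ka.
    have -> : b `^ ka = (b / a) `^ ka * a `^ ka.
      by rewrite -powRM ?divr_ge0 ?(ltW a0) ?(ltW n0)// divfK// gt_eqF.
    rewrite ler_wpM2r ?powR_ge0//; apply: ler1_powR => //; exact: ltW.
  apply: le_trans (ler_wpM2l r0 h) _.
  rewrite mulrA ler_piMl ?powR_ge0// mulrA ler_pdivrMr// mul1r e mulrDr.
  have : c%:R * r <= a * (1 - r).
    rewrite -ler_pdivrMr ?subr_gt0//; apply: (@le_trans _ _ (Num.truncn (c%:R * r / (1 - r))).+1%:R).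
      exact/ltW/truncnS_gt.
    by rewrite ler_nat leqW// leq_subRL.
  lra.
pose n1 := maxn (maxn n2 M) s.+1.
pose D n := `|x n.+1 - x n|.
pose C := \sum_(k < n1) D k * k.+1%:R `^ ka.
have Cterm k : 0 <= D k * k.+1%:R `^ ka by rewrite mulr_ge0 ?powR_ge0 /D.
have C0 : 0 <= C by apply: sumr_ge0.
exists C; split => // n; rewrite -subr_le0.
have wid := weight_id R.
apply: (@act_comparison _ _ _ rk beta1 _ _ _ s_ge1 cs s1c s1c0 id
    (fun m => D m - C * m.+1%:R `^ (- ka)) n1) => //.
- by rewrite /n1 leq_max leqnn orbT.
- move=> m mn1; rewrite subr_le0 powRN ler_pdivlMr ?powR_gt0//.
  rewrite /C (bigD1 (Ordinal mn1))//= lerDl; exact: sumr_ge0.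
- move=> m /andP[n1m _].
  move: n1m; rewrite /n1 !geq_max => /andP[/andP[n2m Mm] sm].
  have cm : (c <= m)%N by exact: leq_trans sm.
  rewrite (actB rk)// (@actZ _ _ _ rk c s1 id m C (fun m => m.+1%:R `^ (- ka)) wid).
  apply: lerB.
    rewrite /D !xE ?(leq_ltn_trans _ sm)// !hphi ?(leqW Mm)// !add0r.
    have e1 : (m <= s)%N = false by rewrite leqNgt sm.
    have e2 : (m < s)%N = false by apply/negbTE; rewrite -leqNgt ltnW.
    rewrite e1 e2.
    have -> : act1 m.+1 x - act1 m x = actI id m (fun k => x k.+1 - x k).
      rewrite /act -(mfB mfI); first last.
      - exact: (adm_act c s1 m x w1).
      - exact: (adm_act c s1 m.+1 x w1).
      congr I; apply/funext => v; rewrite !mul1r subSn//= binEB.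
      by under [X in v * X + _]eq_binE => k _ do rewrite addSn; ring.
    exact: (act_norm rk).
  apply: (@le_trans _ _ (C * (r * (m - c).+1%:R `^ (- ka)))).
    rewrite ler_wpM2l// /act /r mulrC -(mfZ mfI)//.
    apply: (mf_le mfI); [exact: (adm_act c s1 m (fun k => k.+1%:R `^ (- ka)) wid)|exact: admZ|].
    move=> v v01; have /andP[v0 v1] := v01; rewrite [leRHS]mulrC.
    have [->|vn0] := eqVneq v 0; first by rewrite mul0r mulr_ge0 ?powR_ge0.
    have vp : 0 < v by rewrite lt_neqAle eq_sym vn0.
    apply: le_trans (binE_invpow_le (m - c) ka0 (ltW ka1) vp v1).
    rewrite ler_wpM2l//; apply: binE_le => // k _; apply: powR_anti => //.
      by rewrite oppr_le0.
    by rewrite ler_nat ltnS leq_addr.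
  by rewrite ler_wpM2l// Hn2.
Qed.

Let theta : R := (1 + 3 * beta) / 4.

(** Summing the increments: n^(theta - 1) is up to a constant the increment of n^theta, and
theta = 1 - ka. *)
Lemma solution_dist phi x M : split_solution phi x ->
  (forall m, (M <= m)%N -> phi m = 0) -> exists C, 0 <= C /\
  (forall m n, `|x n - x m| <= C * `|n%:R `^ theta - m%:R `^ theta|) /\
  (forall m n, `|x n - x m| <= C * `|n%:R - m%:R|).
Proof.
move=> sol hphi; have [C [C0 hC]] := solution_increment sol hphi.
have b0 : 0 < beta := beta0.
have th0 : 0 < theta by rewrite /theta; lra.
have b1 : beta <= 1 := beta1.
have th1 : theta <= 1 by rewrite /theta; lra.
have kE : - ka = theta - 1 by rewrite /ka /theta; field.
have ka0 : 0 <= ka by rewrite /ka mulr_ge0// ?divr_ge0// subr_ge0.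
have inc k : k.+1%:R `^ (- ka) <= theta^-1 * (k.+1%:R `^ theta - k%:R `^ theta) :> R.
  rewrite ler_pdivlMl//.
  have := powR_le_tangent (ltW th0) th1 (ltr0Sn R k) (ler0n R k).
  have -> : k%:R - k.+1%:R = -1 :> R by rewrite -[k.+1%:R]natr1; ring.
  rewrite kE; lra.
have le1 k : k.+1%:R `^ (- ka) <= 1 :> R.
  rewrite -[leRHS](powRr0 (k.+1%:R : R)); apply: ler_powR; rewrite ?ler1n//.
  by rewrite oppr_le0.
have thV1 : 1 <= theta^-1 by rewrite invf_ge1.
have CV : C <= C / theta by rewrite ler_peMr.
have H m n : (m <= n)%N ->
    `|x n - x m| <= C / theta * (n%:R `^ theta - m%:R `^ theta) /\
    `|x n - x m| <= C / theta * (n%:R - m%:R).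
  elim: n => [|n IH]; first by rewrite leqn0 => /eqP ->; rewrite !subrr normr0 !mulr0.
  rewrite leq_eqVlt => /orP[/eqP ->|]; first by rewrite !subrr normr0 !mulr0.
  rewrite ltnS => /IH [h1 h2].
  have tri : `|x n.+1 - x m| <= `|x n.+1 - x n| + `|x n - x m|.
    by rewrite -[x n.+1 - x m](subrKA (x n)) ler_normD.
  split; apply: (le_trans tri).
    have := hC n; have := ler_wpM2l C0 (inc n); rewrite mulrA; lra.
  have := hC n; have := ler_wpM2l C0 (le1 n); rewrite -[n.+1%:R]natr1; lra.
exists (C / theta); split; first by rewrite divr_ge0// ltW.
have C'0 : 0 <= C / theta by rewrite divr_ge0// ltW.
split => m n.
  have [/H [h _]|/ltnW /H [h _]] := leqP m n.
    by apply: (le_trans h); rewrite ler_wpM2l// ler_norm.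
  rewrite distrC; apply: (le_trans h); rewrite distrC ler_wpM2l// ler_norm//.
have [/H [_ h]|/ltnW /H [_ h]] := leqP m n.
  by apply: (le_trans h); rewrite ler_wpM2l// ler_norm.
by rewrite distrC; apply: (le_trans h); rewrite distrC ler_wpM2l// ler_norm.
Qed.

End split_solutions.

(** * From the recursion to the renewal equation *)

Section step_extension.
Variable R : realType.

Definition extend (x : nat -> R) (t : R) : R := x (Num.truncn t).

Lemma measurable_extend x : measurable_fun setT (extend x).
Proof.
have mge n : measurable [set t : R | (n <= Num.truncn t)%N].
  case: n => [|n]; first by rewrite (_ : mkset _ = setT)//; apply/seteqP; split.
  rewrite (_ : mkset _ = [set` `[n.+1%:R : R, +oo[]); first exact: measurable_itv.
  by apply/seteqP; split => t /=; rewrite in_itv /= andbT truncn_gt_nat.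
move=> _ B mB; rewrite setTI.
rewrite (_ : _ @^-1` _ = \bigcup_(n in [set n | B (x n)])
   ([set t : R | (n <= Num.truncn t)%N] `\` [set t : R | (n.+1 <= Num.truncn t)%N])).
  by apply: bigcup_measurable => n _; apply: measurableD.
apply/seteqP; split => t /=.
  move=> Bt; exists (Num.truncn t) => //=; split => //; by rewrite ltnn.
by move=> [n /= Bn [h1 /negP]]; rewrite -leqNgt => h2;
  rewrite /extend (_ : Num.truncn t = n)//; apply/eqP; rewrite eqn_leq h2.
Qed.

Lemma truncn_bounds (t : R) : 0 <= t ->
  (Num.truncn t)%:R <= t /\ t < (Num.truncn t)%:R + 1.
Proof. by move=> /truncn_itv /andP[h1 h2]; rewrite natr1. Qed.

End step_extension.

Section solution_asymptotics.
Variables (R : realType) (I : (R -> R) -> R) (beta : R).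
Hypothesis rk : renewal_kernel I beta.
Hypothesis beta1 : beta <= 1.
Let mfI := rk_mf rk.
Let beta0 := rk_beta0 rk.
Variables (s c s1 : nat).
Hypothesis s_ge1 : (1 <= s)%N.
Hypothesis cs : (c <= s.+1)%N.
Hypothesis s1c : (s1 <= c)%N.
Hypothesis s1c0 : s1 = c -> c = 0%N.
Local Notation actI := (act I c s1).
Local Notation act1 := (actI (fun=> 1)).
Local Notation split_solution := (split_solution I s c s1).
Let w1 := weight1 R.
Let theta : R := (1 + 3 * beta) / 4.

Lemma solution_finite_bound phi x M : split_solution phi x ->
  (forall m, (M <= m)%N -> phi m = 0) ->
  exists G, 0 <= G /\ forall n, `|x n| <= G * n%:R `^ beta.
Proof.
move=> sol hphi; have [x0 _] := sol; have b0 : 0 < beta := beta0.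
have g0 : 0 < beta / 2 by rewrite divr_gt0.
have gb : beta / 2 < beta by lra.
have [D [n0 [D0 sn0 HD]]] := solution_bound rk beta1 s_ge1 cs s1c s1c0 g0 gb.
pose n1 := maxn n0 M; pose Q := \sum_(m < n1) `|x m|.
have Q0 : 0 <= Q by exact: sumr_ge0.
exists (D * Q); split; first by rewrite mulr_ge0// ltW.
apply: (HD phi x Q n1) => //; first by rewrite leq_maxl.
  move=> m mn; case: m mn => [|m] mn; first by rewrite x0 normr0 powR0 ?gt_eqF// mulr0.
  apply: (@le_trans _ _ Q).
    by rewrite /Q (bigD1 (Ordinal mn))//= lerDl; exact: sumr_ge0.
  rewrite ler_peMr// -[leLHS](powRr0 (m.+1%:R : R)); apply: ler_powR; last exact: ltW.
  by rewrite ler1n.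
move=> n; rewrite geq_max => /andP[_ Mn]; rewrite hphi// normr0.
by rewrite mulr_ge0// powR_ge0.
Qed.

(** Replacing the binomial number of balls of a child by its mean costs a
power of n less than n^beta, since the solution is Lipschitz in n^theta with
theta - 1/2 < beta. *)
Lemma solution_approx_renewal phi x M : split_solution phi x ->
  (forall m, (M <= m)%N -> phi m = 0) ->
  exists G K C t0, approx_renewal I beta (beta / 4) (extend x) G K C t0.
Proof.
move=> sol hphi; have [x0 xE] := sol; have b0 : 0 < beta := beta0.
have b1 : beta <= 1 := beta1.
have [G [G0 hG]] := solution_finite_bound sol hphi.
have [C [C0 [hC hC']]] := solution_dist rk beta1 s_ge1 cs s1c s1c0 sol hphi.
have th0 : 0 < theta by rewrite /theta; lra.
have th1 : theta <= 1 by rewrite /theta; lra.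
have i10 := mf1_ge0 mfI; set i1 := I (fun=> 1) in i10.
pose E := s1%:R `^ theta + 3 + (c%:R + 1) `^ theta : R.
have E0 : 0 <= E by rewrite /E !addr_ge0// powR_ge0.
pose N0 := (maxn M s).+1.
exists G, (C * (E + 1) * i1), C, (N0%:R); split => //.
- exact: measurable_extend.
- by rewrite !mulr_ge0// addr_ge0.
- move=> t t_ge0; have [h1 h2] := truncn_bounds t_ge0.
  apply: le_trans (hG _) _; rewrite ler_wpM2l//; apply: le_powR2r => //; exact: ltW.
- move=> t Nt; have t_ge0 : 0 <= t by exact: le_trans Nt.
  have t_ge1 : 1 <= t by apply: le_trans Nt; rewrite ler1n.
  have nN : (N0 <= Num.truncn t)%N by rewrite truncn_ge_nat.
  have [h1 h2] := truncn_bounds t_ge0; set n := Num.truncn t in nN h1 h2 *.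
  move: nN; rewrite gtn_max => /andP[Mn sn].
  have cn : (c <= n)%N by exact: leq_trans sn.
  have -> : extend x t = act1 n x.
    rewrite /extend -/n xE ?(leq_ltn_trans _ sn)// hphi ?(ltnW Mn)// add0r.
    by rewrite leqNgt sn.
  have aex : adm (fun v => extend x (t * v)).
    apply: ladm_scale => //; split; first exact: measurable_extend.
    move=> T; exists (G * T `^ beta) => u /andP[u0 uT].
    have [h3 _] := truncn_bounds u0.
    apply: le_trans (hG _) _; rewrite ler_wpM2l//; apply: le_powR2r => //; first exact: ltW.
    exact: le_trans uT.
  have aac := adm_act c s1 n x w1.
  have bt : beta - beta / 4 = 3 * beta / 4 by field.
  rewrite /act -(mfB mfI)//; apply: le_trans (mf_norm mfI (admB aac aex)) _.
  have -> : C * (E + 1) * i1 * t `^ (beta - beta / 4) =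
      I (fun=> C * (E + 1) * t `^ (beta - beta / 4)) by rewrite (mf_cst mfI) mulrAC.
  apply: (mf_le mfI); [by apply: adm_norm; exact: admB|exact: adm_cst|].
  move=> v v01; have /andP[v0 v1] := v01; rewrite mul1r.
  set N := (n - c)%N; set k0 := Num.truncn (t * v).
  have tv0 : 0 <= t * v by rewrite mulr_ge0.
  have [h3 h4] := truncn_bounds tv0; rewrite -/k0 in h3 h4.
  rewrite /extend -/k0 -[x k0](binE_cst N _ v) -binEB.
  apply: le_trans (binE_norm _ _ v01) _.
  have hh0 : 0 <= 3 * beta / 4 by lra.
  have hh1 : theta - 2^-1 <= 3 * beta / 4 by rewrite /theta; lra.
  have hd := @binE_pow_dist R theta (3 * beta / 4) N v th0 th1 v01 hh0 hh1.
  have Nt' : N%:R <= t by apply: le_trans h1; rewrite ler_nat leq_subr.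
  have hN : N%:R `^ (3 * beta / 4) <= t `^ (3 * beta / 4) by exact: le_powR2r.
  have tE : N%:R + c%:R = n%:R :> R by rewrite -natrD subnK.
  have hNt : `|(N%:R * v) `^ theta - (t * v) `^ theta| <= (c%:R + 1) `^ theta.
    have Nv0 : 0 <= N%:R * v by rewrite mulr_ge0.
    apply: le_trans (powR_le_distD th0 th1 Nv0 tv0) _.
    apply: le_powR2r => //; first exact: ltW.
    rewrite -mulrBl normrM (ger0_norm v0).
    have : `|N%:R - t| <= c%:R + 1 by rewrite ler0_norm ?subr_le0//; lra.
    have c0 : 0 <= c%:R + 1 :> R by rewrite addr_ge0.
    by move=> h; rewrite -[leRHS]mulr1; apply: ler_pM.
  have hk0 : `|(t * v) `^ theta - k0%:R `^ theta| <= 1.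
    apply: le_trans (powR_le_distD th0 th1 tv0 (ler0n _ _)) _.
    rewrite -[leRHS](powR_1x theta); apply: le_powR2r => //; first exact: ltW.
    rewrite ger0_norm ?subr_ge0//; lra.
  apply: (@le_trans _ _ (binE N (fun k => C * (`|k%:R `^ theta - (N%:R * v) `^ theta| +
      (s1%:R `^ theta + (c%:R + 1) `^ theta + 1))) v)).
    apply: binE_le => // k _; apply: le_trans (hC _ _) _; rewrite ler_wpM2l//.
    have h5 : `|(k + s1)%:R `^ theta - k%:R `^ theta| <= s1%:R `^ theta.
      apply: le_trans (powR_le_distD th0 th1 (ler0n _ _) (ler0n _ _)) _.
      by rewrite natrD addrAC subrr add0r ger0_norm.
    have -> : (k + s1)%:R `^ theta - k0%:R `^ theta =
       ((k + s1)%:R `^ theta - k%:R `^ theta) + (k%:R `^ theta - (N%:R * v) `^ theta) +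
       ((N%:R * v) `^ theta - (t * v) `^ theta) + ((t * v) `^ theta - k0%:R `^ theta) by ring.
    apply: le_trans (ler_normD _ _) _; apply: le_trans (lerD (ler_normD _ _) (lexx _)) _.
    apply: le_trans (lerD (lerD (ler_normD _ _) (lexx _)) (lexx _)) _; lra.
  rewrite binEZ binED binE_cst -mulrA ler_wpM2l// bt mulrDl mul1r.
  have T1 : 1 <= t `^ (3 * beta / 4).
    by rewrite -[leLHS](powRr0 t); apply: ler_powR.
  have := ler_peMr E0 T1; rewrite {1}/E; lra.
- move=> u t u0 t_ge0; apply: le_trans (hC' _ _) _; rewrite ler_wpM2l//.
  have [h1 h2] := truncn_bounds u0; have [h3 h4] := truncn_bounds t_ge0.
  set a := _%:R; set b := _%:R in h3 h4 *.
  have : `|u - t| = `|u - t| by [].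
  rewrite ler_norml; have := ler_norm (u - t); have := ler_norm (t - u).
  rewrite (distrC t u) => *; apply/andP; split; lra.
Qed.

End solution_asymptotics.

(** * The periodic limit *)

Section limit_function.
Variable R : realType.

(** The limit of g along the progression e^(z + k d), k -> oo, which lies in one orbit of L;
the convergence is uniform in z, so that uniform continuity passes to the limit. *)
Lemma periodic_limit (g : R -> R) (G d : R) (L : R -> Prop) : 0 < d ->
  (forall t, 0 < t -> `|g t| <= G) -> (forall k : nat, L (expR (d * k%:R))) ->
  (forall e, 0 < e -> exists T, 0 < T /\
    forall r a, T <= r -> L a -> 1 <= a -> `|g r - g (r * a)| <= e) ->
  (forall e, 0 < e -> exists z T, [/\ 0 < z, 0 < T & forall r t, T <= r -> T <= t ->
    `|r - t| <= z * t -> `|g r - g t| <= e]) ->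
  exists varpi : R -> R, [/\ forall z, `|varpi z| <= G, continuous varpi,
    forall z, varpi (z + d) = varpi z,
    forall e, 0 < e -> exists T, 0 < T /\ forall t, T <= t -> `|g t - varpi (ln t)| <= e &
    (forall a, 0 < a -> L a) -> exists w, forall z, varpi z = w].
Proof.
move=> d0 gG Ld gL gC.
pose u z (k : nat) := g (expR (z + d * k%:R)).
have large (T : R) : exists k : nat, T <= d * k%:R.
  exists (Num.truncn (T / d)).+1; rewrite mulrC -ler_pdivrMr//; exact/ltW/truncnS_gt.
have largeE z T : exists k0, forall k, (k0 <= k)%N -> T <= expR (z + d * k%:R).
  have [k0 h] := large (T - z); exists k0 => k k0k.
  apply: le_trans (expR_ge1Dx _).
  have : d * k0%:R <= d * k%:R by rewrite ler_pM2l// ler_nat.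
  lra.
have expM (z z' : R) : z <= z' -> exists a, [/\ 0 < a, 1 <= a & expR z' = expR z * a].
  move=> zz; exists (expR (z' - z)); split; first exact: expR_gt0.
    by rewrite -expR0 ler_expR subr_ge0.
  by rewrite -expRD subrKC.
have uL e : 0 < e -> exists T, 0 < T /\ forall z k k', T <= expR (z + d * k%:R) -> (k <= k')%N ->
    `|u z k - u z k'| <= e.
  move=> e0; have [T [T0 H]] := gL e e0; exists T; split => // z k k' Tk kk'.
  have E : expR (z + d * k'%:R) = expR (z + d * k%:R) * expR (d * (k' - k)%:R).
    by rewrite -expRD natrB//; congr expR; ring.
  rewrite /u E; apply: H => //.
  by rewrite -expR0 ler_expR mulr_ge0 ?(ltW d0).
have ucvg z : cvgn (u z).
  apply/cauchy_cvgP/cauchy_exP => e e0.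
  have [T [T0 H]] := uL (e / 2) (divr_gt0 e0 (ltr0n _ 2)).
  have [k0 hk] := largeE z T; exists (u z k0); exists k0 => // k k0k /=.
  rewrite /ball /=; apply: le_lt_trans (H z k0 k (hk _ (leqnn _)) k0k) _.
  lra.
pose varpi z := limn (u z).
have near_lim e : 0 < e -> exists T, 0 < T /\ forall z k, T <= expR (z + d * k%:R) ->
    `|u z k - varpi z| <= e.
  move=> e0; have [T [T0 H]] := uL e e0; exists T; split => // z k Tk.
  apply/ler_addgt0Pr => e' e'0.
  have /cvgrPdist_le /(_ e' e'0) [k1 _ hk1] := ucvg z.
  have h1 := hk1 (maxn k k1) (leq_maxr _ _).
  have h2 := H z k (maxn k k1) Tk (leq_maxl _ _).
  rewrite -[u z k - varpi z](subrKA (u z (maxn k k1))).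
  apply: le_trans (ler_normD _ _) _; rewrite lerD// distrC; exact: h1.
exists varpi; split.
- move=> z; apply/ler_addgt0Pr => e e0; have [T [T0 H]] := near_lim e e0.
  have [k hk] := largeE z T; have h := H z k (hk k (leqnn _)).
  have h2 := gG _ (expR_gt0 (z + d * k%:R)).
  rewrite -[varpi z](subrK (u z k)) addrC; apply: le_trans (ler_normD _ _) _.
  by rewrite lerD// distrC.
- move=> z; apply/cvgrPdist_le => e e0.
  have e30 : 0 < e / 3 by rewrite divr_gt0.
  have [T1 [T10 H1]] := near_lim _ e30; have [h [T2 [h0 T20 H2]]] := gC _ e30.
  have [k hk] := largeE (z - 1) (Num.max T1 T2); have {hk} := hk k (leqnn _).
  rewrite ge_max => /andP[hk1 hk2].
  have cexp : (fun z' : R => expR (z' - z)) @ z --> (1 : R).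
    have -> : 1 = expR (z - z) :> R by rewrite subrr expR0.
    apply: (@cvg_comp _ _ _ (fun z' : R => z' - z) expR _ (nbhs (z - z))).
      by apply: cvgB; [exact: cvg_id|exact: cvg_cst].
    exact: continuous_expR.
  have near1 : \forall z' \near z, `|1 - expR (z' - z)| <= h.
    by move/cvgrPdist_le: cexp => /(_ h h0).
  have near2 : \forall z' \near z, z - 1 <= z'.
    near=> z'; have : ball z 1 z' by near: z'; exact: nbhsx_ballx.
    by rewrite /ball /= ltr_norml => /andP[]; lra.
  near=> z'.
  have n1 : `|1 - expR (z' - z)| <= h by near: z'.
  have n2 : z - 1 <= z' by near: z'.
  have m1 w : z - 1 <= w -> T1 <= expR (w + d * k%:R) /\ T2 <= expR (w + d * k%:R).
    move=> zw; have hw : expR (z - 1 + d * k%:R) <= expR (w + d * k%:R).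
      by rewrite ler_expR lerD2r.
    by split; [exact: le_trans hw|exact: le_trans hw].
  have [a1 a2] := m1 z' n2; have [|c1 c2] := m1 z; first by lra.
  have b1 := H1 z' k a1; have b2 := H1 z k c1.
  have b3 : `|u z' k - u z k| <= e / 3.
    apply: H2 => //.
    have -> : expR (z' + d * k%:R) - expR (z + d * k%:R) =
       expR (z + d * k%:R) * (expR (z' - z) - 1).
      by rewrite mulrBr mulr1 -expRD; congr (expR _ - _); ring.
    rewrite normrM (gtr0_norm (expR_gt0 _)) mulrC distrC.
    by rewrite ler_wpM2r// ltW// expR_gt0.
  move: b1 b2 b3; rewrite !ler_norml => /andP[? ?] /andP[? ?] /andP[? ?].
  by apply/andP; split; lra.
- move=> z; apply/eqP; rewrite -subr_eq0 -normr_le0; apply/ler_addgt0Pr => e e0.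
  rewrite add0r; have [T [T0 H]] := near_lim (e / 2) (divr_gt0 e0 (ltr0n _ 2)).
  have [k hk] := largeE z T.
  have E : u z k.+1 = u (z + d) k by rewrite /u -natr1; congr (g (expR _)); ring.
  have h1 := H z k.+1 (hk _ (leqnSn _)).
  have h2 : `|u (z + d) k - varpi (z + d)| <= e / 2.
    apply: H; have := hk _ (leqnSn k); rewrite -natr1 mulrDr mulr1.
    by rewrite (_ : z + (d * k%:R + d) = z + d + d * k%:R)//; ring.
  move: h1 h2; rewrite E !ler_norml => /andP[? ?] /andP[? ?].
  by apply/andP; split; lra.
- move=> e e0; have [T [T0 H]] := near_lim e e0; exists T; split => // t Tt.
  have t0 : 0 < t by exact: lt_le_trans Tt.
  have := H (ln t) 0%N; rewrite /u mulr0 addr0 lnK ?posrE//; exact.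
- move=> Lall; exists (varpi 0) => z0.
  suff W z z' : z <= z' -> varpi z = varpi z'.
    by have [/W|/ltW /W ->] := leP z0 0.
  move=> zz; apply/eqP; rewrite -subr_eq0 -normr_le0; apply/ler_addgt0Pr => e e0.
  have e30 : 0 < e / 3 by rewrite divr_gt0.
  have [T1 [T10 H1]] := near_lim _ e30; have [T2 [T20 H2]] := gL _ e30.
  have [k hk] := largeE z (Num.max T1 T2); have {hk} := hk k (leqnn _).
  rewrite ge_max => /andP[hk1 hk2].
  have zzk : z + d * k%:R <= z' + d * k%:R by rewrite lerD2r.
  have [a [a0 a1 E]] := expM _ _ zzk.
  have b1 := H1 z k hk1.
  have b2 : `|u z' k - varpi z'| <= e / 3.
    by apply: H1; apply: (le_trans hk1); rewrite ler_expR.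
  have b3 : `|u z k - u z' k| <= e / 3 by rewrite /u E; apply: H2 => //; exact: Lall.
  move: b1 b2 b3; rewrite add0r !ler_norml => /andP[? ?] /andP[? ?] /andP[? ?].
  by apply/andP; split; lra.
Unshelve. all: by end_near.
Qed.

End limit_function.

Section truncation.
Variables (R : realType) (I : (R -> R) -> R) (beta : R).
Hypothesis rk : renewal_kernel I beta.
Hypothesis beta1 : beta <= 1.
Let beta0 := rk_beta0 rk.
Variables (s c s1 : nat).
Hypothesis s_ge1 : (1 <= s)%N.
Hypothesis cs : (c <= s.+1)%N.
Hypothesis s1c : (s1 <= c)%N.
Hypothesis s1c0 : s1 = c -> c = 0%N.
Local Notation split_solution := (split_solution I s c s1).

(** L will be the set of all positive numbers or the group of the powers of e^d: by
[wo_mono] the walk does not leave L once the factor 0 is discarded, and by [wo_unif]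
normalized solutions become constant along L. *)
Record walk_orbits (L : R -> Prop) : Prop := WalkOrbits {
  wo_meas : measurable [set a | L a] ;
  wo_pos : forall a, L a -> 0 < a ;
  wo_1 : L 1 ;
  wo_mul : forall a b, L a -> L b -> L (a * b) ;
  wo_mono : forall F H, adm F -> adm H -> F 0 <= H 0 ->
    (forall v, 0 < v <= 1 -> L v -> F v <= H v) -> I F <= I H ;
  wo_unif : forall y G K C t0, approx_renewal I beta (beta / 4) y G K C t0 ->
    uniform_period_set beta y L }.

Lemma split_solutionB phi psi x y : split_solution phi x -> split_solution psi y ->
  split_solution (fun n => phi n - psi n) (fun n => x n - y n).
Proof.
move=> [x0 xE] [y0 yE]; split; first by rewrite x0 y0 subr0.
move=> n n1; rewrite xE// yE//; case: ifP => _; first by rewrite !addr0.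
by rewrite (actB rk) ?opprD; [ring|exact: weight1].
Qed.

Variables (phi : nat -> R) (Cphi delta : R) (nphi : nat).
Hypothesis delta0 : 0 < delta.
Hypothesis Cphi0 : 0 <= Cphi.
Hypothesis phi_le : forall n, (nphi <= n)%N -> `|phi n| <= Cphi * n%:R `^ (beta - delta).
Variable x : nat -> R.
Hypothesis sol : split_solution phi x.
Hypothesis sol_trunc : forall M, exists x',
  split_solution (fun n => phi n * (n < M)%N%:R) x'.

(** Tolls at sizes n >= M are at most M^(- d1) n^(beta - d1), hence contribute at most a small
multiple of n^beta. This reduces the asymptotics to tolls of finite support. *)
Lemma truncation_approx e : 0 < e -> exists M x',
  split_solution (fun n => phi n * (n < M)%N%:R) x' /\
  forall n, `|x n - x' n| <= e * n%:R `^ beta.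
Proof.
move=> e0; have b0 : 0 < beta := beta0.
pose d1 := Num.min delta beta / 2.
have d10 : 0 < d1 by rewrite divr_gt0// lt_min delta0.
have [d1d d1b] : 2 * d1 <= delta /\ 2 * d1 <= beta.
  by rewrite /d1 mulrC divfK// !ge_min !lexx orbT.
have gb : beta - d1 < beta by lra.
have g0 : 0 < beta - d1 by lra.
have [D [n0 [D0 sn0 HD]]] := solution_bound rk beta1 s_ge1 cs s1c s1c0 g0 gb.
have [M0 hM0] := nat_pow_large (D * Cphi / e) d10.
pose M := maxn (maxn M0 n0) (maxn nphi 1).
have M0M : (M0 <= M)%N by rewrite /M !leq_max leqnn.
have n0M : (n0 <= M)%N by rewrite /M !leq_max leqnn orbT.
have nM : (nphi <= M)%N by rewrite /M !leq_max leqnn !orbT.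
have M1 : (1 <= M)%N by rewrite /M !leq_max leqnn !orbT.
have [x' sol'] := sol_trunc M; exists M, x'; split => // n.
have solD := split_solutionB sol sol'.
have Mp : 0 < M%:R :> R by rewrite ltr0n.
pose Q := Cphi * M%:R `^ (- d1).
have Q0 : 0 <= Q by rewrite mulr_ge0// powR_ge0.
have hz : forall m, (m < M)%N -> x m - x' m = 0.
  apply: (solution_zero rk beta1 s_ge1 cs s1c s1c0 solD) => m mM.
  by rewrite mM mulr1 subrr.
have hQ : D * Q <= e.
  rewrite /Q powRN mulrA ler_pdivrMr ?powR_gt0// [leRHS]mulrC -ler_pdivrMr//.
  exact: hM0.
apply: (@le_trans _ _ (D * Q * n%:R `^ beta)); last by rewrite ler_wpM2r ?powR_ge0.
apply: (HD _ _ Q M solD) => // m mM.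
  by rewrite hz// normr0 mulr_ge0 ?powR_ge0.
rewrite ltnNge mM mulr0 subr0; apply: le_trans (phi_le (leq_trans nM mM)) _.
rewrite /Q -mulrA ler_wpM2l//.
have mp : 0 < m%:R :> R by apply: lt_le_trans Mp _; rewrite ler_nat.
apply: (@le_trans _ _ (m%:R `^ (- d1) * m%:R `^ (beta - d1))).
  rewrite -powRD; last by rewrite (gt_eqF mp) implybT.
  by apply: ler_powR; [rewrite ler1n (leq_trans M1)|lra].
rewrite ler_wpM2r ?powR_ge0//; apply: powR_anti => //; first by rewrite oppr_le0 ltW.
by rewrite ler_nat.
Qed.

Local Notation g := (normalized beta (extend x)).

(** All three properties hold for the truncated tolls, whose solutions are approximate
renewal solutions, and they are stable under uniform approximation of g. *)
Lemma solution_regular (L : R -> Prop) : walk_orbits L ->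
  [/\ exists G, forall t, 0 < t -> `|g t| <= G,
  forall e, 0 < e -> exists T, 0 < T /\
    forall r a, T <= r -> L a -> 1 <= a -> `|g r - g (r * a)| <= e &
  forall e, 0 < e -> exists z T, [/\ 0 < z, 0 < T & forall r t, T <= r -> T <= t ->
    `|r - t| <= z * t -> `|g r - g t| <= e]].
Proof.
move=> wo; have b0 : 0 < beta := beta0.
have approx e : 0 < e -> exists x' G K C t0,
    approx_renewal I beta (beta / 4) (extend x') G K C t0 /\
    forall t, 0 < t -> `|g t - normalized beta (extend x') t| <= e.
  move=> e0; have [M [x' [sol' hx']]] := truncation_approx e0.
  have [|G [K [C [t0 ar]]]] := solution_approx_renewal rk beta1 s_ge1 cs s1c s1c0 (M := M) sol'.
    by move=> m Mm; rewrite ltnNge Mm mulr0.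
  exists x', G, K, C, t0; split => // t t_gt0.
  rewrite /normalized -mulrBl normrM normfV (ger0_norm (powR_ge0 _ _)).
  rewrite ler_pdivrMr ?powR_gt0//; apply: le_trans (hx' _) _.
  rewrite ler_wpM2l ?(ltW e0)//; apply: le_powR2r => //; first exact: ltW.
  by case: (truncn_bounds (ltW t_gt0)).
have r0 : 0 < beta / 4 by lra.
have rb : beta / 4 < beta by lra.
split.
- have [x' [G [K [C [t0 [ar H]]]]]] := approx 1 ltr01.
  exists (1 + G) => t t_gt0.
  rewrite -[g t](subrK (normalized beta (extend x') t)).
  apply: le_trans (ler_normD _ _) _; apply: lerD; first exact: H.
  exact: (normalized_le ar).
- move=> e e0; have e30 : 0 < e / 3 by rewrite divr_gt0.
  have [x' [G [K [C [t0 [ar H]]]]]] := approx _ e30.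
  have [T [T0 HT]] := renewal_cauchy rk r0 rb ar (wo_meas wo) (wo_pos wo) (wo_1 wo)
    (wo_mul wo) (wo_mono wo) (wo_unif wo ar) e30.
  exists T; split => // r a Tr La a1.
  have rp : 0 < r by exact: lt_le_trans Tr.
  have := HT r a Tr La a1; have := H r rp.
  have := H (r * a) (mulr_gt0 rp (lt_le_trans ltr01 a1)).
  rewrite !ler_norml => /andP[? ?] /andP[? ?] /andP[? ?]; apply/andP; split; lra.
- move=> e e0; have e30 : 0 < e / 3 by rewrite divr_gt0.
  have [x' [G [K [C [t0 [ar H]]]]]] := approx _ e30.
  have [z [T [z0 z1 T0 HT]]] := ap_near rk beta1 r0 rb ar e30.
  exists z, T; split => // r t Tr Tt rt.
  have rp : 0 < r by exact: lt_le_trans Tr.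
  have tp : 0 < t by exact: lt_le_trans Tt.
  have := HT r t Tr Tt rt; have := H r rp; have := H t tp.
  rewrite !ler_norml => /andP[? ?] /andP[? ?] /andP[? ?]; apply/andP; split; lra.
Qed.

End truncation.

(** * Positivity of the limit *)

Section positivity.
Variables (R : realType) (I : (R -> R) -> R) (beta : R).
Hypothesis rk : renewal_kernel I beta.
Hypothesis beta1 : beta <= 1.
Let mfI := rk_mf rk.
Let beta0 := rk_beta0 rk.
Let Ibeta := rk_beta rk.
Variables (s c s1 : nat).
Hypothesis s_ge1 : (1 <= s)%N.
Hypothesis cs : (c <= s.+1)%N.
Hypothesis s1c : (s1 <= c)%N.
Hypothesis s1c0 : s1 = c -> c = 0%N.
Local Notation actI := (act I c s1).
Local Notation act1 := (actI (fun=> 1)).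
Local Notation split_solution := (split_solution I s c s1).
Let w1 := weight1 R.

Lemma mf_bernoulli_gt0 j k : 0 < I (fun v => v ^+ j * (1 - v) ^+ k).
Proof.
have [p [q [p0 pq q1 Ipq]]] := rk_nondeg rk.
have q0 : 0 < q by exact: lt_le_trans pq.
have ai := adm_ind `[p, q].
have aX (F : R -> R) m : adm F -> adm (fun v => F v ^+ m).
  move=> aF; elim: m => [|m IH]; first exact: adm_cst.
  rewrite (_ : (fun v => _) = (fun v => F v * F v ^+ m)); first exact: admM.
  by apply/funext => v; rewrite exprS.
have a1 : adm (fun v : R => v ^+ j * (1 - v) ^+ k).
  apply: admM; first by apply: (aX id); exact: adm_id.
  by apply: (aX (fun v => 1 - v)); apply: admB; [exact: adm_cst|exact: adm_id].
apply: (@lt_le_trans _ _ (I (fun v => (p ^+ j * (1 - q) ^+ k) * itv_ind `[p, q] v))).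
  by rewrite (mfZ mfI)// !mulr_gt0// exprn_gt0// subr_gt0.
apply: (mf_le mfI) => //; first exact: admZ.
move=> v /andP[v0 v1]; rewrite /itv_ind in_itv /=; case: andP => [[pv vq]|_].
  rewrite mulr1; apply: ler_pM; rewrite ?exprn_ge0 ?(ltW p0) ?subr_ge0 ?(ltW q1)//.
    by apply: lerXn2r; rewrite ?nnegrE ?(ltW p0).
  by apply: lerXn2r; rewrite ?nnegrE ?subr_ge0 ?(ltW q1)// lerD2l lerN2.
by rewrite mulr0 mulr_ge0// exprn_ge0// subr_ge0.
Qed.

Lemma solution_ge0 phi x : split_solution phi x ->
  (forall n, (1 <= n)%N -> 0 <= phi n) -> forall n, 0 <= x n.
Proof.
move=> [x0 xE] phi0 n.
have : -1 * x n <= 0; last by rewrite mulN1r oppr_le0.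
apply: (@act_comparison _ _ _ rk beta1 _ _ _ s_ge1 cs s1c s1c0 (fun=> 1)
    (fun k => -1 * x k) s.+1) => // m.
  case: m => [|m] ms; first by rewrite x0 mulr0.
  by rewrite mulN1r oppr_le0 xE// -ltnS ms addr0 phi0.
move=> /andP[sm _]; rewrite (actZ rk)// !mulN1r lerN2 xE; last exact: leq_ltn_trans sm.
rewrite [(m <= s)%N]leqNgt sm lerDr phi0//; exact: leq_ltn_trans sm.
Qed.

(** A node with many balls has, in one step and with positive probability, a
child with a prescribed number m >= s1 of balls; from there on a subsolution of
order n^beta can be fitted below the solution. *)
Lemma solution_lower_bound phi x m : split_solution phi x ->
  (forall n, (1 <= n)%N -> 0 <= phi n) -> (1 <= m)%N -> (s1 <= m)%N -> 0 < phi m ->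
  exists e n1, 0 < e /\ forall n, (n1 <= n)%N -> e * n%:R `^ beta <= x n.
Proof.
move=> sol phi0 m1 s1m phim; have [x0 xE] := sol; have b0 : 0 < beta := beta0.
have x_ge0 := solution_ge0 sol phi0.
have xm : 0 < x m.
  rewrite xE//; case: ifP => _; first by rewrite addr0.
  apply: ltr_wpDr => //; rewrite -(mul0r (act1 m x)) -(actZ rk)//.
  by apply: (act_le rk) => // k _; rewrite mul0r.
pose m2 := (maxn s m + c).+1.
have x_gt0 n : (m2 <= n)%N -> 0 < x n.
  move=> m2n; have sn : (s < n)%N by rewrite /m2 in m2n; lia.
  have mnc : (m - s1 <= n - c)%N by rewrite /m2 in m2n; lia.
  rewrite xE; last exact: leq_ltn_trans sn.
  rewrite [(n <= s)%N]leqNgt sn; apply: ltr_wpDl; first by apply: phi0; exact: leq_ltn_trans sn.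
  apply: (@lt_le_trans _ _ (x m * I (fun v => v ^+ (m - s1) * (1 - v) ^+ (n - c - (m - s1))))).
    by rewrite mulr_gt0// mf_bernoulli_gt0.
  have aB : adm (fun v : R => v ^+ (m - s1) * (1 - v) ^+ (n - c - (m - s1))).
    split.
      apply: measurable_funM; apply: measurable_funX => //.
      exact: measurable_funB.
    exists 1 => v /andP[v0 v1]; rewrite normrM !normrX (ger0_norm v0) ger0_norm ?subr_ge0//.
    apply: mulr_ile1; rewrite ?exprn_ge0 ?subr_ge0// exprn_ile1 ?subr_ge0//.
    by rewrite lerBlDr lerDl.
  rewrite -(mfZ mfI)// /act.
  apply: (mf_le mfI); [exact: admZ|exact: (adm_act c s1 n x w1)|].
  move=> v v01; rewrite mul1r mulrC.
  have := @binE_ge_atom R (n - c) (fun k => x (k + s1)%N) v (m - s1) v01 (fun k => x_ge0 _) mnc.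
  by rewrite subnK.
pose g := 3 / 4 * beta; have g0 : 0 < g by rewrite /g; lra.
have gb : g < beta by rewrite /g; lra.
have g1 : g <= 1 by rewrite (le_trans (ltW gb)).
pose mm := I (fun v => v `^ g); have mm1 : 1 < mm by apply: (mf_pow_gt1 rk) => //; exact: ltW.
have i10 := mf1_ge0 mfI; set i1 := I (fun=> 1) in i10.
pose full k : R := k%:R `^ beta + k%:R `^ g.
pose psi k : R := if (k < m2)%N then 0 else full k.
have full_ge0 k : 0 <= full k by rewrite addr_ge0// powR_ge0.
have full_mono k l : (k <= l)%N -> full k <= full l.
  by move=> kl; apply: lerD; apply: le_powR2r; rewrite ?ler_nat// ltW.
have psi_ge k : full k - full m2 <= psi k.
  rewrite /psi; case: ltnP => km; first by rewrite subr_le0 full_mono// ltnW.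
  by rewrite gerBl full_ge0.
pose C1 := c%:R `^ beta + 4 * i1 + mm * c%:R `^ g + full m2 * i1.
have C10 : 0 <= C1.
  by rewrite /C1 !addr_ge0// ?mulr_ge0// ?powR_ge0// ltW// (lt_trans ltr01).
have eta0 : 0 < mm - 1 by rewrite subr_gt0.
have b4 : 0 < beta / 4 by lra.
have [n2 hn2] := nat_pow_large ((C1 + 2 * i1) / (mm - 1)) b4.
pose n1 := maxn (maxn n2 m2) s.+1.
have psi_sub n : (n1 <= n)%N -> psi n <= act1 n psi.
  rewrite /n1 !geq_max => /andP[/andP[/hn2 h2 m2n] sn].
  have n_ge1 : 1 <= n%:R :> R by rewrite ler1n; exact: leq_ltn_trans sn.
  apply: (@le_trans _ _ (act1 n (fun k => full k - full m2))); last first.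
    by apply: (act_le rk) => // k _; exact: psi_ge.
  rewrite (actB rk)// (@actD _ _ _ rk c s1 (fun=> 1) n (fun k => k%:R `^ beta) (fun k => k%:R `^ g) w1).
  have -> : act1 n (fun=> full m2) = full m2 * i1.
    rewrite -(mf_cst mfI) /act; congr I; apply/funext => v.
    by rewrite mul1r binE_cst.
  have hb := @act_pow_ge _ _ _ rk s c s1 cs beta n b0 beta1 sn.
  have hg := @act_pow_ge _ _ _ rk s c s1 cs g n g0 g1 sn.
  rewrite Ibeta mulr1 -/i1 in hb; rewrite -/i1 -/mm in hg.
  rewrite {1}/psi ltnNge m2n /= /full.
  have e1 : n%:R `^ g = n%:R `^ (beta / 2) * n%:R `^ (beta / 4) :> R.
    rewrite -powRD; first by congr (_ `^ _); rewrite /g; field.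
    by rewrite (gt_eqF (lt_le_trans ltr01 n_ge1)) implybT.
  have e2 : n%:R `^ (g / 2) <= n%:R `^ (beta / 2) :> R by apply: ler_powR => //; rewrite /g; lra.
  have e3 : 1 <= n%:R `^ (beta / 2) :> R.
    by rewrite -[leLHS](powRr0 (n%:R : R)); apply: ler_powR => //; lra.
  have e4 : (C1 + 2 * i1) <= (mm - 1) * n%:R `^ (beta / 4).
    by rewrite [leRHS]mulrC -ler_pdivrMr.
  set X := n%:R `^ (beta / 2) in e1 e2 e3 hb *; set Z := n%:R `^ (g / 2) in e2 hg *.
  set Y := n%:R `^ (beta / 4) in e1 e4 *.
  have X0 : 0 <= X by rewrite (le_trans ler01).
  have f1 := ler_wpM2r X0 e4; have f2 := ler_wpM2r i10 e2.
  have f3 : C1 <= C1 * X by rewrite ler_peMr.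
  rewrite e1 in hg *; rewrite /C1 /full in f3 f1; move: f1 f2 f3 hb hg.
  set a1 := act1 n _; set a2 := act1 n _; rewrite -/(full m2); lra.
pose S := 1 + \sum_(k < n1) psi k / x k.
have psi_ge0 k : 0 <= psi k by rewrite /psi; case: ifP.
have terms k : 0 <= psi k / x k by rewrite divr_ge0.
have S0 : 0 < S by rewrite ltr_pwDl// sumr_ge0.
exists S^-1, m2; split => [|n m2n]; first by rewrite invr_gt0.
have key k : psi k * S^-1 - x k <= 0.
  have : S^-1 * psi k - x k <= 0; last by rewrite mulrC.
  apply: (@act_comparison _ _ _ rk beta1 _ _ _ s_ge1 cs s1c s1c0 (fun=> 1)
    (fun k => S^-1 * psi k - x k) n1) => // [|l ln1|l /andP[n1l _]].
  - by rewrite /n1 leq_max leqnn orbT.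
  - rewrite subr_le0 mulrC ler_pdivrMr//.
    have [lm2|m2l] := ltnP l m2; first by rewrite /psi lm2 mulr_ge0// ltW.
    rewrite mulrC -ler_pdivrMr ?x_gt0// /S (bigD1 (Ordinal ln1))//= addrCA lerDl.
    by rewrite addr_ge0// sumr_ge0.
  - have sl : (s < l)%N by apply: leq_trans n1l; rewrite /n1 leq_max leqnn orbT.
    rewrite (actB rk)// (actZ rk)//; apply: lerB.
      by rewrite ler_wpM2l ?psi_sub// invr_ge0 ltW.
    rewrite xE; last exact: leq_ltn_trans sl.
    rewrite [(l <= s)%N]leqNgt sl lerDr phi0//; exact: leq_ltn_trans sl.
have := key n; rewrite subr_le0 mulrC; apply: le_trans.
rewrite ler_wpM2l ?invr_ge0 ?(ltW S0)// /psi ltnNge m2n /= lerDl; exact: powR_ge0.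
Qed.

End positivity.

(** * The intensity of the split vector *)

Section bounded_integrals.
Context {d : measure_display} {T : measurableType d} {R : realType}.
Variable P : probability T R.

Lemma bounded_integrable (f : T -> R) (C : R) : measurable_fun setT f ->
  (forall x, `|f x| <= C) -> P.-integrable setT (EFin \o f).
Proof.
move=> mf fC; apply: (@le_integrable _ _ _ P setT measurableT _ (EFin \o cst C)).
- exact/measurable_EFinP.
- move=> x _ /=; rewrite lee_fin; apply: le_trans (fC x) _; exact: ler_norm.
- exact: finite_measure_integrable_cst.
Qed.

Lemma ae_Rintegral (f g : T -> R) : measurable_fun setT f -> measurable_fun setT g ->
  {ae P, forall x, f x = g x} -> (\int[P]_x f x = \int[P]_x g x)%R.
Proof.
move=> mf mg fg; rewrite /Rintegral; congr fine; apply: ae_eq_integral => //.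
- exact/measurable_EFinP.
- exact/measurable_EFinP.
- by apply: filterS fg => x /= -> .
Qed.

End bounded_integrals.

Section split_kernel.
Context {d0 : measure_display} {S : measurableType d0} {R : realType}.
Context {P0 : probability S R} {b : nat}.
Variable V : {RV P0 >-> b.-tuple R}.

(** The coordinates of the split vector, truncated to [0, 1] so that integrals
of functions on [0, 1] need no almost sure provisos. *)
Definition clip (i : 'I_b) (x : S) : R := Num.max 0 (Num.min 1 (tnth (V x) i)).

(** The intensity E sum_i delta_(V_i) of the split vector, as a functional. *)
Definition intensity (F : R -> R) : R := (\sum_(i < b) \int[P0]_x F (clip i x))%R.

Lemma clip01 i x : 0 <= clip i x <= 1.
Proof. by rewrite /clip le_max lexx ge_max ler01 ge_min lexx. Qed.

Lemma measurable_coord i : measurable_fun setT (fun x => tnth (V x) i).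
Proof.
by apply: (measurableT_comp (measurable_tnth i)); exact: measurable_funP.
Qed.

Lemma measurable_clip i : measurable_fun setT (clip i).
Proof.
apply: measurable_maxr; first exact: measurable_cst.
by apply: measurable_minr; [exact: measurable_cst|exact: measurable_coord].
Qed.

Lemma adm_clip F i : adm F -> measurable_fun setT (F \o clip i) /\
  exists C, forall x, `|F (clip i x)| <= C.
Proof.
move=> [mF [C hC]]; split; first by apply: measurableT_comp => //; exact: measurable_clip.
by exists C => x; apply: hC; exact: clip01.
Qed.

Lemma integrable_clip F i : adm F -> P0.-integrable setT (EFin \o (F \o clip i)).
Proof.
by move=> aF; have [mF [C hC]] := adm_clip i aF; exact: (@bounded_integrable _ _ _ _ _ C).
Qed.

Lemma intensity_mean_functional : mean_functional intensity.
Proof.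
split => [F G aF aG|c F aF|F G aF aG FG].
- rewrite /intensity -big_split /=; apply: eq_bigr => i _.
  by rewrite RintegralD//; exact: integrable_clip.
- rewrite /intensity mulr_sumr; apply: eq_bigr => i _.
  by rewrite RintegralZl//; exact: integrable_clip.
- rewrite /intensity; apply: ler_sum => i _; apply: le_Rintegral => //.
  + exact: integrable_clip.
  + exact: integrable_clip.
  + by move=> x _; apply: FG; exact: clip01.
Qed.

Lemma intensity_ae_le F G : adm F -> adm G ->
  (forall i, {ae P0, forall x, F (clip i x) <= G (clip i x)}) ->
  intensity F <= intensity G.
Proof.
move=> aF aG FG; rewrite /intensity; apply: ler_sum => i _.
have [mF [C hC]] := adm_clip i aF; have [mG [D hD]] := adm_clip i aG.
pose H x := Num.min (F (clip i x)) (G (clip i x)).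
have mH : measurable_fun setT H by apply: measurable_minr.
rewrite (@ae_Rintegral _ _ _ P0 (F \o clip i) H) => //; last first.
  by apply: filterS (FG i) => x /= h; rewrite /H min_l.
apply: le_Rintegral => //; last by move=> x _; rewrite /H ge_min lexx orbT.
- apply: (@bounded_integrable _ _ _ _ _ (Num.max C D)) => // x.
  by rewrite /H; case: (leP (F (clip i x)) (G (clip i x))) => _;
    rewrite le_max ?hC ?hD ?orbT.
- exact: integrable_clip.
Qed.

Lemma intensity_ae_eq F G : adm F -> adm G ->
  (forall i, {ae P0, forall x, F (clip i x) = G (clip i x)}) ->
  intensity F = intensity G.
Proof.
move=> aF aG FG; apply/eqP; rewrite eq_le; apply/andP; split;
  by apply: intensity_ae_le => // i; apply: filterS (FG i) => x ->.
Qed.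

Hypothesis hV : split_vector V.

Lemma coord_clip : {ae P0, forall x, forall i, tnth (V x) i = clip i x}.
Proof.
apply: filterS2 (split_vector_ge0 hV) (split_vector_sum hV) => x h0 hs i.
have h1 : tnth (V x) i <= 1.
  apply: le_trans hs; rewrite (bigD1 i)//= lerDl; apply: sumr_ge0 => j _; exact: h0.
by rewrite /clip min_r// max_r.
Qed.

Lemma intensity_sum F : adm F ->
  (\int[P0]_x (\sum_(i < b) F (tnth (V x) i))%:E)%E = (intensity F)%:E.
Proof.
move=> aF; have [mF0 _] := aF.
have aFi := fun i => adm_clip i aF.
transitivity (\int[P0]_x (\sum_(i < b) (F (clip i x))%:E))%E.
  apply: ae_eq_integral => //.
  - apply/measurable_EFinP; apply: measurable_sum => i.
    by apply: measurableT_comp => //; exact: measurable_coord.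
  - apply: emeasurable_sum => i; apply/measurable_EFinP; exact: (aFi i).1.
  - by apply: filterS coord_clip => x h _; rewrite sumEFin; congr EFin; apply: eq_bigr => i _; rewrite h.
rewrite integral_sum//; last by move=> i; exact: integrable_clip.
rewrite /intensity -sumEFin; apply: eq_bigr => i _.
rewrite /Rintegral fineK//; apply: integrable_fin_num => //; exact: integrable_clip.
Qed.

End split_kernel.

Section split_kernel2.
Context {d0 : measure_display} {S : measurableType d0} {R : realType}.
Context {P0 : probability S R} {b : nat}.
Variable V : {RV P0 >-> b.-tuple R}.
Hypothesis hV : split_vector V.
Hypothesis b_gt0 : (0 < b)%N.
Local Notation I := (intensity V).
Let mfI := intensity_mean_functional V.

Lemma order_stat0P x : order_stat V 0 x = 1 <->
  (exists i, tnth (V x) i = 1) /\ forall i, tnth (V x) i <= 1.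
Proof.
rewrite /order_stat; set r := (fun y z : R => z <= y).
have rtot : total r by move=> y z; rewrite /r le_total.
have rtr : transitive r by move=> y z w; rewrite /r => h1 h2; exact: le_trans h2 h1.
have srt := sort_sorted rtot (V x).
have mem y : (y \in sort r (V x)) = (y \in (V x : seq R)) by rewrite mem_sort.
have sz : size (sort r (V x)) = b by rewrite size_sort size_tuple.
case E : (sort r (V x)) srt mem sz => [|h l] /= srt mem sz.
  by exfalso; have := b_gt0; rewrite -{1}sz.
have hmax y : y \in (V x : seq R) -> y <= h.
  rewrite -mem inE => /orP[/eqP -> //|yl].
  by have /allP /(_ y yl) := order_path_min rtr srt.
split=> [hE|[[i hi] hle]].
  split=> [|i]; last by rewrite -hE; apply: hmax; exact: mem_tnth.
  have /tnthP [i hi] : h \in (V x : seq R) by rewrite -mem mem_head.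
  by exists i; rewrite -hi.
apply/eqP; rewrite eq_le; apply/andP; split; last by rewrite -hi; apply: hmax; exact: mem_tnth.
by have /tnthP [j ->] : h \in (V x : seq R); [rewrite -mem mem_head|exact: hle].
Qed.

Lemma measurable_order_stat0 : measurable [set x | order_stat V 0 x = 1].
Proof.
rewrite (_ : [set x | _] = (\bigcup_(i in [set: 'I_b]) [set x | tnth (V x) i = 1]) `&`
   (\bigcap_(i in [set: 'I_b]) [set x | tnth (V x) i <= 1])).
  apply: measurableI.
    apply: fin_bigcup_measurable => [|i _]; first exact: finite_finset.
    by have := measurable_coord V i measurableT (measurable_set1 1); rewrite setTI.
  apply: fin_bigcap_measurable => [|i _]; first exact: finite_finset.
  rewrite (_ : [set x | _] = (fun x => tnth (V x) i) @^-1` `]-oo, 1]).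
    by have := measurable_coord V i measurableT (measurable_itv `]-oo, 1]); rewrite setTI.
  by apply/seteqP; split => x /=; rewrite in_itv.
apply/seteqP; split => x /=.
  by move=> /order_stat0P [[i hi] hle]; split => [|j _]; [exists i|exact: hle].
by move=> [[i _ hi] hle]; apply/order_stat0P; split => [|j]; [exists i|exact: hle].
Qed.

(** Since the coordinates have sum at most 1, at most one of them equals 1; so the expected
number of coordinates equal to 1 is the probability that the largest one is. *)
Lemma intensity_one : I (itv_ind `[1, 1]) < 1.
Proof.
rewrite -lte_fin -(intensity_sum hV); last exact: adm_ind.
apply: le_lt_trans (split_vector_max hV).
rewrite -[X in (_ <= P0 X)%E]setIT -integral_indic//; last exact: measurable_order_stat0.
apply: ae_ge0_le_integral => //.
- by move=> x _; rewrite lee_fin sumr_ge0// => i _; exact: itv_ind_ge0.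
- apply/measurable_EFinP; apply: measurable_sum => i.
  by apply: measurableT_comp; [exact: measurable_itv_ind|exact: measurable_coord].
- by apply/measurable_EFinP; apply: measurable_indic; exact: measurable_order_stat0.
apply: filterS2 (split_vector_ge0 hV) (split_vector_sum hV) => x h0 hs _.
rewrite lee_fin.
have le1 i : tnth (V x) i <= 1.
  apply: le_trans hs; rewrite (bigD1 i)//= lerDl; apply: sumr_ge0 => j _; exact: h0.
have indE i : itv_ind `[1, 1] (tnth (V x) i) = (tnth (V x) i == 1)%:R.
  by rewrite /itv_ind in_itv /= -eq_le eq_sym.
have [[i hi]|ni] := pselect (exists i, tnth (V x) i = 1); last first.
  rewrite big1// => i _; rewrite indE; case: eqP => // hi; by exfalso; apply: ni; exists i.
rewrite indicE mem_set; last by apply/order_stat0P; split => //; exists i.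
rewrite (bigD1 i)//= indE hi eqxx big1 ?addr0// => j ji.
rewrite indE; case: eqP => // hj; exfalso.
move: hs; rewrite (bigD1 i)//= (bigD1 j)//= hi hj.
have : 0 <= \sum_(k < b | (k != i) && (k != j)) tnth (V x) k by apply: sumr_ge0.
lra.
Qed.

Lemma intensity_null J : I (itv_ind J) <= 0 ->
  forall i, {ae P0, forall x, clip V i x \notin J}.
Proof.
move=> IJ i.
have aJ := @adm_ind R J.
have ge0 j : 0 <= (\int[P0]_x itv_ind J (clip V j x))%R.
  by apply: Rintegral_ge0 => x _; exact: itv_ind_ge0.
have z : (\int[P0]_x itv_ind J (clip V i x))%R = 0.
  apply/eqP; rewrite eq_le ge0 andbT; apply: le_trans IJ.
  by rewrite /intensity (bigD1 i)//= lerDl; apply: sumr_ge0 => j _; exact: ge0.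
pose A := clip V i @^-1` [set` J].
have mA : measurable A.
  by have := measurable_clip V i measurableT (measurable_itv J); rewrite setTI.
have PA : P0 A = 0%E.
  have : (\int[P0]_x (\1_A x)%:E)%E = P0 A by rewrite integral_indic// setIT.
  have -> : (fun x => (\1_A x)%:E) = (fun x => (itv_ind J (clip V i x))%:E) :> (S -> \bar R).
    apply/funext => x; rewrite indicE /itv_ind; congr (_%:R)%:E; congr nat_of_bool.
    by apply/idP/idP => [/set_mem|h]; [|exact: mem_set].
  move=> <-; rewrite -[LHS]fineK; first by move: z; rewrite /Rintegral => ->.
  exact: (integrable_fin_num measurableT (integrable_clip V i aJ)).
exists A; split => // x /= h; apply: contrapT => nA; apply: h.
by apply/negP => h; apply: nA.
Qed.

Variable beta : R.
Hypothesis beta0 : 0 < beta.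
Hypothesis hbeta : 'E_P0[(fun x => \sum_(i < b) tnth (V x) i `^ beta)%R]%E = 1%E.

(** If no interval inside ]0, 1[ had mass, the coordinates would be 0 or 1 almost surely, and
v^beta would agree with the indicator of 1, whose intensity is less than 1. *)
Lemma intensity_renewal_kernel : renewal_kernel I beta.
Proof.
have ab : adm (fun v : R => v `^ beta) by apply: adm_pow; exact: ltW.
have Ib : I (fun v => v `^ beta) = 1.
  by apply: EFin_inj; rewrite -(intensity_sum hV ab); move: hbeta; rewrite unlock.
split => //; apply: contrapT => nd.
have null n i : {ae P0, forall x, clip V i x \notin `[n.+2%:R^-1, 1 - n.+2%:R^-1]}.
  apply: intensity_null; rewrite leNgt; apply/negP => h; apply: nd.
  have n0 : 0 < n.+2%:R^-1 :> R by rewrite invr_gt0.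
  have n2 : n.+2%:R^-1 <= 2^-1 :> R by rewrite lef_pV2 ?posrE ?ltr0n// ler_nat.
  move: n0 n2 h; set w := n.+2%:R^-1 => n0 n2 h.
  by exists w, (1 - w); split => //; lra.
have E : I (fun v => v `^ beta) = I (itv_ind `[1, 1]).
  apply: intensity_ae_eq => //; first exact: adm_ind.
  move=> i; have := ae_foralln (fun n => null n i); apply: filterS => x h.
  have /andP[v0 v1] := clip01 V i x; set v := clip V i x in h v0 v1 *.
  rewrite /itv_ind in_itv /= -eq_le eq_sym.
  have [->|vn1] := eqVneq v 1; first by rewrite powR_1x.
  have [->|vn0] := eqVneq v 0; first by rewrite powR0// gt_eqF.
  exfalso; have vp : 0 < v by rewrite lt_neqAle eq_sym vn0.
  have vl : v < 1 by rewrite lt_neqAle vn1.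
  pose m := Num.min v (1 - v).
  have m0 : 0 < m by rewrite lt_min vp subr_gt0.
  pose n := Num.truncn m^-1.
  have hn : n.+2%:R^-1 <= m.
    rewrite invf_ple ?posrE ?ltr0n//; apply: le_trans (ltW (truncnS_gt m^-1)) _.
    by rewrite ler_nat.
  have := h n; rewrite in_itv /=; move/negP; apply; apply/andP; split.
    by apply: le_trans hn _; rewrite /m ge_min lexx.
  by rewrite lerBrDr addrC -lerBrDr; apply: le_trans hn _; rewrite /m ge_min lexx orbT.
by have := intensity_one; rewrite -E Ib ltxx.
Qed.

(** The complement of the support is covered by countably many intervals with rational end
points, each of measure 0. *)
Lemma ae_in_support i :
  {ae P0, forall x, 0 < clip V i x -> in_support I (clip V i x)}.
Proof.
have null n : {ae P0, forall x, forall pq : rat * rat, unpickle n = Some pq ->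
    I (itv_ind `[ratr pq.1, ratr pq.2]) <= 0 ->
    clip V i x \notin `[ratr pq.1, ratr pq.2]}.
  case E : (unpickle n) => [pq|]; last by apply: aeW => x pq.
  have [h|h] := leP (I (itv_ind `[ratr pq.1, ratr pq.2])) 0; last first.
    by apply: aeW => x pq' [<-]; rewrite leNgt h.
  by have := intensity_null h i; apply: filterS => x hx pq' [<-].
have := ae_foralln null; apply: filterS => x H v0 z z0.
set v := clip V i x in H v0 *.
rewrite ltNge; apply/negP => hz.
have [p /= hp] := @rat_in_itvoo R (v - z) v ltac:(lra).
have [q /= hq] := @rat_in_itvoo R v (v + z) ltac:(lra).
rewrite !in_itv /= in hp hq; move: hp hq => /andP[p1 p2] /andP[q1 q2].
have := H (pickle (p, q)) (p, q) (pickleK _).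
rewrite /= in_itv /= (ltW p2) (ltW q1) => h.
have : I (itv_ind `[ratr p, ratr q]) <= 0.
  apply: le_trans hz; apply: (mf_le mfI); [exact: adm_ind|exact: adm_ind|].
  move=> w _; rewrite /itv_ind !in_itv /=; case: andP => [[h1 h2]|_]; last exact: ler0n.
  by rewrite (le_trans (ltW p1) h1) (le_trans h2 (ltW q2)).
by move=> /h.
Qed.

End split_kernel2.

(** * The lattice and the nonlattice case *)

Section orbits.
Context {d0 : measure_display} {S : measurableType d0} {R : realType}.
Context {P0 : probability S R} {b : nat}.
Variable V : {RV P0 >-> b.-tuple R}.
Hypothesis hV : split_vector V.
Hypothesis b_gt0 : (0 < b)%N.
Local Notation I := (intensity V).
Let mfI := intensity_mean_functional V.

Lemma measurable_off_lattice (D : R) :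
  measurable [set y : R | 0 < y /\ ~ exists k : int, ln y = D * k%:~R].
Proof.
rewrite (_ : [set y | _] = [set` `]0, +oo[] `\`
   \bigcup_(n : nat) ((@ln R @^-1` [set D * n%:R]) `|` (@ln R @^-1` [set - (D * n%:R)]))).
  apply: measurableD; first exact: measurable_itv.
  apply: bigcupT_measurable => n; apply: measurableU.
    by have := @measurable_ln R measurableT _ (measurable_set1 (D * n%:R)); rewrite setTI.
  by have := @measurable_ln R measurableT _ (measurable_set1 (- (D * n%:R))); rewrite setTI.
apply/seteqP; split => y /=; rewrite in_itv /= andbT => -[y0 H]; split => //.
  move=> [n _ [h|h]]; apply: H; first by exists (n%:Z).
  by exists (- n%:Z); rewrite h rmorphN mulrN.
move=> [[k|k] hk]; apply: H; first by exists k => //; left.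
by exists k.+1 => //; right; rewrite /= hk NegzE rmorphN mulrN.
Qed.

Lemma lattice_with_ae (D : R) : lattice_with V D <->
  forall i, {ae P0, forall x, 0 < clip V i x -> exists k : int, ln (clip V i x) = D * k%:~R}.
Proof.
rewrite /lattice_with /law_VI; set A := [set y | _].
have mB i : measurable [set x | A (tnth (V x) i)].
  by have := measurable_coord V i measurableT (measurable_off_lattice D); rewrite setTI.
have bE : (0 < (b%:R^-1)%:E :> \bar R)%E by rewrite lte_fin invr_gt0 ltr0n.
split=> [H i|H].
  have PB : P0 [set x | A (tnth (V x) i)] = 0%E.
    have : ((b%:R^-1)%:E * P0 [set x | A (tnth (V x) i)] <= 0)%E.
      by rewrite -H (bigD1 i)//= leeDl// sume_ge0// => j _; rewrite mule_ge0// ltW.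
    rewrite pmule_rle0// => h; apply/eqP; rewrite eq_le h; exact: measure_ge0.
  have nB : {ae P0, forall x, ~ A (tnth (V x) i)}.
    by exists [set x | A (tnth (V x) i)]; split => // x /= /contrapT.
  apply: filterS2 nB (coord_clip hV) => x nA hx; rewrite -hx => v0.
  by apply: contrapT => h; apply: nA.
rewrite big1// => i _; rewrite [X in (_ * X)%E](_ : _ = 0%E) ?mule0//.
apply/negligibleP => //.
have : {ae P0, forall x, ~ A (tnth (V x) i)}.
  apply: filterS2 (H i) (coord_clip hV) => x h hx; rewrite hx => -[v0 nk]; apply: nk; exact: h.
by apply: negligibleS => x /= h h2; exact: h2.
Qed.

Variable beta : R.
Hypothesis beta0 : 0 < beta.
Hypothesis beta1 : beta <= 1.
Hypothesis hbeta : 'E_P0[(fun x => \sum_(i < b) tnth (V x) i `^ beta)%R]%E = 1%E.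
Let rk := intensity_renewal_kernel hV b_gt0 beta0 hbeta.
Let rho0 : 0 < beta / 4. Proof. by rewrite divr_gt0. Qed.
Let rhob : beta / 4 < beta. Proof. by have := beta0; lra. Qed.

Section log_periods.
Variables (y : R -> R) (G K C t0 : R).
Hypothesis ar : approx_renewal I beta (beta / 4) y G K C t0.

Definition log_period (z : R) := asymptotic_period beta y (expR z).

Lemma ae_log_period i :
  {ae P0, forall x, 0 < clip V i x -> log_period (ln (clip V i x))}.
Proof.
apply: filterS (ae_in_support V i) => x h v0.
rewrite /log_period lnK ?posrE//.
have /andP[_ v1] := clip01 V i x.
apply: (support_asymptotic_period rk beta1 rho0 rhob ar v0 v1); exact: h.
Qed.

Lemma log_period0 : log_period 0.
Proof. by rewrite /log_period expR0; exact: ap1. Qed.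

Lemma log_periodB z w : log_period z -> log_period w -> log_period (z - w).
Proof.
by rewrite /log_period expRD expRN => hz hw; exact: (apM hz (apV hw)).
Qed.

Lemma log_period_closed z :
  (forall e, 0 < e -> exists w, log_period w /\ `|w - z| <= e) -> log_period z.
Proof.
move=> H; apply: (ap_closed rk beta1 rho0 rhob ar); first exact: expR_gt0.
move=> u u0; have /cvgrPdist_le /(_ u u0) /nbhs_ballP [e /= e0 he] := @continuous_expR R z.
have [w [hw wz]] := H (e / 2) (divr_gt0 e0 (ltr0n _ 2)).
exists (expR w); split => //; rewrite distrC; apply: he.
rewrite /ball /= distrC; apply: le_lt_trans wz _; lra.
Qed.

End log_periods.

(** The logarithms of the asymptotic periods form a closed subgroup which supports ln V. A
proper closed subgroup is cyclic, which would make V lattice; so every positive number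
is an asymptotic period. *)
Lemma walk_orbits_nonlattice : ~ lattice V -> walk_orbits I beta (fun a => 0 < a).
Proof.
move=> nl; split => //.
- rewrite (_ : [set a | _] = [set` `]0, +oo[]); first exact: measurable_itv.
  by apply/seteqP; split => a /=; rewrite in_itv /= andbT.
- by move=> a c; exact: mulr_gt0.
- move=> F H aF aH FH0 FH; apply: (mf_le mfI) => // v /andP[v0 v1].
  have [->//|vn0] := eqVneq v 0.
  have vp : 0 < v by rewrite lt_neqAle eq_sym vn0.
  by apply: FH => //; rewrite vp.
- move=> y G K C t0 ar; apply: (uniform_all rk beta1 rho0 rhob ar) => a a0.
  have [Hall|[D [D0 HD Hk]]] := closed_subgroup_dichotomy (log_period0 y)
    (@log_periodB y) (log_period_closed ar).
    by have := Hall (ln a); rewrite /log_period lnK.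
  exfalso; apply: nl; have [Dp|Dle] := ltP 0 D.
    exists D; split => //; apply/lattice_with_ae => i.
    by apply: filterS (ae_log_period ar i) => x h /h /Hk.
  exists 1; split => //; apply/lattice_with_ae => i.
  apply: filterS (ae_log_period ar i) => x h /h /Hk [k ->]; exists 0.
  have -> : D = 0 by apply/eqP; rewrite eq_le Dle.
  by rewrite mul0r mulr0.
Qed.

(** The asymptotic periods inside dZ form a cyclic group; the split vector is
supported by its generator, which therefore cannot exceed the span d. *)
Lemma walk_orbits_lattice d : 0 < d -> lattice_with V d ->
  (forall d', 0 < d' -> lattice_with V d' -> d' <= d) ->
  walk_orbits I beta (fun a => exists k : int, a = expR (d * k%:~R)).
Proof.
move=> dp ld dmax.
have aed := (lattice_with_ae d).1 ld; split.
- rewrite (_ : [set a | _] = [set` `]0, +oo[] `\`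
     [set y : R | 0 < y /\ ~ exists k : int, ln y = d * k%:~R]).
    by apply: measurableD; [exact: measurable_itv|exact: measurable_off_lattice].
  apply/seteqP; split => a /=; rewrite in_itv /= andbT.
    move=> [k ->]; split; first exact: expR_gt0.
    by move=> [_]; apply; exists k; rewrite expRK.
  move=> [a0 h]; apply: contrapT => nk; apply: h; split => // -[k hk]; apply: nk.
  by exists k; rewrite -hk lnK.
- by move=> a [k ->]; exact: expR_gt0.
- by exists 0; rewrite mulr0 expR0.
- by move=> a c [k ->] [l ->]; exists (k + l); rewrite intrD mulrDr expRD.
- move=> F H aF aH FH0 FH; apply: intensity_ae_le => // i.
  apply: filterS (aed i) => x hx; have /andP[v0 v1] := clip01 V i x.
  have [->//|vn0] := eqVneq (clip V i x) 0.
  have vp : 0 < clip V i x by rewrite lt_neqAle eq_sym vn0.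
  apply: FH; first by rewrite vp.
  by have [k hk] := hx vp; exists k; rewrite -hk lnK.
- move=> y G K C t0 ar; apply: (uniform_lattice rk beta1 rho0 rhob) => //.
  pose H z := log_period y z /\ exists k : int, z = d * k%:~R.
  have H0 : H 0 by split; [exact: log_period0|exists 0; rewrite mulr0].
  have HB z w : H z -> H w -> H (z - w).
    move=> [hz [k zk]] [hw [l wl]]; split; first exact: (log_periodB hz hw).
    by exists (k - l); rewrite zk wl intrD rmorphN; ring.
  have Hcl z : (forall e, 0 < e -> exists w, H w /\ `|w - z| <= e) -> H z.
    move=> Hz; split.
      by apply: (log_period_closed ar) => e e0; have [w [[hw _] wz]] := Hz e e0; exists w.
    have [w [[_ [k wk]] wz]] := Hz (d / 4) (divr_gt0 dp (ltr0n _ 4)).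
    exists k; apply/eqP; rewrite -subr_eq0 -normr_le0; apply/ler_addgt0Pr => e e0.
    have m0 : 0 < Num.min e (d / 4) by rewrite lt_min e0 divr_gt0.
    have [w' [[_ [k' wk']] wz']] := Hz _ m0.
    have : `|w - w'| <= d / 2.
      rewrite -[w - w'](subrKA z); apply: le_trans (ler_normD _ _) _.
      rewrite [X in _ + X]distrC; move: wz'; rewrite le_min => /andP[_ h]; lra.
    rewrite wk wk' -mulrBr normrM (gtr0_norm dp) -rmorphB /= => h.
    have kk : k = k'.
      apply/eqP; rewrite -subr_eq0 -normr_le0 -ltzD1 add0r -(ltr_int R) intr_norm.
      rewrite -(ltr_pM2l dp); apply: le_lt_trans h _; lra.
    have -> : d * k%:~R = w' by rewrite kk wk'.
    rewrite add0r distrC; move: wz'; rewrite le_min => /andP[]; lra.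
  have aeH i : {ae P0, forall x, 0 < clip V i x -> H (ln (clip V i x))}.
    by apply: filterS2 (ae_log_period ar i) (aed i) => x h1 h2 v0; split; [exact: h1|exact: h2].
  have [Hall|[D [D0 [HD [k0 Dk0]] Hk]]] := closed_subgroup_dichotomy H0 HB Hcl.
    have [_ [k]] := Hall (d / 2).
    move=> /(mulfI (lt0r_neq0 dp)) hk.
    have k1 : (0 < k) by rewrite -(ltr_int R) -hk invr_gt0.
    have : (k < 1) by rewrite -(ltr_int R) -hk invf_lt1// ltr1n.
    by lia.
  have [Dp|Dle] := ltP 0 D; last first.
    exfalso; have : 2 * d <= d; last by rewrite leNgt ltr_pMl// ltr1n.
    apply: dmax; first by rewrite mulr_gt0.
    apply/lattice_with_ae => i; apply: filterS (aeH i) => x h /h /Hk [k ->]; exists 0.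
    have -> : D = 0 by apply/eqP; rewrite eq_le Dle.
    by rewrite mul0r mulr0.
  have Dd : D <= d.
    by apply: dmax => //; apply/lattice_with_ae => i; apply: filterS (aeH i) => x h /h /Hk.
  have k0p : 0 < k0 by rewrite -(ltr_int R) -(pmulr_rgt0 _ dp) -Dk0.
  have DE : D = d.
    apply/eqP; rewrite eq_le Dd Dk0 ler_peMr ?(ltW dp)//.
    by rewrite -[1]/(1%:~R) ler_int.
  have HD' : asymptotic_period beta y (expR D) := HD.
  rewrite expRN -DE; exact: (apV HD').
Qed.

(** Here I(v) = 1, whereas I(v^g) < 1 for g > beta. *)
Lemma beta_split_tree : {ae P0, forall x, \sum_(i < b) tnth (V x) i = 1} -> beta = 1.
Proof.
move=> h; apply/eqP; rewrite eq_le beta1 leNgt; apply/negP => blt.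
have := mf_pow_lt1 rk blt.
have -> : I (fun v => v `^ 1) = 1; last by rewrite ltxx.
transitivity (I id).
  apply: (mf_eq mfI); [exact: adm_pow|exact: adm_id|].
  by move=> v /andP[v0 _]; rewrite powRr1.
apply: EFin_inj; rewrite -(intensity_sum hV (adm_id R)).
transitivity (\int[P0]_x (cst 1%:E) x)%E.
  apply: ae_eq_integral => //.
  - by apply/measurable_EFinP; apply: measurable_sum => i; exact: measurable_coord.
  - by apply: filterS h => x /= ->.
by rewrite integral_cst// mul1e; exact: probability_setT.
Qed.

End orbits.

(** * Marginals of the multinomial distribution *)

Section multinomial.
Variables (R : realType) (b B : nat).
Implicit Types (p : 'I_b -> R).

Definition exp_poly (y : R) : {poly R} := \poly_(j < B) (y ^+ j / j`!%:R).

Let fact_neq0 n : n`!%:R != 0 :> R. Proof. by rewrite pnatr_eq0 -lt0n fact_gt0. Qed.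

Lemma coef_exp_polyM y z (P : {poly R}) :
  (forall n, (n < B)%N -> P`_n = z ^+ n / n`!%:R) ->
  forall n, (n < B)%N -> (exp_poly y * P)`_n = (y + z) ^+ n / n`!%:R.
Proof.
move=> hP n nB; rewrite coefM addrC exprDn mulr_suml; apply: eq_bigr => j _.
have jn : (j <= n)%N by rewrite -ltnS.
rewrite coef_poly (leq_ltn_trans jn nB) hP; last exact: leq_ltn_trans (leq_subr _ _) nB.
have := bin_fact jn => /(congr1 (GRing.natmul (1 : R))); rewrite !natrM => E.
rewrite -mulr_natr -E; field; rewrite !fact_neq0 /=.
by rewrite pnatr_eq0 -lt0n bin_gt0.
Qed.

Lemma coef_prod_exp_poly p (Q : pred 'I_b) n : (n < B)%N ->
  (\prod_(j | Q j) exp_poly (p j))`_n = (\sum_(j | Q j) p j) ^+ n / n`!%:R.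
Proof.
move: n; apply: (big_rec2 (fun (P : {poly R}) z => forall n, (n < B)%N -> P`_n = z ^+ n / n`!%:R)).
  by move=> [|n] _; rewrite coef1 ?expr0 ?fact0 ?divr1// expr0n mul0r.
by move=> j P z _ hP n nB; exact: coef_exp_polyM.
Qed.

(** Exponential generating functions: N! times the coefficient of X^N in
exp(q X) prod_j exp(p_j X), where the factor of index i is restricted to its
term of degree m. *)
Lemma multinomial_marginal N p i m : (N < B)%N -> (m < B)%N ->
  \sum_(k : {ffun 'I_b -> 'I_B} | k i == m :> nat)
     multinomial_prob N p (fun j => k j : nat) =
  'C(N, m)%:R * p i ^+ m * (1 - p i) ^+ (N - m).
Proof.
move=> NB mB; pose q := 1 - \sum_(j < b) p j.
pose c (j : 'I_b) (l : 'I_B) : R :=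
  (p j ^+ l / (l`!)%:R) * (((j == i) ==> (l == m :> nat))%:R).
pose F (j : 'I_b) : {poly R} := \sum_(l < B) c j l *: 'X^l.
have Fi : F i = (p i ^+ m / m`!%:R) *: 'X^m.
  rewrite /F (bigD1 (Ordinal mB))//= /c eqxx /= eqxx mulr1 big1 ?addr0// => l lm.
  have -> : (l == m :> nat) = false by apply/negbTE; move: lm; apply: contra => /eqP h; apply/eqP/val_inj.
  by rewrite mulr0 scale0r.
have Fj j : j != i -> F j = exp_poly (p j).
  move=> ji; rewrite /F /exp_poly poly_def; apply: eq_bigr => l _.
  by rewrite /c (negbTE ji) /= mulr1.
have lhs : \sum_(k : {ffun 'I_b -> 'I_B} | k i == m :> nat)
     multinomial_prob N p (fun j => k j : nat) =
    N`!%:R * (exp_poly q * \prod_j F j)`_N.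
  have -> : \prod_j F j = \sum_(k : {ffun 'I_b -> 'I_B})
      (\prod_j c j (k j)) *: 'X^(\sum_j k j).
    rewrite /F bigA_distr_bigA /=; apply: eq_bigr => k _.
    rewrite -(prodrXr 'X) -[RHS]mul_polyC rmorph_prod /= -big_split /=.
    by apply: eq_bigr => j _; rewrite mul_polyC.
  rewrite mulr_sumr coef_sum mulr_sumr [RHS](bigID (fun k : {ffun 'I_b -> 'I_B} => k i == m :> nat)) /=.
  rewrite [X in _ = _ + X]big1 ?addr0; last first.
    move=> k km; rewrite (bigD1 i)//= /c eqxx /= (negbTE km) mulr0 mul0r scale0r.
    by rewrite mulr0 coef0 mulr0.
  apply: eq_bigr => k km; rewrite -scalerAr coefZ coefMXn /multinomial_prob.
  rewrite -/q ltnNge; case: ifP => hr /=; last by rewrite !mulr0.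
  have hq : (N - \sum_(j < b) k j < B)%N by exact: leq_ltn_trans (leq_subr _ _) NB.
  rewrite coef_poly hq.
  have -> : \prod_j c j (k j) = (\prod_j p j ^+ k j) / (\prod_j (k j)`!)%N%:R.
    rewrite natr_prod -prodfV -big_split /=; apply: eq_bigr => j _.
    by rewrite /c; have [->|_] := eqVneq j i; rewrite /= ?km mulr1.
  rewrite natrM; field; rewrite fact_neq0 /=.
  by rewrite pnatr_eq0 -lt0n; apply: prodn_gt0 => j; exact: fact_gt0.
rewrite lhs (bigD1 i)//= Fi (eq_bigr (fun j => exp_poly (p j)) Fj).
rewrite (_ : exp_poly q * _ = (p i ^+ m / m`!%:R) *:
    ((exp_poly q * \prod_(j | j != i) exp_poly (p j)) * 'X^m)); last first.
  by rewrite -scalerAl -scalerAr; congr (_ *: _); rewrite mulrCA mulrC.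
rewrite coefZ coefMXn; have [Nm|mN] := ltnP N m; first by rewrite bin_small// mulr0 mulr0 !mul0r.
have NmB : (N - m < B)%N by exact: leq_ltn_trans (leq_subr _ _) NB.
rewrite (@coef_exp_polyM q (\sum_(j | j != i) p j)) //; last first.
  by move=> n nB; exact: coef_prod_exp_poly.
have -> : q + \sum_(j | j != i) p j = 1 - p i.
  by rewrite /q [\sum_(j < b) p j](bigD1 i)//=; ring.
have := bin_fact mN => /(congr1 (GRing.natmul (1 : R))); rewrite !natrM => <-.
by field; rewrite !fact_neq0.
Qed.

End multinomial.

(** * From events to functions *)

Section integral_extension.
Context {d d' d2 : measure_display}.
Context {T : measurableType d} {T2 : measurableType d2} {T' : measurableType d'} {R : realType}.
Variables (P : {measure set T -> \bar R}) (P2 : {measure set T2 -> \bar R}).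
Variables (W : T -> T') (W2 : T2 -> T').
Hypothesis mW : measurable_fun setT W.
Hypothesis mW2 : measurable_fun setT W2.
Variables (X : T -> R) (Y : T2 -> R).
Hypothesis mX : measurable_fun setT X.
Hypothesis mY : measurable_fun setT Y.
Hypothesis X0 : forall x, 0 <= X x.
Hypothesis Y0 : forall x, 0 <= Y x.

Import HBNNSimple.

(** Both sides are compared through the same approximation of h by simple functions; the two
integrals may be taken over different probability spaces. *)
Lemma integral_extension_indic (h : T' -> R) :
  (forall B, measurable B ->
    (\int[P]_x (\1_B (W x) * X x)%:E = \int[P2]_x (\1_B (W2 x) * Y x)%:E)%E) ->
  measurable_fun setT h -> (forall y, 0 <= h y) ->
  (\int[P]_x (h (W x) * X x)%:E = \int[P2]_x (h (W2 x) * Y x)%:E)%E.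
Proof.
move=> H mh h0.
have mhE : measurable_fun setT (EFin \o h) by exact/measurable_EFinP.
pose g := nnsfun_approx measurableT mhE.
have simple d3 (T3 : measurableType d3) (Q : {measure set T3 -> \bar R})
    (Z : T3 -> T') (U : T3 -> R) (f : {nnsfun T' >-> R}) :
    measurable_fun setT Z -> measurable_fun setT U -> (forall x, 0 <= U x) ->
    (\int[Q]_x (f (Z x) * U x)%:E = \sum_(y \in range f) y%:E *
      \int[Q]_x (\1_(f @^-1` [set y]) (Z x) * U x)%:E)%E.
  move=> mZ mU U0.
  have mI y : measurable_fun setT (fun x => \1_(f @^-1` [set y]) (Z x) * U x).
    have mi : measurable_fun setT (\1_(f @^-1` [set y]) : T' -> R).
      by apply: measurable_indic; exact: measurable_sfunP.
    by apply: measurable_funM => //; exact: (measurableT_comp mi mZ).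
  transitivity (\int[Q]_x \sum_(y \in range f)
      (maxe 0 y%:E * (\1_(f @^-1` [set y]) (Z x) * U x)%:E))%E.
    apply: eq_integral => x _; rewrite {1}(fimfunE f) fsbig_finite//= fsbig_finite//=.
    rewrite mulr_suml -sumEFin; apply: eq_big_seq => y.
    rewrite in_fset_set// inE => -[z _ <-].
    by rewrite max_r ?lee_fin// -EFinM mulrA.
  rewrite ge0_integral_fsum//; first last.
  - by move=> y x _; rewrite mule_ge0// ?le_max ?lexx// lee_fin mulr_ge0.
  - by move=> y; apply: emeasurable_funM => //; exact/measurable_EFinP.
  apply: eq_fsbigr => y; rewrite inE => -[z _ <-].
  have fz : (0 <= (f z)%:E :> \bar R)%E by rewrite lee_fin.
  under eq_integral do rewrite max_r//.
  rewrite ge0_integralZl_EFin//.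
  - by move=> x _; rewrite lee_fin mulr_ge0.
  - exact/measurable_EFinP.
have lim d3 (T3 : measurableType d3) (Q : {measure set T3 -> \bar R})
    (Z : T3 -> T') (U : T3 -> R) :
    measurable_fun setT Z -> measurable_fun setT U -> (forall x, 0 <= U x) ->
    (\int[Q]_x (h (Z x) * U x)%:E = limn (fun n => \int[Q]_x (g n (Z x) * U x)%:E))%E.
  move=> mZ mU U0; rewrite -monotone_convergence //.
  - apply: eq_integral => x _; apply/esym/cvg_lim => //.
    have -> : (fun n => (g n (Z x) * U x)%:E) = (fun n => (g n (Z x))%:E * (U x)%:E)%E.
      by apply/funext => n; rewrite EFinM.
    rewrite EFinM; apply: cvgeM => //.
      exact: (@cvg_nnsfun_approx _ _ _ _ measurableT _ mhE (fun y _ => h0 y) (Z x) Logic.I).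
    exact: cvg_cst.
  - move=> n; apply/measurable_EFinP/measurable_funM => //.
    by apply: measurableT_comp.
  - by move=> n x _; rewrite lee_fin mulr_ge0.
  - move=> x _ m n mn; rewrite lee_fin ler_wpM2r//.
    exact/lefP/nd_nnsfun_approx.
rewrite (lim _ _ P W X)// (lim _ _ P2 W2 Y)//; congr (limn _); apply/funext => n.
rewrite (simple _ _ P W X)// (simple _ _ P2 W2 Y)//; apply: eq_fsbigr => y _.
by rewrite H//; exact: measurable_sfunP.
Qed.

End integral_extension.

Section product_extension.
Context {d d' : measure_display}.
Context {T : measurableType d} {T' : measurableType d'} {R : realType}.
Variables (J : choiceType) (W : J -> T -> T').
Hypothesis mW : forall u, measurable_fun setT (W u).

Lemma measurable_prod_comp (us : seq J) (f : J -> T' -> R) :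
  (forall u, measurable_fun setT (f u)) ->
  measurable_fun setT (fun x => \prod_(u <- us) f u (W u x)).
Proof.
by move=> mf; apply: measurable_prod => u _; exact: (measurableT_comp (mf u) (mW u)).
Qed.

Lemma measurable_prodP_comp (us : seq J) (Q : pred J) (f : J -> T' -> R) :
  (forall u, measurable_fun setT (f u)) ->
  measurable_fun setT (fun x => \prod_(u <- us | Q u) f u (W u x)).
Proof.
move=> mf; under eq_fun do rewrite -big_filter; exact: measurable_prod_comp.
Qed.

(** The indicator functions are replaced by general functions one coordinate at a time. *)
Lemma integral_extension_prod (P : {measure set T -> \bar R}) (X Y : T -> R) (us : seq J) :
  uniq us -> measurable_fun setT X -> measurable_fun setT Y ->
  (forall x, 0 <= X x) -> (forall x, 0 <= Y x) ->
  (forall B : J -> set T', (forall u, measurable (B u)) ->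
    (\int[P]_x ((\prod_(u <- us) \1_(B u) (W u x)) * X x)%:E =
     \int[P]_x ((\prod_(u <- us) \1_(B u) (W u x)) * Y x)%:E)%E) ->
  forall f : J -> T' -> R, (forall u, measurable_fun setT (f u)) ->
    (forall u y, 0 <= f u y) ->
    (\int[P]_x ((\prod_(u <- us) f u (W u x)) * X x)%:E =
     \int[P]_x ((\prod_(u <- us) f u (W u x)) * Y x)%:E)%E.
Proof.
move=> uus mX mY X0 Y0 H.
suff K (gs : seq J) (f : J -> T' -> R) : (forall u, measurable_fun setT (f u)) -> (forall u y, 0 <= f u y) ->
    (forall u, u \in us -> u \notin gs -> exists2 B, measurable B & f u = \1_B) ->
    (\int[P]_x ((\prod_(u <- us) f u (W u x)) * X x)%:E =
     \int[P]_x ((\prod_(u <- us) f u (W u x)) * Y x)%:E)%E.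
  by move=> f mf f0; apply: (K us) => // u ->.
elim: gs f => [|u gs IH] f mf f0 hf.
  pose B u := f u @^-1` [set 1].
  have mB u : measurable (B u).
    by have := mf u measurableT _ (measurable_set1 1); rewrite setTI.
  have fB u : u \in us -> f u = \1_(B u).
    move=> uus'; have [//|A mA fA] := hf u uus'.
    rewrite /B fA; apply/funext => y; rewrite !indicE; congr (_%:R); congr nat_of_bool.
    apply/idP/idP; rewrite !inE /=; rewrite indicE.
      by move=> Ay; rewrite mem_set.
    by case: (boolP (y \in A)) => [|_ /eqP]; rewrite ?inE// eq_sym oner_eq0.
  have E x : \prod_(u <- us) f u (W u x) = \prod_(u <- us) \1_(B u) (W u x).
    by apply: eq_big_seq => u uu; rewrite fB.
  by under eq_integral do rewrite E; under [RHS]eq_integral do rewrite E; exact: H.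
have [uu|nu] := boolP (u \in us); last first.
  apply: IH => // v vus vgs; apply: hf => //; rewrite inE negb_or vgs andbT.
  by apply: contra nu => /eqP <-.
have E x Z : (\prod_(v <- us) f v (W v x)) * Z =
    f u (W u x) * ((\prod_(v <- us | v != u) f v (W v x)) * Z).
  by rewrite (bigD1_seq u)//= mulrA.
under eq_integral do rewrite E; under [RHS]eq_integral do rewrite E.
apply: integral_extension_indic => //.
- by apply: measurable_funM => //; exact: measurable_prodP_comp.
- by apply: measurable_funM => //; exact: measurable_prodP_comp.
- by move=> x; rewrite mulr_ge0// prodr_ge0.
- by move=> x; rewrite mulr_ge0// prodr_ge0.
move=> B mB; pose f' v := if v == u then (\1_B : T' -> R) else f v.
have E' x Z : \1_B (W u x) * ((\prod_(v <- us | v != u) f v (W v x)) * Z) =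
    (\prod_(v <- us) f' v (W v x)) * Z.
  rewrite [in RHS](bigD1_seq u)//= /f' eqxx mulrA; congr (_ * _ * _).
  by apply: eq_bigr => v /negbTE ->.
under eq_integral do rewrite E'; under [RHS]eq_integral do rewrite E'.
apply: IH => [v|v y|v vus vgs]; rewrite /f'; case: eqP => // vu.
- by exists B.
- by apply: hf => //; rewrite inE negb_or vgs andbT; apply/eqP.
Qed.

End product_extension.

Section independence.
Context {d d' d2 : measure_display}.
Context {T : measurableType d} {S : measurableType d2} {T' : measurableType d'} {R : realType}.
Variables (P : probability T R) (P0 : probability S R).
Variables (J : choiceType) (W : J -> T -> T') (V : S -> T').
Hypothesis mW : forall u, measurable_fun setT (W u).
Hypothesis mV : measurable_fun setT V.
Hypothesis lawW : forall u B, measurable B -> P (W u @^-1` B) = P0 (V @^-1` B).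
Hypothesis indepW : forall (us : seq J) (B : J -> set T'),
  uniq us -> (forall u, measurable (B u)) ->
  P (\bigcap_(u in [set` us]) (W u @^-1` B u)) = (\prod_(u <- us) P (W u @^-1` B u))%E.

Lemma integral_preimage_indic d3 (U : measurableType d3) (Q : probability U R)
  (Z : U -> T') (B : set T') : measurable_fun setT Z -> measurable B ->
  (\int[Q]_x (\1_B (Z x))%:E = Q (Z @^-1` B))%E.
Proof.
move=> mZ mB.
have mA : measurable (Z @^-1` B) by have := mZ measurableT _ mB; rewrite setTI.
transitivity (\int[Q]_x (\1_(Z @^-1` B) x)%:E)%E; last by rewrite integral_indic// setIT.
by apply: eq_integral.
Qed.

(** The independence of events extends to functions, one coordinate at a time. *)
Lemma integral_prod_indep (us : seq J) (f : J -> T' -> R) : uniq us ->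
  (forall u, measurable_fun setT (f u)) -> (forall u y, 0 <= f u y <= 1) ->
  (\int[P]_x (\prod_(u <- us) f u (W u x))%:E =
   (\prod_(u <- us) \int[P0]_x f u (V x))%R%:E)%E.
Proof.
move=> uus.
have R0 (h : T' -> R) : measurable_fun setT h -> (forall y, 0 <= h y <= 1) ->
    (\int[P0]_x (h (V x))%:E = (\int[P0]_x h (V x))%R%:E)%E.
  move=> mh h01; rewrite /Rintegral fineK//; apply: integrable_fin_num => //.
  apply: (@bounded_integrable _ _ _ P0 (h \o V) 1); first exact: measurableT_comp.
  by move=> x; have /andP[h0 h1] := h01 (V x); rewrite /= ger0_norm.
suff K (gs : seq J) (g : J -> T' -> R) : (forall u, measurable_fun setT (g u)) -> (forall u y, 0 <= g u y <= 1) ->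
    (forall u, u \in us -> u \notin gs -> exists2 B, measurable B & g u = \1_B) ->
    (\int[P]_x (\prod_(u <- us) g u (W u x))%:E =
     (\prod_(u <- us) \int[P0]_x g u (V x))%R%:E)%E.
  by move=> mf f0; apply: (K us) => // u ->.
elim: gs g => [|u gs IH] g mg g01 hg.
  pose B u := g u @^-1` [set 1].
  have mB u : measurable (B u).
    by have := mg u measurableT _ (measurable_set1 1); rewrite setTI.
  have gB u : u \in us -> g u = \1_(B u).
    move=> uus'; have [//|A mA gA] := hg u uus'.
    rewrite /B gA; apply/funext => y; rewrite !indicE; congr (_%:R); congr nat_of_bool.
    apply/idP/idP; rewrite !inE /=; rewrite indicE.
      by move=> Ay; rewrite mem_set.
    by case: (boolP (y \in A)) => [|_ /eqP]; rewrite ?inE// eq_sym oner_eq0.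
  have mBW u : measurable (W u @^-1` B u) by have := @mW u measurableT _ (mB u); rewrite setTI.
  transitivity (\int[P]_x (\1_(\bigcap_(u in [set` us]) (W u @^-1` B u)) x)%:E)%E.
    apply: eq_integral => x _; congr EFin; rewrite indicE.
    rewrite (eq_big_seq (fun u => (W u x \in B u)%:R)); last first.
      by move=> u uu; rewrite gB// indicE.
    case: (boolP (x \in _)) => [|nx].
      rewrite inE => hx; rewrite big_seq big1// => u uu.
      by rewrite mem_set//; exact: (hx u uu).
    have [u uu nu] : exists2 u, u \in us & W u x \notin B u.
      apply: contrapT => h; move: nx; rewrite notin_setE; apply => u /= uu.
      by apply: contrapT => nB; apply: h; exists u => //; rewrite notin_setE.
    by rewrite (bigD1_seq u)//= (negbTE nu) mul0r.
  rewrite integral_indic ?setIT//; last first.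
    by rewrite bigcap_seq; exact: bigsetI_measurable.
  transitivity (\prod_(u <- us) P (W u @^-1` B u))%E; first exact: indepW.
  rewrite (eq_big_seq (fun u => (\int[P0]_x g u (V x))%R%:E)).
    by rewrite prodEFin.
  by move=> u uu; rewrite -R0// gB// lawW// integral_preimage_indic.
have [uu|nu] := boolP (u \in us); last first.
  apply: IH => // v vus vgs; apply: hg => //; rewrite inE negb_or vgs andbT.
  by apply: contra nu => /eqP <-.
pose ka := \prod_(v <- us | v != u) (\int[P0]_x g v (V x))%R.
have ge0 v : 0 <= (\int[P0]_x g v (V x))%R.
  by apply: Rintegral_ge0 => x _; case/andP: (g01 v (V x)).
have ka0 : 0 <= ka by apply: prodr_ge0 => v _.
have E x : \prod_(v <- us) g v (W v x) =
    g u (W u x) * \prod_(v <- us | v != u) g v (W v x) by rewrite (bigD1_seq u).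
under eq_integral do rewrite E.
have main : (\int[P0]_x (g u (V x) * cst ka x)%:E =
    (\prod_(v <- us) \int[P0]_x g v (V x))%R%:E)%E.
  rewrite (bigD1_seq u)//= -/ka.
  under eq_integral do rewrite /= mulrC EFinM.
  rewrite ge0_integralZl_EFin//.
  - by rewrite R0// -EFinM mulrC.
  - by move=> x _; rewrite lee_fin; case/andP: (g01 u (V x)).
  - by apply/measurable_EFinP; exact: (measurableT_comp (mg u) mV).
apply: etrans main; apply: integral_extension_indic => //.
- exact: measurable_prodP_comp.
- by move=> x; apply: prodr_ge0 => v _; case/andP: (g01 v (W v x)).
- move=> B mB; pose g' v := if v == u then (\1_B : T' -> R) else g v.
  have E' x : \1_B (W u x) * (\prod_(v <- us | v != u) g v (W v x)) =
      (\prod_(v <- us) g' v (W v x)).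
    rewrite [in RHS](bigD1_seq u)//= /g' eqxx; congr (_ * _).
    by apply: eq_bigr => v /negbTE ->.
  under eq_integral do rewrite E'.
  have i01 (y : T') : 0 <= (\1_B y : R) <= 1.
    by rewrite indicE; case: (_ \in _); rewrite ?lexx ?ler01.
  transitivity ((\prod_(v <- us) \int[P0]_x g' v (V x))%R%:E).
    apply: IH => [v|v y|v vus vgs]; rewrite /g'; case: eqP => // vu; first by exists B.
    by apply: hg => //; rewrite inE negb_or vgs andbT; apply/eqP.
  rewrite (bigD1_seq u)//= {1}/g' eqxx.
  have -> : \prod_(v <- us | v != u) (\int[P0]_x g' v (V x))%R = ka.
    by apply: eq_bigr => v /negbTE vu; rewrite /g' vu.
  under eq_integral do rewrite /= mulrC EFinM.
  rewrite ge0_integralZl_EFin//.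
  + by rewrite mulrC EFinM R0.
  + by apply/measurable_EFinP; apply: measurableT_comp.
- by move=> y; case/andP: (g01 u y).
Qed.

End independence.

(** * Split probabilities *)

Section split_prob_facts.
Variables (R : realType) (b s s0 s1 : nat).
Hypothesis b_gt0 : (0 < b)%N.
Hypothesis hs1 : (b * s1 + s0 <= s + 1)%N.
Let c0 := (s0 + b * s1)%N.
Implicit Types (p : b.-tuple R) (c : 'I_b -> nat).

Definition valid p : bool := [forall i, 0 <= tnth p i] && (\sum_(i < b) tnth p i <= 1).

Lemma split_prob_ge0 m p c : valid p -> 0 <= split_prob s s0 s1 m p c.
Proof.
move=> /andP[/forallP h0 hs]; rewrite /split_prob; case: ifP => _ //.
case: ifP => // _; rewrite /multinomial_prob; case: ifP => // _.
rewrite !mulr_ge0//; first by rewrite prodr_ge0// => i _; rewrite exprn_ge0.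
by rewrite exprn_ge0// subr_ge0.
Qed.

(** The marginals of a multinomial distribution are binomial. The sum over all vectors with
entries below B is the sum over all vectors, as no entry can exceed m. *)
Lemma split_prob_sum m p i B (F : nat -> R) : (m < B)%N ->
  \sum_(c : {ffun 'I_b -> 'I_B}) split_prob s s0 s1 m p (fun j => c j : nat) * F (c i) =
  if (m <= s)%N then F 0%N
  else binE (m - c0) (fun k => F (k + s1)%N) (tnth p i).
Proof.
case: B => // B mB; rewrite /split_prob; case: ifP => ms.
  have e : [forall j, ([ffun=> ord0] : {ffun 'I_b -> 'I_B.+1}) j == 0%N :> nat].
    by apply/forallP => j; rewrite ffunE.
  rewrite (bigD1 [ffun=> ord0])//= e mul1r ffunE big1 ?addr0// => c /eqP cn.
  case: forallP => [h|_]; last by rewrite mul0r.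
  exfalso; apply: cn; apply/ffunP => j; rewrite ffunE; apply/val_inj/eqP; exact: h.
have sm : (s < m)%N by rewrite ltnNge ms.
have cm : (c0 <= m)%N by rewrite /c0; lia.
have s1c : (s1 <= c0)%N by rewrite /c0; case: (b) b_gt0 => // b' _; rewrite mulSn; lia.
rewrite -subnDA -/c0; set N := (m - c0)%N.
have NB : (N < B.+1)%N by rewrite /N; lia.
have Ns1 : (N + s1 <= m)%N by rewrite /N; lia.
pose G (k : {ffun 'I_b -> 'I_B.+1}) := multinomial_prob N (tnth p) (fun j => k j : nat).
have G0 (k : {ffun 'I_b -> 'I_B.+1}) j : (N < k j)%N -> G k = 0.
  move=> Nk; rewrite /G /multinomial_prob ifF//; apply/negbTE; rewrite -ltnNge.
  by apply: leq_trans Nk _; rewrite (bigD1 j)//= leq_addr.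
transitivity (\sum_(k : {ffun 'I_b -> 'I_B.+1}) G k * F (k i + s1)%N).
  transitivity (\sum_(c : {ffun 'I_b -> 'I_B.+1} | [forall j, (s1 <= c j)%N])
     multinomial_prob N (tnth p) (fun j => (c j - s1)%N) * F (c i)).
    rewrite [RHS]big_mkcond /=; apply: eq_bigr => c _.
    by case: ifP => // _; rewrite mul0r.
  pose h (k : {ffun 'I_b -> 'I_B.+1}) : {ffun 'I_b -> 'I_B.+1} := [ffun j => inord (k j + s1)].
  pose h' (k : {ffun 'I_b -> 'I_B.+1}) : {ffun 'I_b -> 'I_B.+1} := [ffun j => inord (k j - s1)].
  rewrite (reindex_onto h h'); last first.
    move=> c /forallP hc; apply/ffunP => j; rewrite !ffunE.
    by rewrite [X in (X + s1)%N]inordK ?subnK ?inord_val// (leq_ltn_trans (leq_subr _ _)).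
  rewrite big_mkcond /=; apply: eq_bigr => k _.
  have [/forallP hk|/forallPn [j hj]] := boolP [forall j, (k j + s1 < B.+1)%N].
    have E j : (h k j : nat) = (k j + s1)%N by rewrite ffunE inordK.
    rewrite ifT; last first.
      apply/andP; split; first by apply/forallP => j; rewrite E leq_addl.
      by apply/eqP/ffunP => j; rewrite ffunE E addnK inord_val.
    rewrite E /G; congr (_ * _); congr multinomial_prob.
    by apply/funext => j; rewrite E addnK.
  rewrite (G0 k j) ?mul0r; last by move: hj; rewrite -leqNgt; lia.
  case: ifP => // /andP[/forallP /(_ j)]; rewrite ffunE /inord /insubd insubF /=; last by apply/negbTE.
  rewrite leqn0 => /eqP s10; exfalso; move: hj; rewrite s10 addn0 ltn_ord//.
have part : \sum_(k : {ffun 'I_b -> 'I_B.+1}) G k * F (k i + s1)%N =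
    \sum_(l < B.+1) F (l + s1)%N * ('C(N, l)%:R * tnth p i ^+ l * (1 - tnth p i) ^+ (N - l)).
  rewrite (partition_big (fun k : {ffun 'I_b -> 'I_B.+1} => k i) xpredT)//=.
  apply: eq_bigr => l _.
  rewrite -(@multinomial_marginal R b B.+1 N (tnth p) i l NB (ltn_ord l)) mulr_sumr.
  apply: eq_big => [k|k /eqP ->]; first by [].
  by rewrite mulrC.
rewrite part binE_formula.
rewrite (@big_ord_widen _ _ _ N.+1 B.+1 (fun l => F (l + s1)%N * ('C(N, l)%:R * tnth p i ^+ l * (1 - tnth p i) ^+ (N - l))))//.
rewrite [RHS]big_mkcond /=; apply: eq_bigr => l _; case: ltnP => // Nl.
by rewrite bin_small// !mul0r mulr0.
Qed.

Lemma split_prob_total m p B : (m < B)%N ->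
  \sum_(c : {ffun 'I_b -> 'I_B}) split_prob s s0 s1 m p (fun j => c j : nat) = 1.
Proof.
move=> mB; have := split_prob_sum p (Ordinal b_gt0) (fun=> 1) mB.
by under eq_bigr do rewrite mulr1; rewrite binE_cst; case: ifP.
Qed.

(** Replaced by 0 off the valid split vectors, so that the bounds 0 and 1 hold everywhere and
not only almost surely. *)
Definition split_probv (m : nat) (c : 'I_b -> nat) p : R :=
  (valid p)%:R * split_prob s s0 s1 m p c.

Lemma split_probv_ge0 m c p : 0 <= split_probv m c p.
Proof.
by rewrite /split_probv; case: (boolP (valid p)) => [/split_prob_ge0|_];
  rewrite ?mul1r ?mul0r.
Qed.

Lemma split_probvE m c p : valid p -> split_probv m c p = split_prob s s0 s1 m p c.
Proof. by rewrite /split_probv => ->; rewrite mul1r. Qed.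

Lemma split_probv_total m p B : valid p -> (m < B)%N ->
  \sum_(c : {ffun 'I_b -> 'I_B}) split_probv m (fun j => c j : nat) p = 1.
Proof.
by move=> vp mB; rewrite -[RHS](split_prob_total p mB); apply: eq_bigr => c _; rewrite split_probvE.
Qed.

Lemma split_probv_le1 m c p : split_probv m c p <= 1.
Proof.
have [vp|nv] := boolP (valid p); last by rewrite /split_probv (negbTE nv) mul0r.
pose B := (m + \sum_(i < b) c i).+1.
have cB i : (c i < B)%N by rewrite ltnS (bigD1 i)//= addnCA leq_addr.
rewrite -(split_probv_total (m := m) (B := B) vp); last by rewrite ltnS leq_addr.
pose cc : {ffun 'I_b -> 'I_B} := [ffun i => Ordinal (cB i)].
rewrite (bigD1 cc)//=.
have -> : (fun j => cc j : nat) = c by apply/funext => i; rewrite ffunE.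
by rewrite lerDl sumr_ge0// => d _; exact: split_probv_ge0.
Qed.

Lemma measurable_valid : measurable [set p : b.-tuple R | valid p].
Proof.
rewrite (_ : [set p | _] = (\bigcap_(i in [set: 'I_b]) [set p | 0 <= tnth p i]) `&`
   [set p : b.-tuple R | \sum_(i < b) tnth p i <= 1]).
  apply: measurableI.
    apply: fin_bigcap_measurable => [|i _]; first exact: finite_finset.
    have := @measurable_tnth _ R b i measurableT _ (measurable_itv `[0, +oo[).
    rewrite setTI (_ : _ @^-1` _ = [set p | 0 <= tnth p i])//.
    by apply/seteqP; split => p /=; rewrite in_itv /= andbT.
  have ms : measurable_fun setT (fun p : b.-tuple R => \sum_(i < b) tnth p i).
    by apply: measurable_sum => i; exact: measurable_tnth.
  have := ms measurableT _ (measurable_itv `]-oo, 1]).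
  rewrite setTI (_ : _ @^-1` _ = [set p | \sum_(i < b) tnth p i <= 1])//.
apply/seteqP; split => p /= => [/andP[/forallP h1 h2]|[h1 h2]].
  by split => // i _; exact: h1.
by rewrite /valid h2 andbT; apply/forallP => i; exact: h1.
Qed.

Lemma measurable_split_prob m c :
  measurable_fun setT (fun p : b.-tuple R => split_prob s s0 s1 m p c).
Proof.
rewrite /split_prob; case: (leqP m s) => _; first exact: measurable_cst.
case: [forall i, (s1 <= c i)%N]; last exact: measurable_cst.
rewrite /multinomial_prob; set r := (\sum_(i < b) _)%N.
case: (leqP r (m - s0 - b * s1)) => _; last exact: measurable_cst.
apply: measurable_funM; first apply: measurable_funM.
- exact: measurable_cst.
- by apply: measurable_prod => i _; apply: measurable_funX; exact: measurable_tnth.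
- apply: measurable_funX; apply: measurable_funB; first exact: measurable_cst.
  by apply: measurable_sum => i; exact: measurable_tnth.
Qed.


Lemma measurable_split_probv m c : measurable_fun setT (split_probv m c).
Proof.
apply: measurable_funM; last exact: measurable_split_prob.
rewrite (_ : (fun p : b.-tuple R => (valid p)%:R) = \1_[set p | valid p]).
  by apply: measurable_indic; exact: measurable_valid.
by apply/funext => p; congr (_%:R); congr nat_of_bool; apply/idP/idP; rewrite inE.
Qed.

End split_prob_facts.

(** * The law of the split tree *)

Section expectation_tools.
Context {d : measure_display} {T : measurableType d} {R : realType}.
Variable P : probability T R.

Lemma integral_indicT (A : set T) : measurable A -> (\int[P]_x (\1_A x)%:E = P A)%E.
Proof. by move=> mA; rewrite integral_indic// setIT. Qed.

Lemma integral_ae_eqT (f g : T -> R) : measurable_fun setT f -> measurable_fun setT g ->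
  {ae P, forall x, f x = g x} -> (\int[P]_x (f x)%:E = \int[P]_x (g x)%:E)%E.
Proof.
move=> mf mg fg; apply: ae_eq_integral => //; [exact/measurable_EFinP|exact/measurable_EFinP|].
by apply: filterS fg => x /= ->.
Qed.

Lemma ae_countable (J : countType) (Q : J -> T -> Prop) :
  (forall j, {ae P, forall x, Q j x}) -> {ae P, forall x, forall j, Q j x}.
Proof.
move=> h; have := @ae_foralln _ _ _ P (fun k x => forall j, unpickle k = Some j -> Q j x).
move=> /(_ _) h'; apply: (filterS _ (h' _)) => [x hx j|k].
  by apply: (hx (pickle j)); rewrite pickleK.
case E : (@unpickle J k) => [j|]; last by apply: filterE => x j.
by apply: filterS (h j) => x Qx j' [<-].
Qed.

Lemma ae_prob1 (A : set T) : measurable A -> P A = 1%E -> {ae P, forall x, A x}.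
Proof.
move=> mA PA; have h : P (~` A) = 0%E by rewrite probability_setC// PA subee.
by apply/(negligibleP P (measurableC mA)).
Qed.

Lemma prob1_ae (A : set T) : measurable A -> {ae P, forall x, A x} -> P A = 1%E.
Proof.
move=> mA /(negligibleP P (measurableC mA)) h.
have {h} : P (~` A) = 0%E by exact: h.
rewrite probability_setC//.
have fA : P A \is a fin_num by exact: fin_num_measure.
by rewrite -(fineK fA) -EFinB => -[] /eqP; rewrite subr_eq0 => /eqP <-.
Qed.

(** A function of a discrete random variable and of a point is measurable as soon as
it is so for each value of the discrete variable. *)
Lemma measurable_discrete (J : countType) (X : T -> J) (G : J -> T -> R) :
  (forall j, measurable [set x | X x = j]) -> (forall j, measurable_fun setT (G j)) ->
  measurable_fun setT (fun x => G (X x) x).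
Proof.
move=> mX mG _ B mB; rewrite setTI.
rewrite (_ : _ @^-1` _ = \bigcup_j ([set x | X x = j] `&` G j @^-1` B)).
  apply: countable_bigcupT_measurable => [|j]; first exact: countableP.
  by apply: measurableI => //; have := mG j measurableT _ mB; rewrite setTI.
apply/seteqP; split => x /=; first by exists (X x).
by move=> [j _ [<-]].
Qed.

Lemma indic_setI (A B : set T) x : (\1_(A `&` B) x : R) = \1_A x * \1_B x.
Proof. by rewrite indicI. Qed.

Lemma indic01 (A : set T) x : 0 <= (\1_A x : R) <= 1.
Proof. by rewrite indicE; case: (_ \in _); rewrite ?lexx ?ler01. Qed.

Lemma indic_in (A : set T) x : A x -> (\1_A x : R) = 1.
Proof. by move=> Ax; rewrite indicE mem_set. Qed.

Lemma indic_notin (A : set T) x : ~ A x -> (\1_A x : R) = 0.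
Proof. by move=> Ax; rewrite indicE memNset. Qed.

End expectation_tools.

Section model.
Context {d0 d1 : measure_display}.
Context {S : measurableType d0} {Omega : measurableType d1} {R : realType}.
Context {P0 : probability S R} {P : probability Omega R} {b : nat}.
Variable V : {RV P0 >-> b.-tuple R}.
Hypothesis hV : split_vector V.
Variables (s s0 s1 n : nat).
Variables (W : node b -> {RV P >-> b.-tuple R}) (T : Omega -> btree b).
Hypothesis M : split_tree_model V s s0 s1 n W T.
Hypothesis b_gt0 : (0 < b)%N.
Hypothesis hs1 : (b * s1 + s0 <= s + 1)%N.
Local Notation q := (split_probv s s0 s1).
Local Notation history := (history W T).

Lemma ae_validV : {ae P0, forall x, valid (V x)}.
Proof.
apply: filterS2 (split_vector_ge0 hV) (split_vector_sum hV) => x h0 h1.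
by rewrite /valid h1 andbT; apply/forallP.
Qed.

Lemma measurable_W u : measurable_fun setT (W u).
Proof. exact: measurable_funP. Qed.

Lemma ae_valid : {ae P, forall x, forall u, valid (W u x)}.
Proof.
apply: (@ae_countable _ _ _ P (seq 'I_b) (fun u x => valid (W u x))) => u.
apply: ae_prob1.
  by have := @measurable_W u measurableT _ (measurable_valid (R := R) (b := b)); rewrite setTI.
have := split_tree_copies M u (measurable_valid (R := R) (b := b)) => ->.
have mVv : measurable (V @^-1` [set p | valid p]).
  have mV : measurable_fun setT V by exact: measurable_funP.
  by have := mV measurableT _ (measurable_valid (R := R) (b := b)); rewrite setTI.
by apply: prob1_ae mVv _; exact: ae_validV.
Qed.

Lemma measurable_T v m : measurable [set x | T x v = m].
Proof. exact: split_tree_measurable M v m. Qed.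

Lemma measurable_Tpred (J : countType) (v : J -> node b) (Q : J -> nat -> Prop) :
  measurable [set x | forall j, Q j (T x (v j))].
Proof.
rewrite (_ : [set x | _] = ~` (\bigcup_j \bigcup_m
    ([set x | T x (v j) = m] `&` [set _ | ~ Q j m]))).
  apply: measurableC; apply: countable_bigcupT_measurable => [|j]; first exact: countableP.
  apply: countable_bigcupT_measurable => [|m]; first exact: countableP.
  apply: measurableI; first exact: measurable_T.
  by have [?|?] := pselect (Q j m); [rewrite (_ : [set _ | _] = set0)//|
    rewrite (_ : [set _ | _] = setT)//]; apply/seteqP; split.
apply/seteqP; split => x /= h.
  by move=> [j _ [m _ [<-]]]; apply; exact: h.
move=> j; apply: contrapT => nQ; apply: h; exists j => //; exists (T x (v j)) => //.
Qed.

Lemma history_measurable k E : history k E -> measurable E.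
Proof.
apply: smallest_sub; first exact: sigma_algebra_measurable.
move=> A /= [[u [B [mB ->]]]|[v [m [_ ->]]]]; last exact: measurable_T.
by have := @measurable_W u measurableT _ mB; rewrite setTI.
Qed.

Lemma historyI k E F : history k E -> history k F -> history k (E `&` F).
Proof.
pose G := [set E | (exists u B, measurable B /\ E = W u @^-1` B) \/
               (exists v m, (size v <= k)%N /\ E = [set w | T w v = m])].
move=> hE hF; exact: (@measurableI _ (g_sigma_algebraType G)).
Qed.

Lemma historyT k : history k setT.
Proof.
pose G := [set E | (exists u B, measurable B /\ E = W u @^-1` B) \/
               (exists v m, (size v <= k)%N /\ E = [set w | T w v = m])].
exact: (@measurableT _ (g_sigma_algebraType G)).
Qed.

(** The history at any depth contains the split vectors of all nodes. *)
Lemma history_W k (us : seq (node b)) (B : node b -> set (b.-tuple R)) :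
  (forall u, measurable (B u)) -> history k (\bigcap_(u in [set` us]) (W u @^-1` B u)).
Proof.
move=> mB; elim: us => [|u us IH].
  by rewrite (_ : \bigcap_(_ in _) _ = setT); [exact: historyT|apply/seteqP; split].
rewrite (_ : \bigcap_(_ in _) _ = (W u @^-1` B u) `&` \bigcap_(u in [set` us]) (W u @^-1` B u)).
  apply: historyI => //; apply: sub_sigma_algebra; left; exists u, (B u); split=> //.
apply/seteqP; split => x /= h; last first.
  by case: h => h1 h2 v; rewrite /= inE => /orP[/eqP ->|/h2].
by split; [apply: h; rewrite /= mem_head|move=> v vus; apply: h; rewrite /= inE vus orbT].
Qed.

Lemma history_T k (w : node b) (Q : node b -> Prop) (g : node b -> nat) :
  (forall u, Q u -> (size (w ++ u) <= k)%N) ->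
  history k [set x | forall u, Q u -> T x (w ++ u) = g u].
Proof.
pose G := [set E | (exists u B, measurable B /\ E = W u @^-1` B) \/
               (exists v m, (size v <= k)%N /\ E = [set w | T w v = m])].
move=> hQ.
have H1 u : history k (if `[<Q u>] then [set x | T x (w ++ u) = g u] else setT).
  case: asboolP => [Qu|_]; last exact: historyT.
  by apply: sub_sigma_algebra; right; exists (w ++ u), (g u); split => //; exact: hQ.
have -> : [set x | forall u, Q u -> T x (w ++ u) = g u] =
    ~` \bigcup_u ~` (if `[<Q u>] then [set x | T x (w ++ u) = g u] else setT).
  rewrite setC_bigcup; apply/seteqP; split => x h.
    by move=> u _; rewrite setCK; case: asboolP => // /h.
  by move=> u Qu; have := h u Logic.I; rewrite setCK; case: asboolP.
apply: (@measurableC _ (g_sigma_algebraType G)).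
apply: (@countable_bigcupT_measurable _ (g_sigma_algebraType G)) => [|u].
  exact: countableP.
apply: (@measurableC _ (g_sigma_algebraType G)); exact: H1.
Qed.

Lemma measurable_q v u c : measurable_fun setT (fun x => q (T x v) c (W u x)).
Proof.
apply: (@measurable_discrete _ _ _ nat (fun x => T x v) (fun m x => q m c (W u x))) => [m|m].
  exact: measurable_T.
by apply: (measurableT_comp _ (@measurable_W u)); exact: measurable_split_probv.
Qed.

Lemma measurable_history_indic k E : history k E -> measurable_fun setT (\1_E : Omega -> R).
Proof. by move=> hE; apply: measurable_indic; exact: history_measurable hE. Qed.

(** The defining property of the tree with the truncated split probabilities. *)
Lemma children_spv k E (c : k.-tuple 'I_b -> 'I_b -> nat) : history k E ->
  P (E `&` [set x | forall (v : k.-tuple 'I_b) i, T x (rcons v i) = c v i]) =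
  (\int[P]_x (\1_E x * \prod_(v : k.-tuple 'I_b) q (T x v) (c v) (W v x))%:E)%E.
Proof.
move=> hE; rewrite (split_tree_children M c hE) integral_mkcond.
apply: ae_eq_integral => //.
- apply: (measurable_restrict _ _ _).1 => //; first exact: history_measurable hE.
  apply: measurable_funS (subsetT _) _ => //.
  apply/measurable_EFinP; apply: measurable_prod => v _.
  apply: (@measurable_discrete _ _ _ nat (fun x => T x v)
    (fun m x => split_prob s s0 s1 m (W v x) (c v))) => [m|m]; first exact: measurable_T.
  exact: (measurableT_comp (measurable_split_prob (R := R) (b := b) s s0 s1 m (c v)) (@measurable_W v)).
- apply/measurable_EFinP; apply: measurable_funM; first exact: measurable_history_indic hE.
  by apply: measurable_prod => v _; exact: measurable_q.
apply: filterS ae_valid => x vx _; rewrite patchE indicE; case: ifP => _.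
  by rewrite mul1r; congr EFin; apply: eq_bigr => v _; rewrite split_probvE.
by rewrite mul0r.
Qed.

(** The sum of the defining property over families of children vectors, with the product
of sums expanded. *)
Lemma children_family k B E (F : k.-tuple 'I_b -> pred {ffun 'I_b -> 'I_B}) : history k E ->
  P (E `&` [set x | forall v : k.-tuple 'I_b, exists2 c : {ffun 'I_b -> 'I_B},
       F v c & forall i, T x (rcons v i) = c i]) =
  (\int[P]_x (\1_E x * \prod_(v : k.-tuple 'I_b)
     \sum_(c | F v c) q (T x v) (fun i => c i : nat) (W v x))%:E)%E.
Proof.
move=> hE; have mE := history_measurable hE.
pose C (g : {ffun k.-tuple 'I_b -> {ffun 'I_b -> 'I_B}}) :=
  [set x | forall (v : k.-tuple 'I_b) i, T x (rcons v i) = g v i].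
have mC g : measurable (C g).
  rewrite (_ : C g = [set x | forall vi : k.-tuple 'I_b * 'I_b,
      T x (rcons vi.1 vi.2) = g vi.1 vi.2]); last first.
    by apply/seteqP; split => x /= h => [vi|v i]; [exact: h|exact: (h (v, i))].
  exact: (@measurable_Tpred _ (fun vi : k.-tuple 'I_b * 'I_b => rcons vi.1 vi.2)
    (fun vi m => m = g vi.1 vi.2)).
have mEC g : measurable (E `&` C g) by exact: measurableI.
set D := [set x | _].
have D1 x : \1_(E `&` D) x = \sum_(g in family F) \1_(E `&` C g) x :> R.
  have [[Ex Dx]|nx] := pselect ((E `&` D) x); last first.
    rewrite indic_notin// big1// => g gF; rewrite indic_notin//.
    move=> [Ex Cg]; apply: nx; split => // v; exists (g v) => //.
    exact: (familyP gF v).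
  have Dx' v : {c : {ffun 'I_b -> 'I_B} | F v c & forall i, T x (rcons v i) = c i}.
    by have [c Fc hc] := cid2 (Dx v); exists c.
  pose g0 : {ffun k.-tuple 'I_b -> {ffun 'I_b -> 'I_B}} := [ffun v => s2val (Dx' v)].
  have g0F : g0 \in family F by apply/familyP => v; rewrite ffunE; case: (Dx' v).
  rewrite indic_in// (bigD1 g0)//= indic_in; last first.
    by split=> // v i; rewrite ffunE; case: (Dx' v).
  rewrite big1 ?addr0// => g /andP[_ /eqP gg]; rewrite indic_notin// => -[_ Cg].
  apply: gg; apply/ffunP => v; apply/ffunP => i; apply/val_inj => /=.
  by rewrite -(Cg v i) ffunE; case: (Dx' v).
have mD : measurable (E `&` D).
  rewrite (_ : _ `&` _ = \bigcup_(g in [set g | g \in family F]) (E `&` C g)).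
    by apply: fin_bigcup_measurable => // ; exact: finite_finset.
  apply/seteqP; split => x.
    move=> hx; apply: contrapT => nx; have := D1 x; rewrite indic_in// big1.
      by move/eqP; rewrite oner_eq0.
    by move=> g gF; rewrite indic_notin// => hg; apply: nx; exists g.
  move=> [g gF hg]; apply: contrapT => nx; have := D1 x; rewrite indic_notin//.
  rewrite (bigD1 g)//= indic_in// => /eqP; rewrite eq_sym paddr_eq0 ?oner_eq0//.
  by apply: sumr_ge0 => g' _; case/andP: (indic01 (R := R) (E `&` C g') x).
rewrite -(integral_indicT P mD).
under eq_integral do rewrite D1 -sumEFin -big_filter.
rewrite ge0_integral_sum//; first last.
  by move=> g; apply/measurable_EFinP; exact: measurable_indic.
transitivity (\sum_(g <- [seq g <- index_enum _ | g \in family F])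
   (\int[P]_x (\1_E x * \prod_(v : k.-tuple 'I_b) q (T x v) (fun i => g v i : nat) (W v x))%:E)%E)%E.
  by apply: eq_bigr => g _; rewrite integral_indicT// children_spv.
rewrite -ge0_integral_sum//; last 2 first.
- move=> g; apply/measurable_EFinP; apply: measurable_funM; first exact: measurable_history_indic hE.
  by apply: measurable_prod => v _; exact: measurable_q.
- move=> g x _; rewrite lee_fin mulr_ge0// prodr_ge0// => v _; exact: split_probv_ge0.
apply: eq_integral => x _; rewrite big_filter sumEFin; congr EFin.
by rewrite -mulr_sumr bigA_distr_big_dep.
Qed.

(** The split probabilities of the vectors with entries at most n already have sum 1. *)
Lemma ae_counts_depth k : {ae P, forall x, forall v : k.-tuple 'I_b, (T x v < n.+1)%N}.
Proof.
elim: k => [|k IH].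
  by apply: filterE => x v; rewrite (tuple0 v) (split_tree_root M).
have mD : measurable [set x | forall v : k.-tuple 'I_b, exists2 c : {ffun 'I_b -> 'I_n.+1},
     xpredT c & forall i, T x (rcons v i) = c i].
  rewrite (_ : mkset _ = [set x | forall vi : k.-tuple 'I_b * 'I_b,
      (T x (rcons vi.1 vi.2) < n.+1)%N]).
    exact: (@measurable_Tpred _ (fun vi : k.-tuple 'I_b * 'I_b => rcons vi.1 vi.2)
      (fun vi m => (m < n.+1)%N)).
  apply/seteqP; split => x /= h.
    by move=> [v i] /=; have [c _ ->] := h v; exact: ltn_ord.
  move=> v; exists [ffun i => Ordinal (h (v, i))] => // i.
  by rewrite ffunE.
have := @children_family k n.+1 setT (fun _ => xpredT) (@historyT k).
rewrite setTI => h.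
have : P [set x | forall v : k.-tuple 'I_b, exists2 c : {ffun 'I_b -> 'I_n.+1},
     xpredT c & forall i, T x (rcons v i) = c i] = 1%E.
  rewrite h; transitivity (\int[P]_x (1%R)%:E)%E.
    apply: integral_ae_eqT => //.
      apply: measurable_funM; first exact: measurable_indic.
      by apply: measurable_prod => v _; apply: measurable_sum => c; exact: measurable_q.
    apply: filterS2 ae_valid IH => x vx hx; rewrite indic_in// mul1r big1// => v _.
    by rewrite split_probv_total.
  by rewrite integral_cst// mul1e; exact: probability_setT.
move=> /(ae_prob1 mD); apply: filterS => x /= hx v.
case/tupleP: v => i v; change (T x (i :: v) < n.+1)%N.
have [w [j ->]] : exists (w : k.-tuple 'I_b) j, i :: v = rcons w j :> seq _.
  have sz : size (belast i v) == k by rewrite size_belast size_tuple.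
  by exists (Tuple sz), (last i v); rewrite /= -lastI.
by have [c _ ->] := hx w; exact: ltn_ord.
Qed.

Lemma ae_counts : {ae P, forall x, forall v, (T x v < n.+1)%N}.
Proof.
have := @ae_countable _ _ _ P nat (fun k x => forall v : k.-tuple 'I_b, (T x v < n.+1)%N)
  ae_counts_depth.
by apply: filterS => x h v; exact: (h _ (in_tuple v)).
Qed.

Definition children_on k (A : pred (k.-tuple 'I_b)) (c : node b -> 'I_b -> nat) : set Omega :=
  [set x | forall v : k.-tuple 'I_b, A v -> forall i, T x (rcons v i) = c v i].

Lemma measurable_children_on k A c : measurable (@children_on k A c).
Proof.
rewrite (_ : children_on A c = [set x | forall vi : k.-tuple 'I_b * 'I_b,
      A vi.1 -> T x (rcons vi.1 vi.2) = c vi.1 vi.2]).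
  exact: (@measurable_Tpred _ (fun vi : k.-tuple 'I_b * 'I_b => rcons vi.1 vi.2)
    (fun vi m => A vi.1 -> m = c vi.1 vi.2)).
by apply/seteqP; split => x /= h => [vi|v Av i]; [move=> Av; exact: h|exact: (h (v, i))].
Qed.

(** The split probabilities of the nodes outside A are summed out. Bounding all counts by
a number B makes these sums finite. *)
Lemma children_subset k E (A : pred (k.-tuple 'I_b)) (c : node b -> 'I_b -> nat) :
  history k E ->
  P (E `&` children_on A c) =
  (\int[P]_x (\1_E x * \prod_(v : k.-tuple 'I_b | A v) q (T x v) (c v) (W v x))%:E)%E.
Proof.
move=> hE; have mE := history_measurable hE.
pose B := (n + \sum_(v : k.-tuple 'I_b) \sum_i c v i).+1.
have cB (v : k.-tuple 'I_b) i : (c v i < B)%N.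
  rewrite ltnS (bigD1 v)//= (bigD1 i)//= addnCA -addnA.
  by rewrite leq_addr.
have nB m : (m < n.+1)%N -> (m < B)%N by move=> h; rewrite /B; lia.
pose F (v : k.-tuple 'I_b) : pred {ffun 'I_b -> 'I_B} :=
  fun d => A v ==> [forall i, d i == c v i :> nat].
transitivity (\int[P]_x (\1_E x * \prod_(v : k.-tuple 'I_b)
     \sum_(d | F v d) q (T x v) (fun i => d i : nat) (W v x))%:E)%E; last first.
  apply: integral_ae_eqT.
  - apply: measurable_funM; first exact: measurable_indic.
    apply: measurable_prod => v _; under eq_fun do rewrite -big_filter.
    by apply: measurable_sum => d; exact: measurable_q.
  - apply: measurable_funM; first exact: measurable_indic.
    under eq_fun do rewrite -big_filter.
    by apply: measurable_prod => v _; exact: measurable_q.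
  apply: filterS2 ae_valid ae_counts => x vx cx; congr (_ * _).
  rewrite [RHS]big_mkcond /=; apply: eq_bigr => v _; rewrite /F.
  case: (A v) => /=; last by rewrite (split_probv_total b_gt0 hs1)// nB.
  rewrite (big_pred1 [ffun i => Ordinal (cB v i)]).
    by congr q; apply/funext => i; rewrite ffunE.
  move=> d; apply/forallP/eqP => [h|-> i]; last by rewrite ffunE.
  by apply/ffunP => i; rewrite ffunE; apply/val_inj/eqP; exact: h.
rewrite -children_family//.
set D := [set x | _].
have DE x : (forall v, (T x v < n.+1)%N) -> D x <-> children_on A c x.
  move=> cx; split => /= h.
    move=> v Av i; have [d] := h v.
    by rewrite /F Av /= => /forallP hd ->; apply/eqP; exact: hd.
  move=> v; have cx' i : (T x (rcons v i) < B)%N by exact: nB.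
  exists [ffun i => Ordinal (cx' i)]; last by move=> i; rewrite ffunE.
  by rewrite /F; apply/implyP => Av; apply/forallP => i; rewrite ffunE /= h.
have mD : measurable D.
  rewrite (_ : D = [set x | forall vi : k.-tuple 'I_b * 'I_b, (T x (rcons vi.1 vi.2) < B)%N] `&`
     children_on A c).
    apply: measurableI; last exact: measurable_children_on.
    exact: (@measurable_Tpred _ (fun vi : k.-tuple 'I_b * 'I_b => rcons vi.1 vi.2)
      (fun vi m => (m < B)%N)).
  apply/seteqP; split => x /= h.
    split => [vi|v Av i]; first by have [d _ ->] := h vi.1; exact: ltn_ord.
    by have [d] := h v; rewrite /F Av /= => /forallP hd ->; apply/eqP; exact: hd.
  case: h => h1 h2 v; exists [ffun i => Ordinal (h1 (v, i))]; last by move=> i; rewrite ffunE.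
  by rewrite /F; apply/implyP => Av; apply/forallP => i; rewrite ffunE /= h2.
rewrite -!integral_indicT//; [|exact: measurableI|by apply: measurableI => //; exact: measurable_children_on].
apply: integral_ae_eqT.
- by apply: measurable_indic; apply: measurableI => //; exact: measurable_children_on.
- by apply: measurable_indic; exact: measurableI.
apply: filterS ae_counts => x /DE DEx.
rewrite !indic_setI; congr (_ * _); rewrite !indicE; congr (_%:R); congr nat_of_bool.
by apply/idP/idP; rewrite !inE => /DEx.
Qed.

(** The history contains the split vectors, so that the events of [children_subset] may be
replaced by functions of the split vectors. *)
Lemma children_extension k E (A : pred (k.-tuple 'I_b)) c (us : seq (node b))
    (f : node b -> b.-tuple R -> R) :
  history k E -> uniq us -> (forall u, measurable_fun setT (f u)) ->
  (forall u y, 0 <= f u y) ->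
  (\int[P]_x ((\prod_(u <- us) f u (W u x)) * (\1_E x * \1_(children_on A c) x))%:E =
   \int[P]_x ((\prod_(u <- us) f u (W u x)) *
     (\1_E x * \prod_(v : k.-tuple 'I_b | A v) q (T x v) (c v) (W v x)))%:E)%E.
Proof.
move=> hE uus mf f0; have mE := history_measurable hE.
have mch := @measurable_children_on k A c.
have mprod : measurable_fun setT
    (fun x => \prod_(v : k.-tuple 'I_b | A v) q (T x v) (c v) (W v x)).
  under eq_fun do rewrite -big_filter.
  by apply: measurable_prod => v _; exact: measurable_q.
apply: (@integral_extension_prod _ _ _ _ R (seq 'I_b) (fun u => W u) measurable_W P) => //.
- by apply: measurable_funM; exact: measurable_indic.
- by apply: measurable_funM => //; exact: measurable_indic.
- by move=> x; rewrite mulr_ge0// prodr_ge0// => v _; exact: split_probv_ge0.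
move=> B mB; have hB := @history_W k us B mB.
have prodE x : \prod_(u <- us) \1_(B u) (W u x) =
    \1_(\bigcap_(u in [set` us]) (W u @^-1` B u)) x :> R.
  have [h|h] := pselect ((\bigcap_(u in [set` us]) (W u @^-1` B u)) x).
    rewrite [RHS]indic_in// big_seq big1// => u uu; rewrite indic_in//; exact: (h u uu).
  have [u uu nu] : exists2 u, u \in us & ~ B u (W u x).
    apply: contrapT => h'; apply: h => u /= uu.
    by apply: contrapT => nB; apply: h'; exists u.
  by rewrite [RHS]indic_notin// (bigD1_seq u)//= indic_notin// mul0r.
have hEB := historyI hB hE; have mEB := history_measurable hEB.
have E1 x Z : (\prod_(u <- us) \1_(B u) (W u x)) * (\1_E x * Z) =
    \1_(\bigcap_(u in [set` us]) (W u @^-1` B u) `&` E) x * Z :> R.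
  by rewrite prodE mulrA indic_setI.
under eq_integral do rewrite E1 -indic_setI.
under [RHS]eq_integral do rewrite E1.
by rewrite integral_indicT; [exact: children_subset|exact: measurableI].
Qed.

(** The split probability averaged over the split vector. *)
Definition transition (m : nat) (c : 'I_b -> nat) : R := (\int[P0]_x q m c (V x))%R.

Lemma prod_indep (us : seq (node b)) (f : node b -> b.-tuple R -> R) : uniq us ->
  (forall u, measurable_fun setT (f u)) -> (forall u y, 0 <= f u y <= 1) ->
  (\int[P]_x (\prod_(u <- us) f u (W u x))%:E =
   (\prod_(u <- us) \int[P0]_x f u (V x))%R%:E)%E.
Proof.
move=> uus mf f01.
apply: (@integral_prod_indep _ _ _ _ _ _ R P P0 (seq 'I_b) (fun u => W u) V measurable_W) => //.
- exact: split_tree_copies M.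
- exact: split_tree_indep M.
Qed.

Lemma root_prefix (us : seq (node b)) (f : node b -> b.-tuple R -> R) m : uniq us ->
  (forall u, measurable_fun setT (f u)) -> (forall u y, 0 <= f u y <= 1) ->
  (\int[P]_x ((\prod_(u <- us) f u (W u x)) * \1_[set x | T x [::] = m] x)%:E =
   P [set x | T x [::] = m] * (\prod_(u <- us) \int[P0]_x f u (V x))%R%:E)%E.
Proof.
move=> uus mf f01; have [nm|nm] := eqVneq n m.
  have -> : [set x | T x [::] = m] = setT.
    by apply/seteqP; split => // x _ /=; rewrite (split_tree_root M).
  rewrite probability_setT mul1e -prod_indep//; apply: eq_integral => x _.
  by rewrite indic_in// mulr1.
have -> : [set x | T x [::] = m] = set0.
  by apply/seteqP; split => // x /=; rewrite (split_tree_root M) => /eqP; rewrite (negbTE nm).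
rewrite measure0 mul0e; transitivity (\int[P]_x (cst 0%E x : \bar R))%E.
  by apply: eq_integral => x _; rewrite indic_notin// mulr0.
by rewrite integral0.
Qed.

Definition child_prob (i : 'I_b) (m : nat) : R :=
  \sum_(c : {ffun 'I_b -> 'I_n.+1} | c i == m :> nat)
     transition n (fun j => c j : nat).

(** The number of balls of a child of the root is independent of the split vectors of all
proper descendants of the root: the case of [law_upto] with K = 0 that starts at a child. *)
Lemma child_prefixE (us : seq (node b)) (f : node b -> b.-tuple R -> R) i m : uniq us -> [::] \notin us ->
  (forall u, measurable_fun setT (f u)) -> (forall u y, 0 <= f u y <= 1) ->
  (\int[P]_x ((\prod_(u <- us) f u (W u x)) * \1_[set x | T x [:: i] = m] x)%:E =
   (child_prob i m * (\prod_(u <- us) \int[P0]_x f u (V x))%R)%:E)%E.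
Proof.
move=> uus nus mf f01.
have mF : measurable_fun setT (fun x => \prod_(u <- us) f u (W u x)).
  by apply: measurable_prod => u _; exact: (measurableT_comp (mf u) (@measurable_W u)).
have F0 x : 0 <= \prod_(u <- us) f u (W u x).
  by apply: prodr_ge0 => u _; case/andP: (f01 u (W u x)).
set B := n.+1; pose A0 := xpredT : pred (0.-tuple 'I_b).
pose C (c : {ffun 'I_b -> 'I_B}) := children_on A0 (fun _ j => c j : nat).
have mC c : measurable (C c) by exact: measurable_children_on.
have CE c x : C c x <-> forall j, T x [:: j] = c j.
  split=> [h j|h v _ j]; first exact: (h [tuple] isT j).
  by rewrite (tuple0 v); exact: h.
transitivity (\int[P]_x (\sum_(c <- [seq c : {ffun 'I_b -> 'I_B} <- index_enum _ | c i == m :> nat])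
   ((\prod_(u <- us) f u (W u x)) * (\1_setT x * \1_(C c) x))%:E))%E.
  under [RHS]eq_integral do rewrite sumEFin.
  apply: integral_ae_eqT.
  - by apply: measurable_funM => //; apply: measurable_indic; exact: measurable_T.
  - apply: measurable_sum => c; apply: measurable_funM => //.
    by apply: measurable_funM; exact: measurable_indic.
  apply: filterS ae_counts => x cx; rewrite -mulr_sumr big_filter; congr (_ * _).
  have cB j : (T x [:: j] < B)%N by exact: cx.
  pose c0 : {ffun 'I_b -> 'I_B} := [ffun j => Ordinal (cB j)].
  have Cc0 : C c0 x by apply/CE => j; rewrite ffunE.
  have c0P c : C c x -> c = c0.
    by move=> /CE h; apply/ffunP => j; apply/val_inj; rewrite ffunE /= h.
  have [Tm|Tm] := eqVneq (T x [:: i]) m.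
    rewrite indic_in// (bigD1 c0)/=; last by rewrite ffunE /= Tm.
    rewrite indic_in// indic_in// mul1r big1 ?addr0// => c /andP[_ /eqP cc0].
    by rewrite (@indic_notin _ _ R (C c)) ?mulr0// => /c0P.
  rewrite indic_notin; last by move=> /= /eqP; rewrite (negbTE Tm).
  rewrite big1// => c /eqP cm; rewrite (@indic_notin _ _ R (C c)) ?mulr0// => /CE /(_ i) h.
  by move: Tm; rewrite h cm eqxx.
rewrite ge0_integral_sum//; first last.
- by move=> c x _; rewrite lee_fin !mulr_ge0.
- move=> c; apply/measurable_EFinP; apply: measurable_funM => //.
  by apply: measurable_funM; exact: measurable_indic.
transitivity (\sum_(c <- [seq c : {ffun 'I_b -> 'I_B} <- index_enum _ | c i == m :> nat])
   (transition n (fun j => c j : nat) * \prod_(u <- us) (\int[P0]_x f u (V x))%R)%R%:E)%E; last first.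
  by rewrite sumEFin /child_prob mulr_suml big_filter.
apply: eq_bigr => c _.
rewrite children_extension//; [|exact: historyT|by move=> u y; case/andP: (f01 u y)].
pose f' u := if u == [::] :> seq 'I_b then q n (fun j => c j : nat) else f u.
transitivity (\int[P]_x (\prod_(u <- [::] :: us) f' u (W u x))%:E)%E.
  apply: eq_integral => x _; congr EFin; rewrite indic_in// mul1r big_cons /f' eqxx mulrC.
  congr (_ * _).
    rewrite (big_pred1 [tuple]) ?(split_tree_root M)// => v.
    by apply/esym/eqP; exact: tuple0.
  by apply: eq_big_seq => u uu; case: eqP => // u0; move: nus; rewrite -u0 uu.
rewrite prod_indep.
- rewrite big_cons /f' eqxx; congr (_ * _)%:E.
  by apply: eq_big_seq => u uu; case: eqP => // u0; move: nus; rewrite -u0 uu.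
- by rewrite /= nus.
- by move=> u; rewrite /f'; case: eqP => // _; exact: measurable_split_probv.
- by move=> u y; rewrite /f'; case: eqP => // _; rewrite split_probv_ge0 split_probv_le1.
Qed.

Lemma child_probE i m : P [set x | T x [:: i] = m] = (child_prob i m)%:E.
Proof.
have := @child_prefixE [::] (fun _ _ => 1) i m; rewrite !big_nil mulr1 => <-//.
- by under eq_integral do rewrite ?big_nil mul1r; rewrite integral_indicT//; exact: measurable_T.
- by move=> *; rewrite ler01 lexx.
Qed.

Lemma prod_prefix (w0 : node b) K (G : node b -> R) :
  \prod_(v : (size w0 + K).-tuple 'I_b | take (size w0) v == w0) G (drop (size w0) v) =
  \prod_(u : K.-tuple 'I_b) G u.
Proof.
pose h (u : K.-tuple 'I_b) : (size w0 + K).-tuple 'I_b := cat_tuple (in_tuple w0) u.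
pose h' (v : (size w0 + K).-tuple 'I_b) : K.-tuple 'I_b :=
  insubd (nseq_tuple K (Ordinal b_gt0)) (drop (size w0) v).
have h'E v : h' v = drop (size w0) v :> seq _.
  by rewrite /h' val_insubd size_drop size_tuple addKn eqxx.
have hE u : h u = w0 ++ u :> seq _ by [].
rewrite (reindex_onto h h'); last first.
  by move=> v /eqP vE; apply/val_inj; rewrite /= h'E -{2}(cat_take_drop (size w0) v) vE.
apply: eq_big => [u|u _]; last by rewrite hE drop_size_cat.
rewrite hE take_size_cat// eqxx /=.
by apply/eqP/val_inj; rewrite /= h'E hE drop_size_cat.
Qed.

(** Conditionally on all the split vectors the tree is a Markov chain along the
levels; integrating out the split vectors of one level at a time, from the
deepest one up, gives a product of annealed transition probabilities. *)
Lemma law_upto (w0 : node b) (t : btree b) K (us : seq (node b))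
    (f : node b -> b.-tuple R -> R) :
  (forall (us : seq (node b)) (f : node b -> b.-tuple R -> R) m, uniq us -> (forall u, u \in us -> (size w0 <= size u)%N) ->
    (forall u, measurable_fun setT (f u)) -> (forall u y, 0 <= f u y <= 1) ->
    (\int[P]_x ((\prod_(u <- us) f u (W u x)) * \1_[set x | T x w0 = m] x)%:E =
     P [set x | T x w0 = m] * (\prod_(u <- us) \int[P0]_x f u (V x))%R%:E)%E) ->
  uniq us -> (forall u, u \in us -> (size w0 + K <= size u)%N) ->
  (forall u, measurable_fun setT (f u)) -> (forall u y, 0 <= f u y <= 1) ->
  (\int[P]_x ((\prod_(u <- us) f u (W u x)) *
      \1_[set x | forall u, (size u <= K)%N -> T x (w0 ++ u) = t u] x)%:E =
   P [set x | T x w0 = t [::]] *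
   ((\prod_(j < K) \prod_(u : j.-tuple 'I_b) transition (t u) (fun i => t (rcons u i))) *
    \prod_(u <- us) \int[P0]_x f u (V x))%R%:E)%E.
Proof.
move=> base; elim: K us f => [|K IH] us f uus hus mf f01.
  rewrite big_ord0 mul1r -base//; last by move=> u /hus; rewrite addn0.
  apply: eq_integral => x _; congr (_ * \1__ x)%:E.
  apply/seteqP; split => y /= h; first by have := h [::] isT; rewrite cats0.
  by move=> u; rewrite leqn0 => /nilP ->; rewrite cats0.
pose k := (size w0 + K)%N.
pose A : pred (k.-tuple 'I_b) := fun v => take (size w0) v == w0.
pose c (v : node b) i := t (rcons (drop (size w0) v) i).
pose AK := [set x | forall u, (size u <= K)%N -> T x (w0 ++ u) = t u].
have hAK : history k AK by apply: history_T => u uK; rewrite size_cat leq_add2l.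
have setE : [set x | forall u, (size u <= K.+1)%N -> T x (w0 ++ u) = t u] =
    AK `&` children_on A c.
  apply/seteqP; split => x /= h.
    split => [u uK|v /eqP Av i]; first by apply: h; rewrite ltnW.
    rewrite -{1}(cat_take_drop (size w0) v) Av rcons_cat; apply: h.
    by rewrite size_rcons size_drop size_tuple /k addKn.
  case: h => h1 h2 u; rewrite leq_eqVlt => /orP[/eqP uK|]; last exact: h1.
  case/lastP: u uK => [//|u i]; rewrite size_rcons => -[uK].
  have sz : size (w0 ++ u) == k by rewrite size_cat uK.
  have := h2 (Tuple sz); rewrite /A /c /= take_size_cat// eqxx => /(_ isT i).
  by rewrite drop_size_cat// rcons_cat.
transitivity (\int[P]_x ((\prod_(u <- us) f u (W u x)) *
    (\1_AK x * \1_(children_on A c) x))%:E)%E.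
  by apply: eq_integral => x _; rewrite setE indic_setI.
rewrite children_extension//; last by move=> u y; case/andP: (f01 u y).
pose f' (u : node b) := if size u == k then q (t (drop (size w0) u)) (c u) else f u.
pose us' := [seq val v | v <- enum A] ++ us.
have f'us (g : (b.-tuple R -> R) -> node b -> R) :
    \prod_(u <- us) g (f' u) u = \prod_(u <- us) g (f u) u.
  apply: eq_big_seq => u /hus; rewrite /f' addnS => uk.
  by rewrite ifF//; apply/negbTE; rewrite neq_ltn uk orbT.
have f'A (g : (b.-tuple R -> R) -> node b -> R) :
    \prod_(u <- [seq val v | v <- enum A]) g (f' u) u =
    \prod_(v : k.-tuple 'I_b | A v) g (q (t (drop (size w0) v)) (c v)) v.
  by rewrite big_map big_enum; apply: eq_big => // v _; rewrite /f' size_tuple eqxx.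
transitivity (\int[P]_x ((\prod_(u <- us') f' u (W u x)) * \1_AK x)%:E)%E.
  apply: eq_integral => x _; congr EFin; rewrite big_cat/=.
  rewrite (f'us (fun h u => h (W u x))) (f'A (fun h u => h (W u x))).
  have [xA|xA] := pselect (AK x); last by rewrite indic_notin// mul0r !mulr0.
  rewrite indic_in// mul1r mulr1 mulrC; congr (_ * _).
  apply: eq_bigr => v /eqP Av; congr (q _ _ _).
  rewrite -{1}(cat_take_drop (size w0) v) Av; apply: xA.
  by rewrite size_drop size_tuple /k addKn.
rewrite IH.
- congr (_ * _%:E)%E; rewrite big_ord_recr -mulrA; congr (_ * _).
  rewrite big_cat (f'us (fun h _ => \int[P0]_x h (V x))%R)
    (f'A (fun h _ => \int[P0]_x h (V x))%R); congr (_ * _).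
  exact: (prod_prefix w0 K (fun u => transition (t u) (fun i => t (rcons u i)))).
- have ue : uniq [seq val v | v <- enum A] by rewrite (map_inj_uniq val_inj) enum_uniq.
  rewrite cat_uniq uus andbT ue /=.
  apply/hasPn => u /hus; rewrite addnS => uk; apply/negP => /mapP[v _ uE].
  by move: uk; rewrite uE size_tuple ltnn.
- move=> u; rewrite mem_cat => /orP[/mapP[v _ ->]|/hus]; first by rewrite size_tuple.
  by rewrite addnS => /ltnW.
- by move=> u; rewrite /f'; case: eqP => // _; exact: measurable_split_probv.
- by move=> u y; rewrite /f'; case: eqP => // _; rewrite split_probv_ge0 split_probv_le1.
Qed.

(** The probability that the first K generations agree with t, given the root. *)
Definition level_prob (t : btree b) K : R :=
  \prod_(j < K) \prod_(u : j.-tuple 'I_b) transition (t u) (fun i => t (rcons u i)).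

Lemma prob_upto_root (t : btree b) K : t [::] = n ->
  P [set x | forall u, (size u <= K)%N -> T x u = t u] = (level_prob t K)%:E.
Proof.
move=> tn; have := @law_upto [::] t K [::] (fun _ _ => 1).
have -> : P [set x | T x [::] = t [::]] = 1%E.
  rewrite (_ : [set x | _] = setT); first exact: probability_setT.
  by apply/seteqP; split => // x _ /=; rewrite (split_tree_root M).
rewrite mul1e !big_nil mulr1 => <-//.
- under eq_integral do rewrite ?big_nil mul1r.
  rewrite integral_indicT//.
  exact: (@measurable_Tpred _ id (fun u m => (size u <= K)%N -> m = t u)).
- by move=> us f m uus _ mf f01; exact: root_prefix.
- by move=> *; rewrite ler01 lexx.
Qed.

Lemma prob_upto_child i (t : btree b) K :
  P [set x | forall u, (size u <= K)%N -> T x (i :: u) = t u] =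
  (child_prob i (t [::]) * level_prob t K)%:E.
Proof.
have := @law_upto [:: i] t K [::] (fun _ _ => 1).
rewrite child_probE !big_nil mulr1 EFinM => <-//.
- under eq_integral do rewrite ?big_nil mul1r.
  rewrite integral_indicT//.
  exact: (@measurable_Tpred _ (cons i) (fun u m => (size u <= K)%N -> m = t u)).
- move=> us f m uus hus mf f01; rewrite child_prefixE ?child_probE//.
  by apply/negP => /hus.
- by move=> *; rewrite ler01 lexx.
Qed.

(** A node without balls has at most s balls, so that the split probability of the zero
vector is 1. It follows that the fringe subtree of an empty child is the empty tree. *)
Lemma ae_extinct : {ae P, forall x, forall v i, T x v = 0%N -> T x (rcons v i) = 0%N}.
Proof.
suff H : {ae P, forall x, forall v, T x v = 0%N -> forall i, T x (rcons v i) = 0%N}.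
  by apply: filterS H => x h v i /h.
apply: (@ae_countable _ _ _ P (seq 'I_b) (fun v x =>
   T x v = 0%N -> forall i, T x (rcons v i) = 0%N)) => v.
pose k := size v; pose A : pred (k.-tuple 'I_b) := fun w => w == v :> seq _.
have hE : history k [set x | T x v = 0%N].
  by apply: sub_sigma_algebra; right; exists v, 0%N.
have mE := history_measurable hE.
have mC := @measurable_children_on k A (fun _ _ => 0%N).
have h := @children_subset k _ A (fun _ _ => 0%N) hE.
set E := [set x | T x v = 0%N] in hE mE h.
have EC : P (E `&` children_on A (fun _ _ => 0%N)) = P E.
  rewrite h -(integral_indicT P mE); apply: integral_ae_eqT.
  - apply: measurable_funM; first exact: measurable_indic.
    under eq_fun do rewrite -big_filter.
    by apply: measurable_prod => w _; exact: measurable_q.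
  - exact: measurable_indic.
  apply: filterS ae_valid => x vx; have [Ex|nE] := pselect (E x); last first.
    by rewrite indic_notin// mul0r.
  rewrite indic_in// mul1r big1// => w /eqP wv; rewrite wv Ex split_probvE// /split_prob /=.
  by case: forallP => // -[] i; rewrite eqxx.
have D0 : P (E `\` children_on A (fun _ _ => 0%N)) = 0%E.
  have fE : P E \is a fin_num by exact: fin_num_measure.
  have fE' : (P E < +oo)%E by rewrite ltey_eq fE.
  transitivity (P E - P (E `&` children_on A (fun _ _ => 0%N)))%E; first exact: measureD.
  by rewrite EC subee.
have mD : measurable (E `\` children_on A (fun _ _ => 0%N)) by exact: measurableD.
apply: (negligibleS _ ((negligibleP P mD).2 D0)) => x /=.
move=> /not_implyP[Ex nC]; split => // C; apply: nC => i.
exact: (C (in_tuple v) (eqxx _) i).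
Qed.

Lemma ae_child0 i : {ae P, forall x, T x [:: i] = 0%N -> forall u, T x (i :: u) = 0%N}.
Proof.
apply: filterS ae_extinct => x h T0 u; elim/last_ind: u => // u j IH.
by rewrite -rcons_cons h.
Qed.

(** One step of the recursion: the binomial marginals of the split probabilities, averaged
over the split vector, are the intensity of the split vector applied to [binE]. *)
Lemma sum_child_prob (y : nat -> R) :
  \sum_(i < b) \sum_(m < n.+1) child_prob i m * y m =
  if (n <= s)%N then b%:R * y 0%N
  else act (intensity V) (s0 + b * s1) s1 (fun=> 1) n y.
Proof.
have mq (c : {ffun 'I_b -> 'I_n.+1}) :
    measurable_fun setT (fun x => q n (fun j => c j : nat) (V x)).
  have mV : measurable_fun setT V by exact: measurable_funP.
  exact: (measurableT_comp (measurable_split_probv (R := R) (b := b) s s0 s1 n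
    (fun j => c j : nat)) mV).
have iq (c : {ffun 'I_b -> 'I_n.+1}) r :
    P0.-integrable setT (EFin \o (fun x => q n (fun j => c j : nat) (V x) * r)).
  apply: (@bounded_integrable _ _ _ P0 _ `|r|); first by apply: measurable_funM.
  move=> x; rewrite normrM ger0_norm ?split_probv_ge0// ler_piMl//.
  exact: split_probv_le1.
have one i : \sum_(m < n.+1) child_prob i m * y m =
    (\int[P0]_x \sum_(c : {ffun 'I_b -> 'I_n.+1}) q n (fun j => c j : nat) (V x) * y (c i))%R.
  transitivity (\sum_(c : {ffun 'I_b -> 'I_n.+1}) transition n (fun j => c j : nat) * y (c i)).
    rewrite [RHS](partition_big (fun c : {ffun 'I_b -> 'I_n.+1} => c i) xpredT)//=.
    apply: eq_bigr => m _; rewrite mulr_suml.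
    by apply: eq_bigr => c /eqP ->.
  rewrite /Rintegral; apply: EFin_inj; rewrite fineK; last first.
    apply: integrable_fin_num => //.
    under eq_fun do rewrite -sumEFin.
    by apply: (@integrable_sum _ _ _ P0 setT measurableT) => c _; exact: iq.
  under eq_integral do rewrite -sumEFin.
  rewrite (@integral_sum _ _ _ P0 setT measurableT _ (fun (c : {ffun 'I_b -> 'I_n.+1}) x =>
     (q n (fun j => c j : nat) (V x) * y (c i))%:E)); last by move=> c; exact: iq.
  rewrite -sumEFin; apply: eq_bigr => c _.
  rewrite /transition -RintegralZr//; last by have := iq c 1; under eq_fun do rewrite mulr1.
  by rewrite /Rintegral fineK//; apply: integrable_fin_num => //; exact: iq.
have vclip : {ae P0, forall x, valid (V x) /\ forall i, tnth (V x) i = clip V i x}.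
  by apply: filterS2 ae_validV (coord_clip hV) => x.
have step i (F : R -> R) : measurable_fun setT (F \o clip V i) ->
    (forall x, valid (V x) -> (forall j, tnth (V x) j = clip V j x) ->
      \sum_(c : {ffun 'I_b -> 'I_n.+1}) split_prob s s0 s1 n (V x) (fun j => c j : nat) * y (c i)
      = F (clip V i x)) ->
    \sum_(m < n.+1) child_prob i m * y m = (\int[P0]_x F (clip V i x))%R.
  move=> mF hF; rewrite one; apply: ae_Rintegral => //.
    by apply: measurable_sum => c; exact: measurable_funM.
  apply: filterS vclip => x [vx cx]; rewrite -hF//.
  by apply: eq_bigr => c _; rewrite split_probvE.
case: ifPn => ns.
  transitivity (\sum_(i < b) y 0%N); last by rewrite sumr_const card_ord mulr_natl.
  apply: eq_bigr => i _; rewrite (step i (fun=> y 0%N))//.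
    rewrite Rintegral_cst// -[RHS]mulr1; congr (_ * _).
    exact: (congr1 fine (probability_setT P0)).
    exact: measurable_cst.
  by move=> x vx cx; rewrite (split_prob_sum b_gt0 hs1 (V x) i y (ltnSn n)) ns.
rewrite /act /intensity; apply: eq_bigr => i _.
rewrite (step i (fun v => 1 * binE (n - (s0 + b * s1)) (fun k => y (k + s1)%N) v))//.
  apply: (measurableT_comp (f := fun v => 1 * binE (n - (s0 + b * s1)) (fun k => y (k + s1)%N) v)).
    by apply: measurable_funM => //; exact: measurable_binE.
  exact: measurable_clip.
by move=> x vx cx; rewrite (split_prob_sum b_gt0 hs1 (V x) i y (ltnSn n)) (negbTE ns) cx mul1r.
Qed.

End model.

(** * Fringe subtrees of the children of the root *)

Section finite_trees.
Variables (R : realType) (b : nat).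
Implicit Types (t : btree b) (phi : toll R b).

(** Finite trees are coded by finite lists, hence by natural numbers, so that a random finite
tree is a discrete random variable. *)
Definition tree_of (l : seq (node b * nat)) : btree b :=
  fun v => (\sum_(p <- l | p.1 == v) p.2)%N.

Definition decode (k : nat) : btree b := if unpickle k is Some l then tree_of l else fun=> 0%N.

Lemma decode_surj t : finite_set (nodes t) -> exists k, decode k = t.
Proof.
move=> /finite_seqP[r tr]; exists (pickle [seq (v, t v) | v <- undup r]).
rewrite /decode pickleK; apply/funext => v; rewrite /tree_of big_map /= big_mkcond.
have [vr|vr] := boolP (v \in undup r).
  rewrite (bigD1_seq v)//= ?undup_uniq// eqxx big1 ?addn0// => u uv.
  by rewrite (negbTE uv).
rewrite big_seq big1 => [|u ur]; last first.
  by rewrite ifF//; apply: contraNF vr => /eqP <-.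
apply/esym/eqP; rewrite -leqn0 leqNgt; apply: contraNN vr => tv.
by rewrite mem_undup; have : nodes t v by []; rewrite tr.
Qed.

Definition code t : nat := xget 0%N [set k | decode k = t].

Lemma codeK t : finite_set (nodes t) -> decode (code t) = t.
Proof.
move=> /decode_surj[k kt]; rewrite /code; case: xgetP => [j -> //|].
by move=> /(_ k) /=.
Qed.

Lemma finite_fringe t v : finite_set (nodes t) -> finite_set (nodes (fringe t v)).
Proof.
move=> ft; apply: (@sub_finite_set _ _ (drop (size v) @` nodes t)); last exact: finite_image.
by move=> u /= tu; exists (v ++ u) => //; rewrite drop_size_cat.
Qed.

Lemma additive_seq phi t (l : seq (node b)) : uniq l ->
  (forall v, (0 < t v)%N -> v \in l) ->
  additive_functional phi t = \sum_(v <- l) (0 < t v)%N%:R * phi (fringe t v).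
Proof.
move=> ul hl; rewrite fsbig_seq// -(fsbig_widen (nodes t)).
- by apply: eq_fsbigr => v; rewrite inE /= => tv; rewrite tv mul1r.
- by move=> v /= tv; exact: hl.
- by move=> v /= [_ tv]; case: (ltnP 0 (t v)) => // _; rewrite mul0r.
Qed.

Lemma additive_rec phi t : finite_set (nodes t) ->
  additive_functional phi t = (0 < t [::])%N%:R * phi t +
    \sum_(i < b) additive_functional phi (fringe t [:: i]).
Proof.
move=> /finite_seqP[r tr]; pose l' := undup (map behead r).
have l'P i v : (0 < t (i :: v))%N -> v \in l'.
  move=> tv; rewrite mem_undup; apply/mapP; exists (i :: v) => //.
  by have : nodes t (i :: v) by []; rewrite tr.
rewrite (@additive_seq phi t ([::] :: [seq i :: v | i <- enum 'I_b, v <- l'])).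
- rewrite big_cons; congr (_ + _); rewrite big_allpairs_dep /= big_enum /=.
  apply: eq_bigr => i _; rewrite (@additive_seq phi _ l') ?undup_uniq//.
  by move=> v; exact: l'P.
- rewrite /=; apply/andP; split; first by apply/negP => /allpairsP[[i v] [_ _]].
  apply: allpairs_uniq; [exact: enum_uniq|exact: undup_uniq|].
  by move=> [i v] [j w] _ _ /= [-> ->].
- move=> [|i v] tv; first by rewrite inE.
  rewrite inE; apply/orP; right; apply/allpairsP; exists (i, v) => /=.
  by rewrite mem_enum; split => //; exact: l'P tv.
Qed.

(** Truncating the depth keeps all expectations finite, and the recursive form lets the
one-step law act on them. *)
Fixpoint additive_upto phi (K : nat) t : R :=
  if K is K'.+1 then
    (0 < t [::])%N%:R * phi t + \sum_(i < b) additive_upto phi K' (fringe t [:: i])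
  else 0.

Lemma additive_uptoE phi K t : finite_set (nodes t) ->
  (forall v, (0 < t v)%N -> (size v < K)%N) ->
  additive_upto phi K t = additive_functional phi t.
Proof.
elim: K t => [|K IH] t ft hK.
  by rewrite (@additive_seq phi t [::]) ?big_nil// => v /hK.
rewrite additive_rec//=; congr (_ + _); apply: eq_bigr => i _; apply: IH.
  exact: finite_fringe.
by move=> v tv; have := hK (i :: v) tv.
Qed.

Lemma additive_upto_ge0 phi K t : (forall t, 0 <= phi t) -> 0 <= additive_upto phi K t.
Proof.
move=> phi0; elim: K t => [//|K IH] t /=.
by rewrite addr_ge0 ?mulr_ge0// sumr_ge0.
Qed.

Lemma additive_upto_le phi K t : (forall t, 0 <= phi t) ->
  additive_upto phi K t <= additive_upto phi K.+1 t.
Proof.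
move=> phi0; elim: K t => [|K IH] t; first exact: additive_upto_ge0.
by rewrite [leLHS]/= [leRHS]/=; rewrite lerD2l ler_sum// => i _; exact: IH.
Qed.

Lemma additive_ge0 phi t : (forall t, 0 <= phi t) -> 0 <= additive_functional phi t.
Proof.
move=> phi0; rewrite /additive_functional; apply: fsumr_ge0 => v _; exact: phi0.
Qed.

Lemma additive0 phi : additive_functional phi (fun=> 0%N) = 0.
Proof. by rewrite (@additive_seq phi _ [::]) ?big_nil. Qed.

Lemma additive_upto0 phi K : additive_upto phi K (fun=> 0%N) = 0.
Proof.
by elim: K => //= K IH; rewrite mul0r add0r big1.
Qed.

Lemma additive_upto_lim phi t : finite_set (nodes t) ->
  exists K0, forall K, (K0 <= K)%N -> additive_upto phi K t = additive_functional phi t.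
Proof.
move=> ft; have /finite_seqP[r tr] := ft.
exists (\max_(v <- r) size v).+1 => K hK; apply: additive_uptoE => // v tv.
apply: leq_trans hK; rewrite ltnS; apply: (leq_bigmax_seq (P := xpredT) (F := fun v : node b => size v)) => //.
by have : nodes t v by []; rewrite tr.
Qed.

End finite_trees.

Section random_tree.
Context {d : measure_display} {Omega : measurableType d} {R : realType} {b : nat}.
Variable U : Omega -> btree b.
Hypothesis mU : forall v m, measurable [set x | U x v = m].
Hypothesis fU : forall x, finite_set (nodes (U x)).

Lemma measurable_tree t : measurable [set x | U x = t].
Proof.
rewrite (_ : [set x | _] = ~` \bigcup_v ~` [set x | U x v = t v]).
  apply: measurableC; apply: countable_bigcupT_measurable => [|v]; first exact: countableP.
  exact: measurableC.
rewrite setC_bigcup; apply/seteqP; split => x /=.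
  by move=> Ut v _ /=; rewrite Ut; apply.
by move=> h; apply/funext => v; apply: contrapT => nv; exact: (h v Logic.I).
Qed.

Lemma code_eq k : [set x | code (U x) = k] =
  if code (@decode b k) == k then [set x | U x = @decode b k] else set0.
Proof.
case: eqP => kk; apply/seteqP; split => x //=.
- by move=> <-; rewrite codeK.
- by move=> ->.
- by move=> xk; apply: kk; rewrite -xk codeK.
Qed.

Lemma measurable_code k : measurable [set x | code (U x) = k].
Proof. by rewrite code_eq; case: eqP => // _; exact: measurable_tree. Qed.

Lemma measurable_toll (h : btree b -> R) : measurable_fun setT (fun x => h (U x)).
Proof.
rewrite (_ : (fun x => _) = fun x => h (@decode b (code (U x)))); last first.
  by apply/funext => x; rewrite codeK.
exact: (@measurable_discrete _ _ _ nat (fun x => code (U x)) (fun k _ => h (@decode b k)) measurable_code).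
Qed.

Lemma measurable_fun_code : measurable_fun setT (fun x => code (U x)).
Proof.
move=> _ B _; rewrite setTI (_ : _ @^-1` B = \bigcup_k ([set x | code (U x) = k] `&` [set _ | B k])).
  apply: bigcupT_measurable => k; apply: measurableI; first exact: measurable_code.
  by have [?|?] := pselect (B k); [rewrite (_ : [set _ | _] = setT)//|
    rewrite (_ : [set _ | _] = set0)//]; apply/seteqP; split.
apply/seteqP; split => x /=; first by move=> Bx; exists (code (U x)).
by move=> [k _ [->]].
Qed.

End random_tree.

Section expectations.
Context {d0 d1 : measure_display}.
Context {S : measurableType d0} {Omega : measurableType d1} {R : realType}.
Context {P0 : probability S R} {P : probability Omega R} {b : nat}.
Variable V : {RV P0 >-> b.-tuple R}.
Hypothesis hV : split_vector V.
Variables (s s0 s1 : nat).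
Variables (W : nat -> node b -> {RV P >-> b.-tuple R}) (T : nat -> Omega -> btree b).
Hypothesis M : forall n, (1 <= n)%N -> split_tree_model V s s0 s1 n (W n) (T n).
Hypothesis b_gt0 : (0 < b)%N.
Hypothesis hs1 : (b * s1 + s0 <= s + 1)%N.
Local Notation child_prob := (child_prob V s s0 s1).

(** Up to every depth K, both probabilities are given by the same product of transition
probabilities; then K tends to infinity. *)
Lemma child_tree_prob n m i (t : btree b) : (1 <= n)%N -> (1 <= m)%N -> t [::] = m ->
  P [set x | fringe (T n x) [:: i] = t] = ((child_prob n i m)%:E * P [set x | T m x = t])%E.
Proof.
move=> n1 m1 tm.
pose A K := [set x | forall u, (size u <= K)%N -> T n x (i :: u) = t u].
pose B K := [set x | forall u, (size u <= K)%N -> T m x u = t u].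
have mA K : measurable (A K).
  exact: (measurable_Tpred (M n1) (cons i) (fun u m => (size u <= K)%N -> m = t u)).
have mB K : measurable (B K).
  exact: (measurable_Tpred (M m1) id (fun u m => (size u <= K)%N -> m = t u)).
have -> : [set x | fringe (T n x) [:: i] = t] = \bigcap_K A K.
  apply/seteqP; split => x /= h; first by move=> K _ u _; rewrite -h.
  by apply/funext => u; exact: (h (size u)).
have -> : [set x | T m x = t] = \bigcap_K B K.
  apply/seteqP; split => x /= h; first by move=> K _ u _; rewrite -h.
  by apply/funext => u; exact: (h (size u)).
have cA : P (A K) @[K --> \oo] --> P (\bigcap_K A K).
  apply: nonincreasing_cvg_mu => //.
  - by rewrite ltey_eq fin_num_measure.
  - exact: bigcapT_measurable.
  - by move=> j k jk; apply/subsetPset => x h u uj; apply: h; exact: leq_trans jk.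
have cB : P (B K) @[K --> \oo] --> P (\bigcap_K B K).
  apply: nonincreasing_cvg_mu => //.
  - by rewrite ltey_eq fin_num_measure.
  - exact: bigcapT_measurable.
  - by move=> j k jk; apply/subsetPset => x h u uj; apply: h; exact: leq_trans jk.
have E K : P (A K) = ((child_prob n i m)%:E * P (B K))%E.
  by rewrite (prob_upto_child hV (M n1))// (prob_upto_root hV (M m1))// tm EFinM.
have : ((child_prob n i m)%:E * P (B K))%E @[K --> \oo] -->
    ((child_prob n i m)%:E * P (\bigcap_K B K))%E by apply: cvgeZl.
rewrite (_ : (fun K => _) = (fun K => P (A K))); last by apply/funext => K; rewrite E.
by move=> cA'; exact: cvg_unique cA cA'.
Qed.

Lemma child_prob_ge0 n i m : (1 <= n)%N -> 0 <= child_prob n i m.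
Proof. by move=> n1; rewrite -lee_fin -(child_probE hV (M n1)). Qed.

Lemma finite_T n : (1 <= n)%N -> forall x, finite_set (nodes (T n x)).
Proof. by move=> n1 x; exact: split_tree_finite (M n1) x. Qed.

Lemma measurable_tollT n (h : btree b -> R) : (1 <= n)%N ->
  measurable_fun setT (fun x => h (T n x)).
Proof.
by move=> n1; apply: measurable_toll; [exact: measurable_T (M n1)|exact: finite_T].
Qed.

(** The conditional law of the fringe subtree of a child. Through the codes of the trees
the identity extends from single trees, treated in [child_tree_prob], to all functions. *)
Lemma child_law n m i (h : btree b -> R) : (1 <= n)%N -> (1 <= m)%N -> (forall t, 0 <= h t) ->
  (\int[P]_x (h (fringe (T n x) [:: i]) * \1_[set x | T n x [:: i] = m] x)%:E =
   (child_prob n i m)%:E * \int[P]_x (h (T m x))%:E)%E.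
Proof.
move=> n1 m1 h0; set p := child_prob n i m; have p0 : 0 <= p by exact: child_prob_ge0.
pose U x := fringe (T n x) [:: i].
have mU v k : measurable [set x | U x v = k] by exact: measurable_T (M n1) _ _.
have fU x : finite_set (nodes (U x)) by apply: finite_fringe; exact: finite_T.
have mT v k : measurable [set x | T m x v = k] by exact: measurable_T (M m1) _ _.
have fT := finite_T m1.
have mcU := measurable_fun_code mU fU; have mcT := measurable_fun_code mT fT.
have mh : measurable_fun setT (fun k => h (@decode b k)) by [].
have hU x : h (fringe (T n x) [:: i]) = h (@decode b (code (U x))) by rewrite codeK.
have hT x : h (T m x) = h (@decode b (code (T m x))) by rewrite codeK.
under eq_integral do rewrite hU.
transitivity (\int[P]_x (h (@decode b (code (T m x))) * cst p x)%:E)%E; last first.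
  under eq_integral do rewrite -hT /= mulrC EFinM.
  rewrite ge0_integralZl_EFin//.
  - by move=> x _; rewrite lee_fin.
  - by apply/measurable_EFinP; exact: measurable_tollT.
have mX : measurable_fun setT (\1_[set x | T n x [:: i] = m] : Omega -> R).
  by apply: measurable_indic; exact: measurable_T (M n1) _ _.
have X0 x : 0 <= (\1_[set x | T n x [:: i] = m] x : R) by [].
have mY : measurable_fun setT (cst p : Omega -> R) by exact: measurable_cst.
apply: (@integral_extension_indic _ _ _ _ _ _ R P P _ _ mcU mcT _ _ mX mY
  X0 (fun=> p0) (fun k => h (@decode b k))) => //.
move=> B _.
have mUB k : measurable ([set x | code (U x) = k] `&` [set x | T n x [:: i] = m]).
  by apply: measurableI; [exact: measurable_code|exact: measurable_T (M n1) _ _].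
have mTB k : measurable [set x | code (T m x) = k] by exact: measurable_code.
have -> : (\int[P]_x (\1_B (code (U x)) * \1_[set x | T n x [:: i] = m] x)%:E =
   P (\bigcup_(k in B) ([set x | code (U x) = k] `&` [set x | T n x [:: i] = m])))%E.
  rewrite -integral_indicT; last by apply: bigcup_measurable => k _.
  apply: eq_integral => x _; congr EFin.
  transitivity (\1_([set x | B (code (U x))] `&` [set x | T n x [:: i] = m]) x : R).
    by rewrite indic_setI.
  congr (\1__ x); apply/seteqP; split => y /=; first by move=> [? ?]; exists (code (U y)).
  by move=> [k Bk [-> ?]].
have -> : (\int[P]_x (\1_B (code (T m x)) * cst p x)%:E =
   p%:E * P (\bigcup_(k in B) [set x | code (T m x) = k]))%E.
  have mBT : measurable (\bigcup_(k in B) [set x | code (T m x) = k]).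
    by apply: bigcup_measurable => k _.
  under eq_integral do rewrite /= mulrC EFinM.
  rewrite ge0_integralZl_EFin//; last first.
    by apply/measurable_EFinP; apply: measurableT_comp.
  congr (_ * _)%E; rewrite -integral_indicT//; apply: eq_integral => x _; congr EFin.
  transitivity (\1_([set x | B (code (T m x))]) x : R) => //.
  congr (\1__ x); apply/seteqP; split => y /=; first by move=> ?; exists (code (T m y)).
  by move=> [k Bk ->].
rewrite measure_bigcup//; last first.
  by move=> k l _ _ [x [[<- _] [<- _]]].
rewrite measure_bigcup//; last by move=> k l _ _ [x [<- <-]].
rewrite -nneseriesZl//; apply: eq_eseriesr => k _.
rewrite (code_eq fU) (code_eq fT); case: eqP => _; last by rewrite set0I measure0 mule0.
have [tm|tm] := eqVneq (@decode b k [::]) m.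
  rewrite (_ : _ `&` _ = [set x | U x = @decode b k]); first exact: child_tree_prob.
  by apply/seteqP; split => x /= => [[]//|Ut]; split => //; rewrite -tm -Ut.
rewrite (_ : _ `&` _ = set0); last first.
  apply/seteqP; split => // x /= [Ut Tm]; move: tm; rewrite -Ut -Tm.
  by rewrite /U /fringe /= eqxx.
rewrite (_ : [set x | _] = set0) ?measure0 ?mule0//.
apply/seteqP; split => // x /= Tt; move: tm; rewrite -Tt.
by rewrite (split_tree_root (M m1)) eqxx.
Qed.

(** The law of [child_law] summed over the number m of balls of the child; an empty child
contributes h of the empty tree. *)
Lemma child_expectation n i (h : btree b -> R) (y : nat -> \bar R) : (1 <= n)%N ->
  (forall t, 0 <= h t) -> h (fun=> 0%N) = 0 -> y 0%N = 0%E ->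
  (forall m, (1 <= m)%N -> y m = (\int[P]_x (h (T m x))%:E)%E) ->
  (\int[P]_x (h (fringe (T n x) [:: i]))%:E =
   \sum_(m < n.+1) (child_prob n i m)%:E * y m)%E.
Proof.
move=> n1 h0 hz y0 hy.
have mUn : measurable_fun setT (fun x => h (fringe (T n x) [:: i])).
  exact: (measurable_tollT (fun t => h (fringe t [:: i])) n1).
have mI m : measurable [set x | T n x [:: i] = m] by exact: measurable_T (M n1) _ _.
transitivity (\int[P]_x (\sum_(m < n.+1)
   (h (fringe (T n x) [:: i]) * \1_[set x | T n x [:: i] = m] x)%:E))%E.
  under [RHS]eq_integral do rewrite sumEFin.
  apply: integral_ae_eqT => //.
    by apply: measurable_sum => m; apply: measurable_funM => //; exact: measurable_indic.
  apply: filterS (ae_counts hV (M n1) b_gt0 hs1) => x cx; rewrite -mulr_sumr.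
  rewrite (bigD1 (Ordinal (cx [:: i])))//= indic_in// big1 ?addr0 ?mulr1// => m mi.
  by rewrite indic_notin// => /= Tm; move: mi; rewrite -val_eqE /= Tm eqxx.
rewrite ge0_integral_sum//; first last.
- by move=> m x _; rewrite lee_fin mulr_ge0.
- by move=> m; apply/measurable_EFinP; apply: measurable_funM => //; exact: measurable_indic.
apply: eq_bigr => -[[|m] mn] _ /=; last by rewrite child_law// hy.
rewrite y0 mule0; transitivity (\int[P]_x (cst 0%R x)%:E)%E; last first.
  by rewrite integral0.
apply: integral_ae_eqT => //.
  by apply: measurable_funM => //; exact: measurable_indic.
apply: filterS (ae_child0 hV (M n1) b_gt0 hs1 i) => x hx.
have [T0|T0] := eqVneq (T n x [:: i]) 0%N.
  rewrite (_ : fringe _ _ = fun=> 0%N) ?hz ?mul0r//.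
  by apply/funext => u; exact: hx.
by rewrite indic_notin ?mulr0//; apply/eqP.
Qed.

End expectations.

(** * Expectations of additive functionals *)

Section iterates.
Variables (R : realType) (I : (R -> R) -> R) (beta : R).
Hypothesis rk : renewal_kernel I beta.
Hypothesis beta1 : beta <= 1.
Variables (s c s1 : nat).
Hypothesis s_ge1 : (1 <= s)%N.
Hypothesis cs : (c <= s.+1)%N.
Hypothesis s1c : (s1 <= c)%N.
Hypothesis s1c0 : s1 = c -> c = 0%N.
Let w1 := weight1 R.

(** Otherwise the indicator of n would contradict the maximum principle. *)
Lemma self_loop_lt1 n : (s < n)%N -> act I c s1 (fun=> 1) n (fun m => (m == n)%:R) < 1.
Proof.
move=> sn; rewrite ltNge; apply/negP => h.
have : (n == n)%:R <= 0 :> R; last by rewrite eqxx ler10.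
apply: (@act_comparison _ _ _ rk beta1 _ _ _ s_ge1 cs s1c s1c0 (fun=> 1)
    (fun m => (m == n)%:R) n n w1 sn) => [m mn|m]; first by rewrite ltn_eqF.
by rewrite -eqn_leq => /eqP <-; rewrite eqxx.
Qed.

(** Strong induction on n: the expectation at n feeds back into itself with a coefficient less
than 1, which bounds it by the toll and the bounds at smaller numbers of balls. *)
Lemma iterates_bounded (phi : nat -> R) (y : nat -> nat -> R) :
  (forall K, y K 0%N = 0) -> (forall K n, y K n <= y K.+1 n) ->
  (forall K n, (1 <= n)%N ->
    y K.+1 n = phi n + (if (n <= s)%N then 0 else act I c s1 (fun=> 1) n (y K))) ->
  forall n, exists B, forall K, y K n <= B.
Proof.
move=> y0 ymono yrec n.
suff H N : exists B, 0 <= B /\ forall K m, (m < N)%N -> y K m <= B.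
  by have [B [_ hB]] := H n.+1; exists B => K; exact: hB.
elim: N => [|N [B [B0 hB]]]; first by exists 0.
suff [C hC] : exists C, forall K, y K N <= C.
  exists (Num.max B C); split; first by rewrite le_max B0.
  move=> K m; rewrite ltnS leq_eqVlt => /orP[/eqP ->|/hB h].
    by rewrite le_max hC orbT.
  by rewrite le_max h.
case: N hB => [|N'] hB; first by exists 0 => K; rewrite y0.
set N := N'.+1 in hB *.
have [Ns|sN] := leqP N s.
  by exists (phi N) => K; apply: le_trans (ymono K N) _; rewrite yrec// Ns addr0.
pose p := act I c s1 (fun=> 1) N (fun m => (m == N)%:R).
have p1 : p < 1 by exact: self_loop_lt1.
pose a := act I c s1 (fun=> 1) N (fun=> B).
exists ((phi N + a) / (1 - p)) => K.
rewrite ler_pdivlMr ?subr_gt0// mulrBr mulr1 lerBlDr.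
apply: le_trans (ymono K N) _; rewrite yrec// leqNgt sN /= -addrA lerD2l.
rewrite /p -(actZ rk)// /a -(actD rk)//.
apply: (act_le rk) => // m hm.
have mN : (m <= N)%N.
  have cN : (c <= N)%N by exact: leq_trans sN.
  by apply: leq_trans hm _; move: s1c cN; lia.
have [->|mn] := eqVneq m N; first by rewrite mulr1 lerDr.
by rewrite mulr0 addr0; apply: hB; rewrite ltn_neqAle mn.
Qed.

End iterates.

Lemma shift_le (b s s0 s1 : nat) : (1 < b)%N -> (1 <= s)%N -> (b * s1 + s0 <= s + 1)%N ->
  [/\ (s0 + b * s1 <= s.+1)%N, (s1 <= s0 + b * s1)%N &
      s1 = (s0 + b * s1)%N -> (s0 + b * s1)%N = 0%N].
Proof.
move=> b_gt1 s_ge1 hs1.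
have h : (s1 + s1 <= b * s1)%N by rewrite addnn -mul2n leq_mul2r b_gt1 orbT.
by split; move: hs1 h; lia.
Qed.

Section additive_expectations.
Context {d0 d1 : measure_display}.
Context {S : measurableType d0} {Omega : measurableType d1} {R : realType}.
Context {P0 : probability S R} {P : probability Omega R} {b : nat}.
Variable V : {RV P0 >-> b.-tuple R}.
Hypothesis hV : split_vector V.
Variables (s s0 s1 : nat).
Variables (W : nat -> node b -> {RV P >-> b.-tuple R}) (T : nat -> Omega -> btree b).
Hypothesis M : forall n, (1 <= n)%N -> split_tree_model V s s0 s1 n (W n) (T n).
Hypothesis b_gt1 : (1 < b)%N.
Hypothesis s_ge1 : (1 <= s)%N.
Hypothesis hs1 : (b * s1 + s0 <= s + 1)%N.
Variable beta : R.
Hypothesis rk : renewal_kernel (intensity V) beta.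
Hypothesis beta1 : beta <= 1.
Let c := (s0 + b * s1)%N.
Let b_gt0 : (0 < b)%N := ltnW b_gt1.
Local Notation act1 := (act (intensity V) c s1 (fun=> 1)).
Local Notation split_solution := (split_solution (intensity V) s c s1).

Definition mean (phi : toll R b) (m : nat) : R := fine ('E_P[phi \o T m])%E.

Lemma integral_toll (phi : toll R b) m : (1 <= m)%N ->
  P.-integrable setT (EFin \o (phi \o T m)) ->
  (\int[P]_x (phi (T m x))%:E)%E = (mean phi m)%:E.
Proof.
by move=> m1 ip; rewrite /mean unlock fineK//; exact: integrable_fin_num.
Qed.

Section nonnegative_toll.
Variable phi : toll R b.
Hypothesis phi0 : forall t, 0 <= phi t.
Hypothesis iphi : forall m, (1 <= m)%N -> P.-integrable setT (EFin \o (phi \o T m)).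

(** With G = H = the additive functional this is the recursion of the expectations; with G and
H the contributions of the first K and K + 1 generations, that of their approximations. *)
Lemma one_step_expectation (G H : btree b -> R) (y : nat -> R) n : (1 <= n)%N ->
  (forall t, 0 <= G t) -> G (fun=> 0%N) = 0 -> y 0%N = 0 ->
  (forall m, (1 <= m)%N -> (\int[P]_x (G (T m x))%:E)%E = (y m)%:E) ->
  (forall x, H (T n x) = (0 < T n x [::])%N%:R * phi (T n x) +
     \sum_(i < b) G (fringe (T n x) [:: i])) ->
  (\int[P]_x (H (T n x))%:E)%E =
    (mean phi n + (if (n <= s)%N then 0 else act1 n y))%:E.
Proof.
move=> n1 G0 Gz y0 Gy HE.
have mG i : measurable_fun setT (fun x => G (fringe (T n x) [:: i])).
  exact: (measurable_tollT M (fun t => G (fringe t [:: i])) n1).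
transitivity (\int[P]_x ((phi (T n x))%:E + \sum_(i < b) (G (fringe (T n x) [:: i]))%:E))%E.
  by apply: eq_integral => x _; rewrite HE (split_tree_root (M n1)) n1 mul1r EFinD sumEFin.
rewrite ge0_integralD//; first last.
- under eq_fun do rewrite sumEFin.
  by apply/measurable_EFinP; exact: measurable_sum.
- by move=> x _; rewrite sume_ge0// => i _; rewrite lee_fin.
- by apply/measurable_EFinP; exact: (measurable_tollT M phi n1).
- by move=> x _; rewrite lee_fin.
rewrite integral_toll//; last exact: iphi.
rewrite EFinD; congr (_ + _)%E.
rewrite ge0_integral_sum//; first last.
- by move=> i x _; rewrite lee_fin.
- by move=> i; exact/measurable_EFinP.
have e := sum_child_prob hV n b_gt0 hs1 y.
rewrite y0 mulr0 in e; rewrite -e -sumEFin; apply: eq_bigr => i _.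
rewrite (@child_expectation _ _ _ _ _ _ _ _ V hV _ _ _ _ _ M b_gt0 hs1 n i G (EFin \o y))//.
- by rewrite -sumEFin; apply: eq_bigr => m _.
- by rewrite /= y0.
- by move=> m m1; rewrite Gy.
Qed.

Let y K n : R := if n == 0%N then 0 else fine (\int[P]_x (additive_upto phi K (T n x))%:E)%E.

Lemma integral_upto K n : (1 <= n)%N ->
  (\int[P]_x (additive_upto phi K (T n x))%:E)%E = (y K n)%:E.
Proof.
elim: K n => [|K IH] n n1; first by rewrite /y gtn_eqF//= integral0.
rewrite {1}/y gtn_eqF//.
rewrite (@one_step_expectation (additive_upto phi K) _ (y K) n)//.
- by move=> t; exact: additive_upto_ge0.
- exact: additive_upto0.
Qed.

Lemma upto_rec K n : (1 <= n)%N ->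
  y K.+1 n = mean phi n + (if (n <= s)%N then 0 else act1 n (y K)).
Proof.
move=> n1; apply: EFin_inj; rewrite -integral_upto//.
apply: (@one_step_expectation (additive_upto phi K)) => //.
- by move=> t; exact: additive_upto_ge0.
- exact: additive_upto0.
- by move=> m m1; exact: integral_upto.
Qed.

(** Monotone convergence in the depth of truncation, with the bounds of [iterates_bounded]. *)
Lemma additive_finite n : (1 <= n)%N ->
  (\int[P]_x (additive_functional phi (T n x))%:E)%E \is a fin_num.
Proof.
move=> n1; have [cs s1c s1c0] := shift_le b_gt1 s_ge1 hs1.
have mU K : measurable_fun setT (fun x => additive_upto phi K (T n x)).
  exact: (measurable_tollT M (additive_upto phi K) n1).
have ymono K m : y K m <= y K.+1 m.
  case: m => [|m]; first by rewrite /y eqxx.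
  rewrite -lee_fin -!integral_upto//; apply: ge0_le_integral => //.
  - by move=> x _; rewrite lee_fin; exact: additive_upto_ge0.
  - by apply/measurable_EFinP; exact: (measurable_tollT M (additive_upto phi K)).
  - by apply/measurable_EFinP; exact: (measurable_tollT M (additive_upto phi K.+1)).
  - by move=> x _; rewrite lee_fin; exact: additive_upto_le.
have [B hB] := @iterates_bounded R (intensity V) beta rk beta1 s c s1 s_ge1 cs s1c s1c0
  (mean phi) y (fun=> erefl) ymono upto_rec n.
have E : (\int[P]_x (additive_functional phi (T n x))%:E =
    limn (fun K => \int[P]_x (additive_upto phi K (T n x))%:E))%E.
  rewrite -monotone_convergence//.
  - apply: eq_integral => x _; apply/esym/cvg_lim => //.
    have [K0 hK0] := additive_upto_lim phi (finite_T M n1 x).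
    apply: cvg_near_cst; exists K0 => // K /= hK; by rewrite hK0.
  - by move=> K; exact/measurable_EFinP.
  - by move=> K x _; rewrite lee_fin; exact: additive_upto_ge0.
  - move=> x _; apply/nondecreasing_seqP => K; rewrite lee_fin; exact: additive_upto_le.
have ge0 : (0 <= \int[P]_x (additive_functional phi (T n x))%:E)%E.
  by apply: integral_ge0 => x _; rewrite lee_fin; exact: additive_ge0.
rewrite ge0_fin_numE// E; apply: (@le_lt_trans _ _ B%:E); last exact: ltry.
apply: lime_le; last by apply: nearW => K; rewrite integral_upto// lee_fin.
apply: ereal_nondecreasing_is_cvgn; apply/nondecreasing_seqP => K.
by rewrite !integral_upto// lee_fin.
Qed.

Lemma integrable_additive_ge0 n : (1 <= n)%N ->
  P.-integrable setT (EFin \o (additive_functional phi \o T n)).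
Proof.
move=> n1; have mX : measurable_fun setT (fun x => additive_functional phi (T n x)).
  exact: (measurable_tollT M (additive_functional phi) n1).
apply/integrableP; split; first exact/measurable_EFinP.
under eq_integral do rewrite /= ger0_norm ?additive_ge0//.
by have := additive_finite n1; rewrite ge0_fin_numE// integral_ge0// => x _;
  rewrite lee_fin additive_ge0.
Qed.

(** The positive and the negative part of the toll are treated separately. *)
Lemma additive_solution_ge0 : split_solution (mean phi)
  (fun n => if n == 0%N then 0 else mean (additive_functional phi) n).
Proof.
split=> // n n1; rewrite {1}gtn_eqF//; apply: EFin_inj.
rewrite -integral_toll//; last exact: integrable_additive_ge0.
apply: (@one_step_expectation (additive_functional phi)) => //.
- by move=> t; exact: additive_ge0.
- exact: additive0.
- move=> m m1; rewrite gtn_eqF// integral_toll//; exact: integrable_additive_ge0.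
- by move=> x; rewrite additive_rec//; exact: (finite_T M n1 x).
Qed.

End nonnegative_toll.

Lemma additiveB (phi psi : toll R b) t : finite_set (nodes t) ->
  additive_functional (fun t => phi t - psi t) t =
  additive_functional phi t - additive_functional psi t.
Proof.
move=> /finite_seqP[r tr].
have hr v : (0 < t v)%N -> v \in undup r.
  by move=> tv; rewrite mem_undup; have : nodes t v by []; rewrite tr.
rewrite !(@additive_seq _ _ _ t (undup r)) ?undup_uniq// -sumrB.
by apply: eq_bigr => v _; rewrite mulrBr.
Qed.

Lemma additive_solution (phi : toll R b) :
  (forall m, (1 <= m)%N -> P.-integrable setT (EFin \o (phi \o T m))) ->
  exists2 x, split_solution (mean phi) x &
    forall n, (1 <= n)%N -> 'E_P[additive_functional phi \o T n]%E = (x n)%:E.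
Proof.
move=> iphi.
pose pp : toll R b := fun t => Num.max (phi t) 0.
pose pn : toll R b := fun t => Num.max (- phi t) 0.
have pE t : phi t = pp t - pn t.
  rewrite /pp /pn; case: (lerP (phi t) 0) => h.
    by rewrite max_l ?oppr_ge0// sub0r opprK.
  by rewrite max_r ?subr0// oppr_le0 ltW.
have pp0 t : 0 <= pp t by rewrite le_max lexx orbT.
have pn0 t : 0 <= pn t by rewrite le_max lexx orbT.
have dom (q : toll R b) m : (1 <= m)%N -> (forall t, `|q t| <= `|phi t|) ->
    P.-integrable setT (EFin \o (q \o T m)).
  move=> m1 hq; apply: le_integrable (iphi m m1) => //.
    by apply/measurable_EFinP; exact: (measurable_tollT M q m1).
  by move=> x _; rewrite /= lee_fin.
have ip m : (1 <= m)%N -> P.-integrable setT (EFin \o (pp \o T m)).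
  move=> m1; apply: dom => // t; rewrite ger0_norm// /pp ge_max normr_ge0 andbT.
  exact: ler_norm.
have iN m : (1 <= m)%N -> P.-integrable setT (EFin \o (pn \o T m)).
  move=> m1; apply: dom => // t; rewrite ger0_norm// /pn ge_max normr_ge0 andbT.
  by rewrite -normrN ler_norm.
have diff (F G H : toll R b) m : (1 <= m)%N ->
    P.-integrable setT (EFin \o (F \o T m)) -> P.-integrable setT (EFin \o (G \o T m)) ->
    (forall x, H (T m x) = F (T m x) - G (T m x)) ->
    'E_P[H \o T m]%E = (mean F m - mean G m)%:E.
  move=> m1 iF iG HE; rewrite unlock EFinB -!integral_toll//.
  rewrite -(integralB measurableT iF iG).
  by apply: eq_integral => x _ /=; rewrite HE EFinB.
have sp := additive_solution_ge0 pp0 ip; have sn := additive_solution_ge0 pn0 iN.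
exists (fun n => (if n == 0%N then 0 else mean (additive_functional pp) n) -
   (if n == 0%N then 0 else mean (additive_functional pn) n)).
  have [e0 e1] := split_solutionB rk sp sn; split => // n n1; rewrite e1//.
  by congr (_ + _); rewrite /mean -/(mean pp n) -/(mean pn n) (diff pp pn phi n)//; [exact: ip|exact: iN].
move=> n n1; rewrite gtn_eqF//; apply: diff => //.
- exact: integrable_additive_ge0.
- exact: integrable_additive_ge0.
- move=> x; rewrite -additiveB; last exact: (finite_T M n1 x).
  by congr additive_functional; apply/funext => t; exact: pE.
Qed.

End additive_expectations.

(** * The asymptotic expansion *)

Section solution_limit.
Variables (R : realType) (I : (R -> R) -> R) (beta : R).
Hypothesis rk : renewal_kernel I beta.
Hypothesis beta1 : beta <= 1.
Variables (s c s1 : nat).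
Hypothesis s_ge1 : (1 <= s)%N.
Hypothesis cs : (c <= s.+1)%N.
Hypothesis s1c : (s1 <= c)%N.
Hypothesis s1c0 : s1 = c -> c = 0%N.
Local Notation split_solution := (split_solution I s c s1).
Variables (phi : nat -> R) (Cphi delta : R) (nphi : nat).
Hypothesis delta0 : 0 < delta.
Hypothesis Cphi0 : 0 <= Cphi.
Hypothesis phi_le : forall n, (nphi <= n)%N -> `|phi n| <= Cphi * n%:R `^ (beta - delta).
Variable x : nat -> R.
Hypothesis sol : split_solution phi x.
Hypothesis sol_trunc : forall M, exists x',
  split_solution (fun n => phi n * (n < M)%N%:R) x'.

(** [solution_regular] provides the hypotheses of [periodic_limit]. For the lower bound the
periodic function is evaluated at large arguments, where it is close to the solution. *)
Lemma solution_limit (L : R -> Prop) (d : R) : walk_orbits I beta L -> 0 < d ->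
  (forall k : nat, L (expR (d * k%:R))) ->
  exists varpi : R -> R,
  [/\ [/\ exists G, forall z, `|varpi z| <= G, continuous varpi &
          forall z, varpi (z + d) = varpi z],
      forall e, 0 < e -> exists N, forall n, (N <= n)%N ->
        `|x n - varpi (ln n%:R) * n%:R `^ beta| <= e * n%:R `^ beta,
      (forall a, 0 < a -> L a) -> exists w, forall z, varpi z = w &
      (forall n, (1 <= n)%N -> 0 <= phi n) ->
      (exists m, [/\ (1 <= m)%N, (s1 <= m)%N & 0 < phi m]) ->
      exists w, 0 < w /\ forall z, w <= varpi z].
Proof.
move=> wo dgt0 Ld; have b0 : 0 < beta := rk_beta0 rk.
have [[G hG] hC hU] := solution_regular rk beta1 s_ge1 cs s1c s1c0 delta0 Cphi0 phi_le
  sol sol_trunc wo.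
have [varpi [vG vc vd vlim vcst]] := periodic_limit dgt0 hG Ld hC hU.
have natE n : (1 <= n)%N -> x n = normalized beta (extend x) n%:R * n%:R `^ beta.
  move=> n1; rewrite /normalized /extend natrK mulfVK// gt_eqF// powR_gt0//.
  by rewrite ltr0n.
exists varpi; split.
- by split => //; exists G.
- move=> e e0; have [Tm [Tm0 hTm]] := vlim e e0.
  exists (Num.truncn Tm).+1 => n hn.
  have n1 : (1 <= n)%N by exact: leq_trans hn.
  have Tn : Tm <= n%:R.
    by apply: ltW; apply: lt_le_trans (truncnS_gt Tm) _; rewrite ler_nat.
  rewrite natE// -mulrBl normrM (ger0_norm (powR_ge0 _ _)) ler_wpM2r ?powR_ge0//.
  exact: hTm.
- exact: vcst.
move=> phi0 [m [m1 s1m phim]].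
have [e [n1 [e0 he]]] := solution_lower_bound rk beta1 s_ge1 cs s1c s1c0 sol phi0 m1 s1m phim.
pose w := e * 2^-1 `^ beta.
have w0 : 0 < w by rewrite mulr_gt0// powR_gt0// invr_gt0.
have w20 : 0 < w / 2 by rewrite divr_gt0.
have [Tm [Tm0 hTm]] := vlim (w / 2) w20.
exists (w / 2); split=> // z.
have vk (k : nat) : varpi (z + d * k%:R) = varpi z.
  elim: k => [|k IH]; first by rewrite mulr0 addr0.
  by rewrite -natr1 mulrDr mulr1 addrA vd IH.
pose T0 := Num.max Tm (n1%:R + 2).
have [k hk] : exists k : nat, T0 <= expR (z + d * k%:R).
  exists (Num.truncn ((T0 - z) / d)).+1; apply: le_trans (expR_ge1Dx _).
  have := truncnS_gt ((T0 - z) / d); rewrite ltr_pdivrMr// mulrC => h.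
  by move: h; set u := d * _; lra.
set t := expR _ in hk; have := hTm t; move: hk; rewrite ge_max => /andP[Tt nt].
move=> /(_ Tt); rewrite /t expRK vk => hv.
have t0 : 0 < t by exact: expR_gt0.
have [tr1 tr2] := truncn_bounds (ltW t0).
have n1t : (n1 <= Num.truncn t)%N.
  by rewrite -(ler_nat R); move: nt tr2; lra.
have gt : w <= normalized beta (extend x) t.
  rewrite /normalized ler_pdivlMr ?powR_gt0// /w -mulrA -powRM ?invr_ge0 ?(ltW t0)//.
  apply: le_trans (he _ n1t); rewrite ler_pM2l// ge0_ler_powR ?nnegrE ?(ltW b0)//.
    by rewrite mulr_ge0// ltW.
  by move: nt tr2; have : 0 <= n1%:R :> R by []; lra.
by move: hv; rewrite ler_norml => /andP[_]; move: gt; rewrite /t; lra.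
Qed.

End solution_limit.

Section toll_means.
Context {d1 : measure_display} {Omega : measurableType d1} {R : realType}.
Context {P : probability Omega R} {b : nat}.
Variable T : nat -> Omega -> btree b.
Hypothesis mT : forall n (h : toll R b), (1 <= n)%N -> measurable_fun setT (fun x => h (T n x)).
Hypothesis rootT : forall n x, (1 <= n)%N -> T n x [::] = n.

Lemma mean_truncated (phi : toll R b) M n : (1 <= n)%N ->
  mean (P := P) T (fun t => phi t * (t [::] < M)%N%:R) n = mean (P := P) T phi n * (n < M)%N%:R.
Proof.
move=> n1; rewrite /mean unlock.
case: (ltnP n M) => nM; rewrite ?mulr1 ?mulr0.
  by congr fine; apply: eq_integral => x _ /=; rewrite rootT// nM mulr1.
transitivity (fine (\int[P]_x (cst 0%E x : \bar R))%E); last by rewrite integral0.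
by congr fine; apply: eq_integral => x _ /=; rewrite rootT// ltnNge nM mulr0.
Qed.

Lemma integrable_truncated (phi : toll R b) M n : (1 <= n)%N ->
  P.-integrable setT (EFin \o (phi \o T n)) ->
  P.-integrable setT (EFin \o ((fun t => phi t * (t [::] < M)%N%:R) \o T n)).
Proof.
move=> n1 ip; apply: le_integrable ip => //.
  apply/measurable_EFinP.
  exact: (@mT n (fun t => phi t * (t [::] < M)%N%:R) n1).
move=> x _ /=; rewrite lee_fin normrM ler_piMr// normr_nat.
by case: (_ < _)%N; rewrite ?ler01 ?lexx.
Qed.

Lemma bounded_toll_integrable (phi : toll R b) : (forall t, 0 <= phi t <= 1) ->
  forall n, (1 <= n)%N -> P.-integrable setT (EFin \o (phi \o T n)).
Proof.
move=> phi01 n n1; apply: (@bounded_integrable _ _ _ P _ 1); first exact: mT.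
by move=> x /=; have /andP[h0 h1] := phi01 (T n x); rewrite ger0_norm.
Qed.

(** A bounded toll is O(n^(beta - delta)) with delta = beta. *)
Lemma bounded_toll_mean (phi : toll R b) (beta : R) : (forall t, 0 <= phi t <= 1) ->
  mean (P := P) T phi =O_\oo (fun n : nat => n%:R `^ (beta - beta)).
Proof.
move=> phi01; apply/eqO_exP; exists 1 => //; exists 1%N => // n /= n1.
rewrite subrr powRr0 normr1 mulr1.
have ip := bounded_toll_integrable phi01 n1.
rewrite -lee_fin /mean unlock ger0_norm; last first.
  by apply: fine_ge0; apply: integral_ge0 => x _; rewrite lee_fin; case/andP: (phi01 (T n x)).
rewrite fineK; last exact: integrable_fin_num.
apply: (@le_trans _ _ (\int[P]_x (cst 1%E x))%E).
  apply: ge0_le_integral => //.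
  - by move=> x _; rewrite lee_fin; case/andP: (phi01 (T n x)).
  - by apply/measurable_EFinP; exact: mT.
  - by move=> x _; rewrite lee_fin; case/andP: (phi01 (T n x)).
by rewrite integral_cst// mul1e; exact: probability_le1.
Qed.

End toll_means.

Theorem theorem2p1
  (R : realType)
  (b s s0 s1 : nat)
  (hb : (2 <= b)%N) (hs : (1 <= s)%N) (hs1 : (b * s1 + s0 <= s + 1)%N)
  (d0 : measure_display) (S : measurableType d0) (P0 : probability S R)
  (V : {RV P0 >-> b.-tuple R}) (hV : split_vector V)
  (beta : R) (hbeta0 : 0 < beta) (hbeta1 : beta <= 1)
  (hbeta : 'E_P0[(fun x => \sum_(i < b) tnth (V x) i `^ beta)%R]%E = 1%E)
  (d : R) (hd : is_span V d)
  (d1 : measure_display) (Omega : measurableType d1) (P : probability Omega R)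
  (W : nat -> node b -> {RV P >-> b.-tuple R})
  (T : nat -> Omega -> btree b)
  (hT : forall n, (1 <= n)%N -> split_tree_model V s s0 s1 n (W n) (T n)) :
  let integrable_toll (phi : toll R b) :=
    forall m, (1 <= m)%N -> P.-integrable setT (EFin \o (phi \o T m)) in
  let mean (phi : toll R b) (m : nat) : R := fine ('E_P[phi \o T m])%E in
  let admissible (phi : toll R b) :=
    integrable_toll phi /\
    exists delta : R, 0 < delta /\
      mean phi =O_\oo (fun n : nat => n%:R `^ (beta - delta)) in
  [/\ forall phi : toll R b, admissible phi ->
        exists varpi : R -> R,
        [/\ [/\ exists M : R, forall x, `|varpi x| <= M,
                continuous varpi &
                forall x, varpi (x + d) = varpi x],
            exists err : nat -> R,
              err =o_\oo (fun n : nat => n%:R `^ beta) /\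
              forall n, (1 <= n)%N ->
                'E_P[additive_functional phi \o T n]%E =
                (varpi (ln n%:R) * n%:R `^ beta + err n)%:E,
            ~ lattice V -> exists c : R, forall x, varpi x = c &
            (forall n, (1 <= n)%N -> 0 <= mean phi n) ->
            (exists n, [/\ (1 <= n)%N, (s1 <= n)%N & 0 < mean phi n]) ->
            exists c : R, 0 < c /\ forall x, c <= `|varpi x| ],
      [/\ admissible (@toll_leaf R b),
          admissible (@toll_one R b) &
          forall k, (1 <= k)%N -> admissible (@toll_delta R b k)] &
      {ae P0, forall x, \sum_(i < b) tnth (V x) i = 1} -> beta = 1].
Proof.
move=> integrable_toll mean admissible.
have b_gt0 : (0 < b)%N by exact: ltnW.
have rk := intensity_renewal_kernel hV b_gt0 hbeta0 hbeta.
have [cs s1c s1c0] := shift_le hb hs hs1.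
have mT n (h : toll R b) : (1 <= n)%N -> measurable_fun setT (fun x => h (T n x)).
  by move=> n1; exact: (measurable_tollT hT h n1).
have rootT n x : (1 <= n)%N -> T n x [::] = n.
  by move=> n1; exact: split_tree_root (hT n n1) x.
have adm01 (phi : toll R b) : (forall t, 0 <= phi t <= 1) -> admissible phi.
  move=> phi01; split; first exact: (bounded_toll_integrable (P := P) mT phi01).
  by exists beta; split => //; exact: (bounded_toll_mean (P := P) mT beta phi01).
split; last exact: (beta_split_tree hV b_gt0 hbeta0 hbeta1 hbeta).
- move=> phi [iphi [delta [delta0 /eqO_exP[C C0 [N _ hN]]]]].
  have [x sol Ex] := additive_solution hV hT hb hs hs1 rk hbeta1 iphi.
  have sol_trunc K : exists x', split_solution (intensity V) s (s0 + b * s1) s1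
      (fun n => mean phi n * (n < K)%N%:R) x'.
    have [x' [e0 e1] _] := additive_solution hV hT hb hs hs1 rk hbeta1
      (fun m m1 => integrable_truncated mT K m1 (iphi m m1)).
    exists x'; split => // n n1; rewrite e1//; congr (_ + _).
    exact: (mean_truncated (P := P) rootT phi K n1).
  have phi_le n : (N <= n)%N -> `|mean phi n| <= C * n%:R `^ (beta - delta).
    by move=> Nn; have := hN n Nn; rewrite /= (ger0_norm (powR_ge0 _ _)).
  (* in the nonlattice case every period will do, and d = 0 is a period anyway *)
  have [L [d' [wo d'0 Ld' dd' Lall]]] : exists L d', [/\ walk_orbits (intensity V) beta L,
      0 < d', forall k : nat, L (expR (d' * k%:R)),
      d = d' \/ d = 0 & ~ lattice V -> forall a, 0 < a -> L a].
    case: hd => [[dgt0 dlat dmax]|[nlat dE]].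
      exists (fun a => exists k : int, a = expR (d * k%:~R)), d; split => //.
      - exact: walk_orbits_lattice.
      - by move=> k; exists k%:Z; rewrite -pmulrn.
      - by left.
      - by move=> nlat; exfalso; apply: nlat; exists d.
    exists (fun a => 0 < a), 1; split => //.
    - exact: walk_orbits_nonlattice.
    - by right.
  have [varpi [[vG vc vd] vlim vcst vpos]] := solution_limit rk hbeta1 hs cs s1c s1c0 delta0
    (ltW C0) phi_le sol sol_trunc wo d'0 Ld'.
  exists varpi; split.
  + by split => // z; case: dd' => ->; rewrite ?addr0.
  + exists (fun n => x n - varpi (ln n%:R) * n%:R `^ beta); split; last first.
      by move=> n n1; rewrite Ex// addrC subrK.
    apply/eqoP => e e0; have [N0 hN0] := vlim e e0.
    exists N0 => // n /= Nn; rewrite (ger0_norm (powR_ge0 _ _)); exact: hN0.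
  + by move=> /Lall /vcst.
  + move=> phi0 phipos; have [w [w0 hw]] := vpos phi0 phipos.
    by exists w; split => // z; apply: le_trans (hw z) (ler_norm _).
- split.
  + by apply: adm01 => t; rewrite /toll_leaf; case: asboolP => _; rewrite ?lexx ?ler01.
  + by apply: adm01 => t; rewrite /toll_one lexx ler01.
  + by move=> k _; apply: adm01 => t; rewrite /toll_delta; case: eqP => _; rewrite ?lexx ?ler01.
Qed.
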